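(* Consider the decentralized stochastic convex optimization problem described in the context, with $M$ workers, smoothness $L$, noise level $\sigma$, heterogeneity at the optimum $\zeta_\star$, and gossip matrix $P$ with $1-\lambda_2(P)\ge\rho$, $\rho\in(0,1]$; assume in addition that $f$ is $\mu$-strongly convex ($\mu>0$). Let $\Delta_0\ge f(x_0)-f(x^\star)$, fix $0<\epsilon\le\Delta_0$, and set $$K:=\left\lceil\log_2\frac{\Delta_0}{\epsilon}\right\rceil,\qquad \Delta_s:=\frac{\Delta_0}{2^s},\qquad R_s:=\sqrt{\frac{2\Delta_0}{\mu2^s}},\qquad 0\le s\le K.$$ Let $$\ell_\epsilon:=\max\left\{60,\ \log\left[\frac{2^{100}}{\rho\sqrt M}\left(1+\frac{\zeta_\star+\sigma}{L\sqrt{\epsilon/\mu}}\right)\left(1+\frac{\sigma^2}{\mu\epsilon}+M\sqrt{\frac{L}{\mu\rho}}\right)\right]\right\},$$ and choose the epoch budgets $$N_s:=\left\lceil2^{16}\frac{\sigma^2}{\mu\epsilon}+2^{18}M\sqrt{\frac{L}{\mu\rho}}\,\ell_\epsilon^2\right\rceil,\qquad 0\le s<K.$$ Define $$\Lambda_s:=\frac{100N_s}{\sqrt M}\left(1+\frac{\zeta_\star+\sigma}{LR_s}\right),\qquad B_s:=\left\lceil\max\left\{1,\frac{20}{\sqrt\rho}\log\frac{\Lambda_s}{\rho}\right\}\right\rceil,$$ and assume that $T_s:=N_s/(MB_s)$ is a positive integer for every $0\le s<K$. Run the restarted algorithm described in the context with these epoch budgets and radii. Then the returned local outputs (the columns $U^{(K)}_{\cdot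 i}$ of $U^{(K)}$) satisfy $$\max_{1\le i\le M}\mathbb E[f(U^{(K)}_{\cdot i})-f(x^\star)]\le\epsilon,$$ with total sample complexity $$N=\sum_{s=0}^{K-1}N_s\le K\left(1+2^{16}\frac{\sigma^2}{\mu\epsilon}+2^{18}M\sqrt{\frac{L}{\mu\rho}}\,\ell_\epsilon^2\right)=\widetilde O\!\left(\frac{\sigma^2}{\mu\epsilon}+M\sqrt{\frac{L}{\mu\rho}}\log\frac{\Delta_0}{\epsilon}\right),$$ where $\widetilde O$ hides factors logarithmic in the target accuracy and the problem parameters.
   Context: Notation: $\|\cdot\|$ is the Euclidean norm, $\mathbf 1\in\mathbb R^M$ is the all-ones vector. Problem. $f(x)=\frac1M\sum_{i=1}^M f_i(x)$, where each $f_i:\mathbb R^d\to\mathbb R$ is convex, differentiable and $L$-smooth ($L$-Lipschitz gradient), $L>0$; $x^\star\in\arg\min_xf(x)$ (nonempty). Worker $i$ has a stochastic gradient oracle $G_i(x,\xi)$ with $\mathbb E[G_i(x,\xi)\mid x]=\nabla f_i(x)$ and $\mathbb E[\|G_i(x,\xi)-\nabla f_i(x)\|^2\mid x]\le\sigma^2$; all oracle samples are conditionally independent given past queries. $\zeta_\star\ge0$ satisfies $\frac1M\sum_{i=1}^M\|\nabla f_i(x^\star)-\nabla f(x^\star)\|^2\le\zeta_\star^2$. Gossip matrix. $P\in[0,1]^{M\times M}$ is symmetric and doubly stochastic, supported on an undirected communication graph on $\{1,\dots,M\}$ ($P_{ij}=0$ if $i\ne j$ and $\{i,j\}$ is not an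 edge), with eigenvalues $1=\lambda_1(P)\ge\lambda_2(P)\ge\dots\ge\lambda_M(P)\ge-1$ and $1-\lambda_2(P)\ge\rho$. Algorithm DDA-SGD started from $U\in\mathbb R^{d\times M}$ with horizon $T$, block length $B$ and parameters $\alpha_{\rm g},\beta_{\rm g},(\theta_t)_{t=0}^T,(m_t)_{t=0}^{T+1},(\eta_t)_{t=0}^T$. Set $X_{-1}=X_0=Z_0=Q_0=\widetilde X_{-1}=U$. For $t=0,1,\dots,T$: (1) with $q_{t,i}$ the $i$-th column of $Q_t$, node $i$ draws fresh samples $\xi_{t,i}^{(1)},\dots,\xi_{t,i}^{(B)}$ and forms $g_{t,i}=\frac1B\sum_{s=1}^BG_i(q_{t,i},\xi_{t,i}^{(s)})$; (2) $Y_t^{(-1)}=Y_t^{(0)}=X_t$, and for $s=1,\dots,B$: $V_t^{(s)}=Y_t^{(s-1)}+\beta_{\rm g}(Y_t^{(s-1)}-Y_t^{(s-2)})$, $Y_t^{(s)}=(1-\alpha_{\rm g})V_t^{(s)}+\alpha_{\rm g}V_t^{(s)}P$; (3) $\widetilde X_t=Y_t^{(B)}$, $Q_{t+1}=\widetilde X_t+m_t(1+m_{t+1})(\widetilde X_t-\widetilde X_{t-1})$; (4) with $G_t=[g_{t,1},\dots,g_{t,M}]$: $Z_{t+1}=Z_t-\eta_tG_t$, $X_{t+1}=(1-\theta_t)X_t+\theta_tZ_{t+1}$. Output: the matrix $\widetilde X_T$ of local outputs. Parameter rules for budget $N$ and radius $R$ (with corresponding $B$ and $T=N/(MB)$): $\alpha_{\rm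 g}=\frac12$, $\beta_{\rm g}=\frac{1-\sqrt{\rho/2}}{1+\sqrt{\rho/2}}$; $a_t=\frac{t+1}{128L}$, $\theta_t=\frac{2}{t+2}$ for $0\le t<T$, $\theta_T=0$; $m_0=0$, $m_t=\frac{t-1}{t+2}$ for $1\le t\le T$, $m_{T+1}=0$; $\beta=1+\frac{\sigma}{R\sqrt{MB}}\sqrt{\sum_{i=0}^{T-1}a_i^2}$; $\eta_t=a_t/\beta$ for $0\le t<T$, $\eta_T=0$. Restarted algorithm. Set $U^{(0)}=x_0\mathbf 1^\top$. For $s=0,\dots,K-1$: run DDA-SGD started from $U^{(s)}$ with budget $N=N_s$, radius $R=R_s$, block length $B=B_s$, horizon $T=T_s$ and parameters $\alpha_{\rm g}=\frac12$, $\beta_{\rm g}=\frac{1-\sqrt{\rho/2}}{1+\sqrt{\rho/2}}$; $a_t=\frac{t+1}{128L}$, $\theta_t=\frac{2}{t+2}$ for $0\le t<T_s$, $\theta_{T_s}=0$; $m_0=0$, $m_t=\frac{t-1}{t+2}$ for $1\le t\le T_s$, $m_{T_s+1}=0$; $\beta=1+\frac{\sigma}{R_s\sqrt{MB_s}}\sqrt{\sum_{i=0}^{T_s-1}a_i^2}$; $\eta_t=a_t/\beta$ for $0\le t<T_s$, $\eta_{T_s}=0$ (using fresh oracle samples), and let $U^{(s+1)}$ be its output matrix $\widetilde X_{T_s}$. Node $i$ outputs the $i$-th column of $U^{(K)}$.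
   Formalization: The soft-O estimate is proved for ε ≤ Δ₀/2 only: as ε tends to Δ₀ with σ = 0, K = 1 while log(Δ₀/ε) tends to 0, so it fails uniformly there; the error guarantee and the explicit bound on N hold for all 0 < ε ≤ Δ₀. *)

(* Defs.v *)
From HB Require Import structures.
From mathcomp Require Import all_boot all_order all_algebra.
From mathcomp Require Import all_classical all_reals all_analysis.
Import Order.TTheory GRing.Theory Num.Theory.
Import numFieldNormedType.Exports.

Set Implicit Arguments.
Unset Strict Implicit.
Unset Printing Implicit Defensive.

Local Open Scope classical_set_scope.
Local Open Scope ring_scope.

(* The library norm on matrices is the sup norm, hence a separate Euclidean
   norm. Sup and Euclidean norms induce the same topology, so [differentiable]
   and ['D_] keep their usual meaning. *)
Definition enorm {R : realType} {d : nat} (v : 'cV[R]_d) : R :=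
  Num.sqrt (\sum_(k < d) v k 0 ^+ 2).

Definition gradient {R : realType} {d : nat} (f : 'cV[R]_d -> R)
    (x : 'cV[R]_d) : 'cV[R]_d :=
  \col_(k < d) ('D_(delta_mx k 0 : 'cV[R]_d) (f : 'cV[R]_d -> R^o) x).

Definition L_smooth {R : realType} {d : nat} (L : R) (f : 'cV[R]_d -> R) : Prop :=
  (forall x : 'cV[R]_d, differentiable (f : 'cV[R]_d -> R^o) x) /\
  (forall x y : 'cV[R]_d,
     enorm (gradient f x - gradient f y) <= L * enorm (x - y)).

Definition convex_on_space {R : realType} {d : nat} (f : 'cV[R]_d -> R) : Prop :=
  @convex_function R 'cV[R]_d setT f.

Definition strongly_convex {R : realType} {d : nat} (mu : R)
    (f : 'cV[R]_d -> R) : Prop :=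
  forall (x y : 'cV[R]_d) (t : R), 0 <= t <= 1 ->
    f (t *: x + (1 - t) *: y) <=
    t * f x + (1 - t) * f y - mu / 2 * t * (1 - t) * enorm (x - y) ^+ 2.

Definition average {R : realType} {d M : nat} (f : 'I_M -> 'cV[R]_d -> R)
    (x : 'cV[R]_d) : R :=
  (M%:R)^-1 * \sum_(i < M) f i x.

Definition gossip_matrix {R : realType} {M : nat} (edge : rel 'I_M)
    (W : 'M[R]_M) : Prop :=
  [/\ forall i j, 0 <= W i j <= 1,
      W^T = W,
      forall i, \sum_(j < M) W i j = 1,
      forall j, \sum_(i < M) W i j = 1 &
      forall i j, i != j -> ~~ edge i j -> W i j = 0].

(* [lam] lists the eigenvalues of [W], with multiplicity, in nonincreasing
   order. Indices start at 0: the second largest eigenvalue is the value of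
   [lam] at the index equal to 1 (there is none when M = 1). *)
Definition ordered_spectrum {R : realType} {M : nat} (W : 'M[R]_M)
    (lam : 'I_M -> R) : Prop :=
  char_poly W = \prod_(i < M) ('X - (lam i)%:P) /\
  (forall i j : 'I_M, (i <= j)%N -> lam j <= lam i).

(* [cond_exp_version P F X Y]: Y is a version of E[X | F], where F is a
   sub-sigma-algebra of the ambient one. *)
Definition cond_exp_version {disp : measure_display}
    {Omega : measurableType disp} {R : realType} (P : probability Omega R)
    (F : set (set Omega)) (X Y : Omega -> R) : Prop :=
  [/\ P.-integrable setT (EFin \o X),
      P.-integrable setT (EFin \o Y),
      forall S : set R, measurable S -> F (Y @^-1` S) &
      forall A : set Omega, F A ->
        (\int[P]_(w in A) (X w)%:E = \int[P]_(w in A) (Y w)%:E)%E].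

Definition sigma_of {Omega : Type} {R : realType} {d : nat}
    (X : Omega -> 'cV[R]_d) : set (set Omega) :=
  <<s [set A | exists (k : 'I_d) (S : set R),
         measurable S /\ A = (fun w => X w k 0) @^-1` S] >>.

(* Events A_j in H_j are independent given F when the product of versions of
   P(A_j | F) is a version of P(\bigcap_j A_j | F). Subfamilies are covered by
   taking A_j to be the whole space. *)
Definition cond_independent {disp : measure_display}
    {Omega : measurableType disp} {R : realType} (P : probability Omega R)
    (F : set (set Omega)) {J : finType} (H : J -> set (set Omega)) : Prop :=
  forall (A : J -> set Omega) (p : J -> Omega -> R),
    (forall j, H j (A j)) ->
    (forall j, cond_exp_version P F (\1_(A j)) (p j)) ->
    cond_exp_version P F (\1_(\bigcap_(j in [set: J]) A j))
      (fun w => \prod_(j : J) p j w).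

Record dda_params (R : realType) := DdaParams {
  horizon : nat;
  block : nat;
  alpha_g : R;
  beta_g : R;
  theta : nat -> R;
  mom : nat -> R;
  eta : nat -> R
}.

(* The pair (Y^(s), Y^(s-1)). *)
Fixpoint gossip_iter {R : realType} {d M : nat} (al be : R) (W : 'M[R]_M)
    (X : 'M[R]_(d, M)) (s : nat) : 'M[R]_(d, M) * 'M[R]_(d, M) :=
  if s is s'.+1 then
    let: (Y, Y') := gossip_iter al be W X s' in
    let V := Y + be *: (Y - Y') in
    ((1 - al) *: V + al *: (V *m W), Y)
  else (X, X).

(* State at the beginning of round t: X_t, Z_t, Q_t and the previous gossip
   output [dXg] = \tilde X_{t-1}. *)
Record dda_state (R : realType) (d M : nat) := DdaState {
  dX : 'M[R]_(d, M);
  dZ : 'M[R]_(d, M);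
  dQ : 'M[R]_(d, M);
  dXg : 'M[R]_(d, M)
}.

Definition dda_step {R : realType} {d M : nat} (prm : dda_params R)
    (W : 'M[R]_M) (t : nat) (Gt : 'M[R]_(d, M)) (st : dda_state R d M) :
    dda_state R d M :=
  let Xg := (gossip_iter (alpha_g prm) (beta_g prm) W (dX st) (block prm)).1 in
  let Z' := dZ st - eta prm t *: Gt in
  DdaState ((1 - theta prm t) *: dX st + theta prm t *: Z')
           Z'
           (Xg + (mom prm t * (1 + mom prm t.+1)) *: (Xg - dXg st))
           Xg.

Fixpoint dda_run {R : realType} {d M : nat} (prm : dda_params R)
    (W : 'M[R]_M) (orc : nat -> 'M[R]_(d, M) -> 'M[R]_(d, M))
    (U : 'M[R]_(d, M)) (t : nat) : dda_state R d M :=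
  if t is t'.+1 then
    let st := dda_run prm W orc U t' in
    dda_step prm W t' (orc t' (dQ st)) st
  else DdaState U U U U.

(* Column i is the average over b < B of G_i(q_i, z_{i,b}), with q_i the i-th
   column of Q. *)
Definition minibatch {R : realType} {d M : nat} {Xi : 'I_M -> Type}
    (G : forall i : 'I_M, 'cV[R]_d -> Xi i -> 'cV[R]_d) (B : nat)
    (z : forall i : 'I_M, nat -> Xi i) (Q : 'M[R]_(d, M)) : 'M[R]_(d, M) :=
  \matrix_(k < d, i < M)
    ((B%:R)^-1 * \sum_(b < B) G i (col i Q) (z i b) k 0).

Definition dda_sgd_state {R : realType} {d M : nat} {Xi : 'I_M -> Type}
    (prm : dda_params R) (W : 'M[R]_M)
    (G : forall i : 'I_M, 'cV[R]_d -> Xi i -> 'cV[R]_d)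
    (z : nat -> forall i : 'I_M, nat -> Xi i)
    (U : 'M[R]_(d, M)) (t : nat) : dda_state R d M :=
  dda_run prm W (fun r Q => minibatch G (block prm) (z r) Q) U t.

(* Rounds are 0, ..., T, so the output \tilde X_T is stored in the state
   reached after T + 1 rounds. *)
Definition dda_sgd {R : realType} {d M : nat} {Xi : 'I_M -> Type}
    (prm : dda_params R) (W : 'M[R]_M)
    (G : forall i : 'I_M, 'cV[R]_d -> Xi i -> 'cV[R]_d)
    (z : nat -> forall i : 'I_M, nat -> Xi i)
    (U : 'M[R]_(d, M)) : 'M[R]_(d, M) :=
  dXg (dda_sgd_state prm W G z U (horizon prm).+1).

(* [z s t i b] is the b-th sample drawn by node i in round t of epoch s. *)
Fixpoint restarted {R : realType} {d M : nat} {Xi : 'I_M -> Type}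
    (prm : nat -> dda_params R) (W : 'M[R]_M)
    (G : forall i : 'I_M, 'cV[R]_d -> Xi i -> 'cV[R]_d)
    (z : nat -> nat -> forall i : 'I_M, nat -> Xi i)
    (x0 : 'cV[R]_d) (s : nat) : 'M[R]_(d, M) :=
  if s is s'.+1 then
    dda_sgd (prm s') W G (z s') (restarted prm W G z x0 s')
  else x0 *m const_mx 1.

(* Column i of Q_t in epoch s. *)
Definition query {R : realType} {d M : nat} {Xi : 'I_M -> Type}
    (prm : nat -> dda_params R) (W : 'M[R]_M)
    (G : forall i : 'I_M, 'cV[R]_d -> Xi i -> 'cV[R]_d)
    (z : nat -> nat -> forall i : 'I_M, nat -> Xi i)
    (x0 : 'cV[R]_d) (s t : nat) (i : 'I_M) : 'cV[R]_d :=
  col i (dQ (dda_sgd_state (prm s) W G (z s) (restarted prm W G z x0 s) t)).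

Definition a_coef {R : realType} (L : R) (t : nat) : R := (t.+1)%:R / (128 * L).

Definition beta_coef {R : realType} (M : nat) (L sigma rad : R) (T B : nat) : R :=
  1 + sigma / (rad * Num.sqrt (M%:R * B%:R)) *
      Num.sqrt (\sum_(i < T) a_coef L i ^+ 2).

Definition rule_params {R : realType} (M : nat) (L sigma rho rad : R)
    (T B : nat) : dda_params R :=
  DdaParams T B (1 / 2)
    ((1 - Num.sqrt (rho / 2)) / (1 + Num.sqrt (rho / 2)))
    (fun t => if (t < T)%N then 2 / (t%:R + 2) else 0)
    (fun t => if (0 < t <= T)%N then (t%:R - 1) / (t%:R + 2) else 0)
    (fun t => if (t < T)%N then a_coef L t / beta_coef M L sigma rad T B else 0).

(* The arguments of the ceilings below are nonnegative in their range of use,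
   so that [absz] only converts from int to nat. *)
Definition nat_ceil {R : realType} (x : R) : nat := `|Num.ceil x|%N.

Definition num_epochs {R : realType} (Delta0 eps : R) : nat :=
  nat_ceil (ln (Delta0 / eps) / ln 2).

Definition epoch_radius {R : realType} (mu Delta0 : R) (s : nat) : R :=
  Num.sqrt (2 * Delta0 / (mu * 2 ^+ s)).

Definition ell {R : realType} (M : nat) (L mu sigma zeta rho eps : R) : R :=
  Num.max 60
    (ln (2 ^+ 100 / (rho * Num.sqrt M%:R)
         * (1 + (zeta + sigma) / (L * Num.sqrt (eps / mu)))
         * (1 + sigma ^+ 2 / (mu * eps) + M%:R * Num.sqrt (L / (mu * rho))))).

Definition budget_real {R : realType} (M : nat) (L mu sigma zeta rho eps : R) : R :=
  2 ^+ 16 * (sigma ^+ 2 / (mu * eps))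
  + 2 ^+ 18 * M%:R * Num.sqrt (L / (mu * rho))
    * ell M L mu sigma zeta rho eps ^+ 2.

Definition Lambda {R : realType} (M : nat) (L sigma zeta rad : R) (N : nat) : R :=
  100 * N%:R / Num.sqrt M%:R * (1 + (zeta + sigma) / (L * rad)).

Definition block_length {R : realType} (M : nat) (L sigma zeta rho rad : R)
    (N : nat) : nat :=
  nat_ceil (Num.max 1
    (20 / Num.sqrt rho * ln (Lambda M L sigma zeta rad N / rho))).

(* A power of a sum of logarithms of the quantities in [vs]: the factor hidden
   by a soft-O whose constants are C and p. *)
Definition log_factor {R : realType} (p : nat) (vs : seq R) : R :=
  (1 + \sum_(v <- vs) `|ln v|) ^+ p.

(* Main.v *)
(* The gossip matrix preserves averages over the nodes, so the averages of X_t,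
   Z_t and Q_t perform accelerated dual averaging on f with the inexact
   first-order oracle [mean (grads f_ Q_t)], whose defect is of the order of the
   dispersion of Q_t around its average, and with a noise of variance
   sigma^2 / (M B). Accelerated gossip multiplies the dispersion by
   (4 / rho) (1 - sqrt (rho / 2))^B, and B is so large that a dispersion at most
   R_s^2 / N^4 is reproduced in every round, which is negligible at the scale of
   the objective. Hence an epoch that starts with squared distance at most R_s^2
   from the average to xstar and with dispersion at most R_s^2 / N^4 ends with
   an average whose gap is at most Delta_s / 8 in expectation; strong convexity
   turns this gap into the same two bounds with R_{s+1} = R_s / sqrt 2. *)
Require Import Defs.
From HB Require Import structures.
From mathcomp Require Import all_boot all_order all_algebra.
From mathcomp Require Import all_classical all_reals all_analysis.
From mathcomp Require Import measurable_realfun complex ring lra.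
Import Order.TTheory GRing.Theory Num.Theory.
Import numFieldNormedType.Exports.

Set Implicit Arguments.
Unset Strict Implicit.
Unset Printing Implicit Defensive.

Local Open Scope classical_set_scope.
Local Open Scope ring_scope.

(** * Integration and conditional expectation *)

(** Two circularities shape the proof. The dispersion of Q_t depends on the size of the stochastic
    gradients, which is not bounded a priori but grows with the distance from the queries to xstar;
    that distance is controlled by the potential, whose error terms contain the dispersion.
    [state_bounds] closes this loop by strong induction on the round, the potential at round t using
    only the dispersion of earlier rounds. Among the parameters, N_s contains [ell] while B_s
    contains the logarithm of N_s; the constants 2^100 and 60 inside [ell] provide the slack that
    resolves this. The query Q_t is extrapolated from delayed averages and misses X_{t+1} by the
    last two increments of Z; the factor 128 in [a_coef] makes this lag small enough to be absorbed
    by the proximal term. Independence is given for events only, whereas the variance gain 1/(MB)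
    needs vanishing covariances; these are reached through versions of conditional probabilities,
    obtained from Radon-Nikodym. Measurability of f along the run is never established: gaps are
    bounded pathwise by integrable majorants. *)

Definition smeas {T : Type} {R : realType} (F : set (set T)) (X : T -> R) :=
  forall S : set R, measurable S -> F (X @^-1` S).

(** The generated type carries F as its own sigma-algebra, so that [smeas] inherits closure under
    sums and scalings from [measurable_fun]. *)
Lemma smeasP {T : pointedType} {R : realType} (F : set (set T)) (X : T -> R) :
  sigma_algebra setT F ->
  smeas F X <-> measurable_fun [set: g_sigma_algebraType F] (X : g_sigma_algebraType F -> R).
Proof.
move=> sF; split => [h _ S mS|h S mS].
  by rewrite setTI; apply: sub_sigma_algebra; exact: h.
have := h measurableT S mS; rewrite setTI.
by rewrite /measurable/= (sigma_algebra_id sF).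
Qed.

Section measure_lemmas.
Context d (T : measurableType d) (R : realType) (P : probability T R).
Implicit Types (X Y D : T -> R) (F G H : set (set T)).
Local Notation E X := (\int[P]_w (X w))%R.

Lemma RintegralT_sum (I : Type) (s : seq I) (Q : pred I) (h : I -> T -> R) :
  (forall i, Q i -> P.-integrable setT (EFin \o h i)) ->
  P.-integrable setT (EFin \o (fun w => \sum_(i <- s | Q i) h i w)) /\
  \int[P]_w (\sum_(i <- s | Q i) h i w) = \sum_(i <- s | Q i) \int[P]_w (h i w).
Proof.
move=> ih; elim: s => [|i s [IH1 IH2]].
  split.
    rewrite (_ : _ \o _ = cst 0%E); first exact: integrable0.
    by apply/funext => w /=; rewrite big_nil.
  rewrite big_nil; under eq_Rintegral do rewrite big_nil.
  by rewrite Rintegral_cst ?mul0r.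
have [Qi|nQi] := boolP (Q i); last first.
  split.
    rewrite (_ : _ \o _ = EFin \o (fun w => \sum_(i <- s | Q i) h i w)) //.
    by apply/funext => w /=; rewrite big_cons (negbTE nQi).
  by under eq_Rintegral do rewrite big_cons (negbTE nQi); rewrite big_cons (negbTE nQi).
split.
  rewrite (_ : _ \o _ = (EFin \o h i) \+ (EFin \o (fun w => (\sum_(i <- s | Q i) h i w)%R)))%E.
    by apply: integrableD => //; exact: ih.
  by apply/funext => w /=; rewrite big_cons Qi EFinD.
under eq_Rintegral do rewrite big_cons Qi.
by rewrite RintegralD ?big_cons ?Qi ?IH2 //; exact: ih.
Qed.

Lemma integrableZlR c X : P.-integrable setT (EFin \o X) ->
  P.-integrable setT (EFin \o (fun w => c * X w)).
Proof.
move=> iX; rewrite (_ : _ \o _ = (fun x => c%:E * (EFin \o X) x)%E).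
  exact: integrableZl.
by apply/funext => w /=; rewrite EFinM.
Qed.

Lemma integrableDR X Y : P.-integrable setT (EFin \o X) ->
  P.-integrable setT (EFin \o Y) ->
  P.-integrable setT (EFin \o (fun w => X w + Y w)).
Proof.
move=> iX iY; rewrite (_ : _ \o _ = (EFin \o X) \+ (EFin \o Y))%E.
  exact: integrableD.
by apply/funext => w /=; rewrite EFinD.
Qed.

Lemma integrableBR X Y : P.-integrable setT (EFin \o X) ->
  P.-integrable setT (EFin \o Y) ->
  P.-integrable setT (EFin \o (fun w => X w - Y w)).
Proof.
move=> iX iY; rewrite (_ : _ \o _ = (EFin \o X) \- (EFin \o Y))%E.
  exact: integrableB.
by apply/funext => w /=; rewrite EFinB.
Qed.

Lemma integrable_cstR (c : R) : P.-integrable setT (EFin \o (fun _ : T => c)).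
Proof. exact: finite_measure_integrable_cst. Qed.

Lemma integrable_dom X Y : measurable_fun setT X ->
  (forall w, `|X w| <= Y w) -> P.-integrable setT (EFin \o Y) ->
  P.-integrable setT (EFin \o X).
Proof.
move=> mX XY; apply: le_integrable => //; first exact/measurable_EFinP.
by move=> w _ /=; rewrite lee_fin (le_trans (XY w)) // ler_norm.
Qed.

Lemma smeas_measurable F X : F `<=` measurable -> smeas F X -> measurable_fun setT X.
Proof. by move=> FT mX _ S mS; rewrite setTI; apply: FT; exact: mX. Qed.

Lemma Rintegral_setI A X : measurable A ->
  \int[P]_(w in A) X w = \int[P]_w (X w * \1_A w).
Proof.
move=> mA; rewrite Rintegral_mkcond; apply: eq_Rintegral => w _.
by rewrite patchE indicE; case: ifP; rewrite ?mulr1 ?mulr0.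
Qed.

Import HBNNSimple.
(** Orthogonality to the indicators of G extends to G-simple functions by linearity, then to
    nonnegative X by approximation from below, with |X D| as dominating function. *)
Lemma Rintegral_orthogonal_pos G D X : sigma_algebra setT G -> G `<=` measurable ->
  P.-integrable setT (EFin \o D) ->
  (forall A, G A -> \int[P]_(w in A) D w = 0) ->
  smeas G X -> (forall w, 0 <= X w) ->
  P.-integrable setT (EFin \o (fun w => X w * D w)) ->
  \int[P]_w (X w * D w) = 0.
Proof.
move=> sG GT iD D0 mX X0 iXD.
have mX' : measurable_fun [set: g_sigma_algebraType G]
    (EFin \o (X : g_sigma_algebraType G -> R)).
  apply/measurable_EFinP => _ S mS; rewrite setTI.
  by apply: sub_sigma_algebra; exact: mX.
(* The approximants are built on the type generated by G, so that their level sets lie in G and not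
   merely in the ambient sigma-algebra. *)
pose h := nnsfun_approx (@measurableT _ (g_sigma_algebraType G)) mX'.
have mXT := smeas_measurable GT mX.
have mDT : measurable_fun setT D.
  by apply/measurable_EFinP; exact: measurable_int iD.
have Gpre n y : G (h n @^-1` [set y]).
  have : measurable ((h n : g_sigma_algebraType G -> R) @^-1` [set y]).
    exact: measurable_sfunP.
  by rewrite {1}/measurable/= (sigma_algebra_id sG).
have mh n : measurable_fun setT (h n : T -> R).
  move=> _ S mS; rewrite setTI; apply: GT.
  have : measurable ((h n : g_sigma_algebraType G -> R) @^-1` S).
    exact: measurable_sfunP.
  by rewrite {1}/measurable/= (sigma_algebra_id sG).
have hle n w : h n w <= X w.
  rewrite -lee_fin; have c := cvg_nnsfun_approx (@measurableT _ (g_sigma_algebraType G)) mX'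
    (fun x _ => X0 x) (I : setT w).
  have nd : {homo (fun k => (h k w)%:E) : m n / (m <= n)%N >-> (m <= n)%E}.
    by move=> a b ab; rewrite lee_fin; exact/lefP/nd_nnsfun_approx.
  have := nondecreasing_cvgn_le.
  have -> : (X w)%:E = limn (fun k => (h k w)%:E) by apply/esym/cvg_lim.
  by move=> _; have := ereal_nondecreasing_cvgn nd => /cvg_lim -> //; apply: ereal_sup_ubound; exists n.
have h0 n w : 0 <= h n w by [].
have I0 n : \int[P]_w (h n w * D w) = 0.
  have -> : \int[P]_w (h n w * D w) =
      \int[P]_w (\sum_(y <- finmap.enum_fset (fset_set (range (h n)))) y * (D w * \1_(h n @^-1` [set y]) w)).
    apply: eq_Rintegral => w _; rewrite [in LHS](fimfunE (h n)) fsbig_finite //= mulr_suml.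
    by apply: eq_bigr => y _; rewrite -mulrA (mulrC (\1_ _ _)).
  have iDA y : P.-integrable setT (EFin \o (fun w => D w * \1_(h n @^-1` [set y]) w)).
    apply: (@integrable_dom _ (fun w => `|D w|)).
    - apply: measurable_funM => //; apply: measurable_indic; exact: GT.
    - move=> w; rewrite normrM ler_piMr // indicE; case: (_ \in _); by rewrite ?normr1 ?normr0.
    - have := integrable_abse iD; by apply: eq_integrable.
  rewrite (proj2 (RintegralT_sum _ _)); last by move=> y _; exact: integrableZlR.
  rewrite big1 // => y _; rewrite RintegralZl // -Rintegral_setI ?D0 ?mulr0 //; exact: GT.
have [_ _ cv] := @dominated_convergence _ _ _ P setT measurableT
  (fun n w => (h n w * D w)%:E) (fun w => (X w * D w)%:E) (fun w => `|X w * D w|%:E)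
  (fun n => (measurable_EFinP _ _).2 (measurable_funM (mh n) mDT))
  ((measurable_EFinP _ _).2 (measurable_funM mXT mDT))
  ltac:(apply: aeW => w _; under eq_fun do rewrite EFinM; rewrite EFinM; apply: cvgeZr => //;
     exact: (cvg_nnsfun_approx (@measurableT _ (g_sigma_algebraType G)) mX' (fun x _ => X0 x) (I : setT w)))
  ltac:(have := integrable_abse iXD; by apply: eq_integrable)
  ltac:(apply: aeW => w n _ /=; rewrite lee_fin !normrM ler_wpM2r // !ger0_norm //).
have : (\int[P]_x (X x * D x)%:E = 0)%E.
  apply: cvg_unique cv _; first exact: ereal_hausdorff.
  rewrite (_ : (fun _ => _) = cst 0%E); first exact: cvg_cst.
  apply/funext => n /=; have := I0 n; rewrite /Rintegral => e0.
  rewrite -[LHS]fineK ?e0 // integrable_fin_num //.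
  apply: (@integrable_dom _ (fun w => `|X w * D w|)).
  - exact: measurable_funM.
  - by move=> w; rewrite !normrM ler_wpM2r // !ger0_norm.
  - have := integrable_abse iXD; by apply: eq_integrable.
by rewrite /Rintegral => ->.
Qed.

Lemma Rintegral_orthogonal G D X : sigma_algebra setT G -> G `<=` measurable ->
  P.-integrable setT (EFin \o D) ->
  (forall A, G A -> \int[P]_(w in A) D w = 0) ->
  smeas G X ->
  P.-integrable setT (EFin \o (fun w => X w * D w)) ->
  \int[P]_w (X w * D w) = 0.
Proof.
move=> sG GT iD D0 mX iXD.
have mDT : measurable_fun setT D.
  by apply/measurable_EFinP; exact: measurable_int iD.
pose Xp w := Num.max (X w) 0; pose Xn w := Num.max (- X w) 0.
have mp : smeas G Xp.
  have m : measurable_fun setT (fun x : R => Num.max x 0).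
    by apply: measurable_maxr => //.
  move=> S mS; have := mX _ (m measurableT _ mS); by rewrite setTI.
have mn : smeas G Xn.
  have m : measurable_fun setT (fun x : R => Num.max (- x) 0).
    by apply: measurable_maxr => //.
  move=> S mS; have := mX _ (m measurableT _ mS); by rewrite setTI.
have aXD := integrable_abse iXD.
have ip : P.-integrable setT (EFin \o (fun w => Xp w * D w)).
  apply: (@integrable_dom _ (fun w => `|X w * D w|)).
  - apply: measurable_funM => //; exact: smeas_measurable mp.
  - move=> w; rewrite !normrM ler_wpM2r // /Xp; case: (leP (X w) 0) => h; by rewrite ?normr0.
  - by apply: eq_integrable aXD.
have in' : P.-integrable setT (EFin \o (fun w => Xn w * D w)).
  apply: (@integrable_dom _ (fun w => `|X w * D w|)).
  - apply: measurable_funM => //; exact: smeas_measurable mn.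
  - move=> w; rewrite !normrM ler_wpM2r // /Xn; case: (leP (- X w) 0) => h; by rewrite ?normr0 ?normrN.
  - by apply: eq_integrable aXD.
have -> : \int[P]_w (X w * D w) = \int[P]_w (Xp w * D w - Xn w * D w).
  apply: eq_Rintegral => w _; rewrite -mulrBl; congr (_ * _).
  by rewrite /Xp /Xn; case: (leP (X w) 0) => h; case: (leP (- X w) 0) => h'; lra.
by rewrite RintegralB // !(@Rintegral_orthogonal_pos G) ?subrr // => w; rewrite le_max lexx orbT.
Qed.

End measure_lemmas.

(** * Restriction of a finite measure to a sub-sigma-algebra *)

Section sub_measure.
Context d (T : measurableType d) (R : realType).
Variables (m : {finite_measure set T -> \bar R}) (F : set (set T)).
Local Notation TF := (g_sigma_algebraType F).

Definition into_sub : T -> TF := id.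

(** The restriction to F is the image measure under the identity. The two proofs are arguments so
    that the measure instances can be attached to the resulting term. *)
Definition restr_sub (_ : sigma_algebra setT F) (_ : F `<=` measurable) :
  set TF -> \bar R := pushforward m into_sub.

Hypotheses (sF : sigma_algebra setT F) (FT : F `<=` measurable).

Lemma into_sub_measurable : measurable_fun setT into_sub.
Proof. by move=> _ A; rewrite setTI /measurable/= (sigma_algebra_id sF) => /FT. Qed.

Local Notation sub_measure := (restr_sub sF FT).

Let sub_measure0 : sub_measure set0 = 0%E.
Proof. by rewrite /restr_sub /pushforward preimage_set0 measure0. Qed.

Let sub_measure_ge0 A : (0 <= sub_measure A)%E.
Proof. by rewrite /restr_sub /pushforward measure_ge0. Qed.

Let sub_measure_additive : semi_sigma_additive sub_measure.
Proof.
move=> A mA tA mUA; apply: (@measure_semi_sigma_additive _ _ _ m A) => //.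
  by move=> n; have := mA n; rewrite {1}/measurable/= (sigma_algebra_id sF) => /FT.
by have := mUA; rewrite {1}/measurable/= (sigma_algebra_id sF) => /FT.
Qed.

HB.instance Definition _ := isMeasure.Build _ _ _ sub_measure
  sub_measure0 sub_measure_ge0 sub_measure_additive.

Let sub_measure_fin : fin_num_fun sub_measure.
Proof.
move=> A mA; apply: fin_num_measure.
by have := mA; rewrite {1}/measurable/= (sigma_algebra_id sF) => /FT.
Qed.

HB.instance Definition _ := Measure_isFinite.Build _ _ _ sub_measure sub_measure_fin.

End sub_measure.

(** * Conditional probabilities and uncorrelated variables *)

Section cond_exp.
Context d (T : measurableType d) (R : realType) (P : probability T R).
Implicit Types (X Y D : T -> R) (F G H : set (set T)).

(** The version is the Radon-Nikodym derivative of B |-> P(B [&] A) with respect to P, both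
    restricted to F. Existence matters because [cond_independent] only speaks about given
    versions. *)
Lemma cond_prob_exists F A : sigma_algebra setT F -> F `<=` measurable ->
  measurable A -> exists2 p, cond_exp_version P F (\1_A) p & forall w, 0 <= p w.
Proof.
move=> sF FT mA.
have Aoo : (P A < +oo)%E by rewrite ltey_eq fin_num_measure.
pose mu : {finite_measure set (g_sigma_algebraType F) -> \bar R} := restr_sub P sF FT.
pose nu : {finite_measure set (g_sigma_algebraType F) -> \bar R} :=
  restr_sub (mfrestr mA Aoo) sF FT.
have mE (B : set T) : F B -> (@measurable _ (g_sigma_algebraType F)) B.
  exact: sub_sigma_algebra.
have mE' (B : set T) : (@measurable _ (g_sigma_algebraType F)) B -> F B.
  by rewrite {1}/measurable/= (sigma_algebra_id sF).
have nu_mu : nu `<< mu.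
  apply/null_content_dominatesP => B mB; rewrite /= /restr_sub /pushforward /= => PB0.
  apply/eqP; rewrite eq_le measure_ge0 andbT -PB0; apply: le_measure.
  - by rewrite inE; apply: measurableI => //; exact: (FT _ (mE' _ mB)).
  - by rewrite inE; exact: (FT _ (mE' _ mB)).
  - exact: subIsetl.
have [f [f0 ffin fint fE]] := radon_nikodym_sigma_finite nu_mu.
have [mf _] := integrableP _ _ _ fint.
have mf' : measurable_fun [set: T] (f : T -> \bar R).
  move=> _ S mS; rewrite setTI; apply: (FT); apply: mE'.
  by have := mf measurableT S mS; rewrite setTI.
have ffin' w : f w = (fine (f w))%:E by rewrite fineK.
have int_mu (B : set T) : F B -> (\int[mu]_(x in B) f x = \int[P]_(x in B) f x)%E.
  move=> FB; rewrite (@ge0_integral_pushforward _ _ T (g_sigma_algebraType F) R (@into_sub _ T F) (into_sub_measurable sF FT) P B f) //.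
  - exact: mE.
  - exact: measurable_funTS.
have nuE (B : set T) : F B -> (P (B `&` A) = \int[P]_(x in B) f x)%E.
  by move=> FB; rewrite -int_mu // -fE //; apply: mE.
have FsetT : F setT by have [h0 hC _] := sF; have := hC _ h0; rewrite setD0.
exists (fine \o f); last by move=> w; rewrite /= fine_ge0.
split.
- apply: (@integrable_dom _ _ _ _ _ (fun=> 1)); first exact: measurable_indic.
    by move=> w; rewrite indicE; case: (_ \in _); rewrite ?normr1 ?normr0.
  exact: integrable_cstR.
- rewrite (_ : EFin \o _ = f); last by apply/funext => w /=; rewrite fineK.
  apply/integrableP; split => //.
  under eq_integral => w _ do rewrite gee0_abs //.
  by rewrite -(nuE _ FsetT) setTI ltey_eq fin_num_measure.
- move=> S mS; apply: mE'.
  have mfine : measurable_fun setT (fine : \bar R -> R) by [].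
  have mS' : measurable ((fine : \bar R -> R) @^-1` S).
    by have := mfine measurableT _ mS; rewrite setTI.
  by have := mf measurableT _ mS'; rewrite setTI.
- move=> B FB.
  rewrite integral_indic //; last exact: (FT).
  rewrite (setIC A B); apply: etrans (nuE _ FB) _.
  by apply: eq_integral => w _; rewrite /= fineK.
Qed.

Lemma cond_exp_orth F X Y : F `<=` measurable -> cond_exp_version P F X Y ->
  P.-integrable setT (EFin \o (fun w => X w - Y w)) /\
  forall A, F A -> \int[P]_(w in A) (X w - Y w) = 0.
Proof.
move=> FT [iX iY mY e]; split; first exact: integrableBR.
move=> A FA; rewrite RintegralB; first by rewrite /Rintegral e // subrr.
- exact: FT.
- by apply: integrableS iX => //; exact: (FT).
- by apply: integrableS iY => //; exact: (FT).
Qed.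

Lemma pull_out F X Y Z : sigma_algebra setT F -> F `<=` measurable ->
  cond_exp_version P F X Y -> smeas F Z ->
  P.-integrable setT (EFin \o (fun w => Z w * (X w - Y w))) ->
  \int[P]_w (Z w * (X w - Y w)) = 0.
Proof.
move=> sF FT /(cond_exp_orth FT)[i0 e0] mZ iZ.
exact: (Rintegral_orthogonal sF FT i0 e0 mZ iZ).
Qed.

(** Truncation at 1 makes the version bounded everywhere, hence square integrable, as the products
    in [uncorrelated] require. *)
Lemma cond_prob_exists01 F A : sigma_algebra setT F -> F `<=` measurable ->
  measurable A -> exists2 p, cond_exp_version P F (\1_A) p & forall w, 0 <= p w <= 1.
Proof.
move=> sF FT mA; have [p pA p0] := cond_prob_exists sF FT mA.
have [i1 ip mp e] := pA.
have mpT : measurable_fun setT p by exact: (smeas_measurable FT mp).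
pose q w := Num.min (p w) 1.
have q01 w : 0 <= q w <= 1 by rewrite /q le_min p0 ler01 /= ge_min lexx orbT.
exists q => //.
have mq : smeas F q.
  have m : measurable_fun setT (fun x : R => Num.min x 1) by apply: measurable_minr.
  by move=> S mS; have := mp _ (m measurableT _ mS); rewrite setTI.
have mqT : measurable_fun setT q by exact: (smeas_measurable FT mq).
have iq : P.-integrable setT (EFin \o q).
  apply: (@integrable_dom _ _ _ _ _ (fun=> 1)) => //; last exact: integrable_cstR.
  by move=> w; have /andP[a b] := q01 w; rewrite ger0_norm.
have ipq : P.-integrable setT (EFin \o (fun w => p w - q w)) by exact: integrableBR.
pose B := p @^-1` `]1, +oo[.
have FB : F B by apply: mp.
have mB := FT _ FB.
have pq w : p w - q w = (p w - 1) * \1_B w.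
  rewrite indicE /q; have [h|h] := leP (p w) 1.
    by rewrite memNset ?mulr0 ?subrr // /B /= in_itv /= andbT; apply/negP; rewrite -leNgt.
  by rewrite mem_set ?mulr1 // /B /= in_itv /= andbT.
(* On B, where p > 1, the integral of p is P(A [&] B) <= P(B). So the excess p - q, which is
   nonnegative and lives on B, has integral 0 on every event. *)
have I0 : \int[P]_w (p w - q w) <= 0.
  under eq_Rintegral do rewrite pq.
  rewrite -Rintegral_setI // RintegralB //; last 2 first.
  - by apply: integrableS ip.
  - by apply: integrableS (integrable_cstR _ _).
  rewrite subr_le0 /Rintegral -e //.
  have -> : (\int[P]_(_ in B) 1%:E = P B)%E by rewrite integral_cst // mul1e.
  rewrite integral_indic //; apply: fine_le; rewrite ?fin_num_measure //.
  - exact: measurableI.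
  - by apply: le_measure; rewrite ?inE //; exact: measurableI.
split => // C FC; rewrite e //.
have mC := FT _ FC.
have ipC : P.-integrable C (EFin \o p) by apply: integrableS ip.
have iqC : P.-integrable C (EFin \o q) by apply: integrableS iq.
have : \int[P]_(w in C) (p w - q w) = 0.
  apply/eqP; rewrite eq_le; apply/andP; split; last first.
    by apply: Rintegral_ge0 => w _; rewrite subr_ge0 ge_min lexx.
  apply: le_trans I0; rewrite Rintegral_setI //; apply: le_Rintegral => //.
  - apply: (@integrable_dom _ _ _ _ _ (fun w => p w - q w)) => //.
      by apply: measurable_funM; [exact: measurable_funB|exact: measurable_indic].
    move=> w; have d0 : 0 <= p w - q w by rewrite subr_ge0 ge_min lexx.
    by rewrite ger0_norm ?indicE; case: (_ \in _); rewrite ?mulr1 ?mulr0.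
  - move=> w _; have d0 : 0 <= p w - q w by rewrite subr_ge0 ge_min lexx.
    by rewrite indicE; case: (_ \in _); rewrite ?mulr1 ?mulr0.
rewrite RintegralB // => /eqP; rewrite subr_eq0 /Rintegral => /eqP h.
by rewrite -[LHS]fineK ?integrable_fin_num // -[RHS]fineK ?integrable_fin_num // h.
Qed.

Definition sqint X := measurable_fun setT X /\ P.-integrable setT (EFin \o (fun w => X w ^+ 2)).

Lemma sqintM X Y : sqint X -> sqint Y -> P.-integrable setT (EFin \o (fun w => X w * Y w)).
Proof.
move=> [mX iX] [mY iY].
apply: (@integrable_dom _ _ _ _ _ (fun w => X w ^+ 2 + Y w ^+ 2)).
- exact: measurable_funM.
- move=> w; rewrite normrM -(real_normK (num_real (X w))) -(real_normK (num_real (Y w))).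
  have := sqr_ge0 (`|X w| - `|Y w|); have := sqr_ge0 (`|X w|); have := sqr_ge0 (`|Y w|).
  by nra.
- exact: integrableDR.
Qed.

Lemma sqint_cst c : sqint (fun=> c).
Proof. by split => //; exact: integrable_cstR. Qed.

Lemma sqintZ c X : sqint X -> sqint (fun w => c * X w).
Proof.
move=> [mX iX]; split; first exact: measurable_funM.
by have := integrableZlR (c ^+ 2) iX; apply: eq_integrable => // w _ /=; rewrite exprMn.
Qed.

Lemma sqintD X Y : sqint X -> sqint Y -> sqint (fun w => X w + Y w).
Proof.
move=> sX sY; have iXY := sqintM sX sY; move: sX sY => [mX iX] [mY iY].
split; first exact: measurable_funD.
have := integrableDR (integrableDR iX iY) (integrableZlR 2 iXY).
by apply: eq_integrable => // w _ /=; congr EFin; ring.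
Qed.

Lemma sqintB X Y : sqint X -> sqint Y -> sqint (fun w => X w - Y w).
Proof.
move=> sX /(sqintZ (-1)) sY; have := sqintD sX sY.
by rewrite (_ : (fun w => X w + -1 * Y w) = (fun w => X w - Y w)) //; apply/funext => w; rewrite mulN1r.
Qed.

Lemma sqint_integrable X : sqint X -> P.-integrable setT (EFin \o X).
Proof.
by move=> /(sqintM (sqint_cst 1)); apply: eq_integrable => // w _ /=; rewrite mul1r.
Qed.

Lemma sqint_of_sqr X Y : measurable_fun setT X -> P.-integrable setT (EFin \o Y) ->
  (forall w, X w ^+ 2 <= Y w) -> sqint X.
Proof.
move=> mX iY h; split => //; apply: (integrable_dom _ _ iY).
  exact: measurable_funX.
by move=> w; rewrite ger0_norm ?sqr_ge0.
Qed.

(* Independence given F only concerns events: X1 - Y1 is first shown to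
   integrate to 0 on every event of H2, so that it is orthogonal to X2, while
   orthogonality to Y2 only uses that Y1 is a version of E[X1 | F]. *)
Lemma uncorrelated F H1 H2 X1 Y1 X2 Y2 :
  sigma_algebra setT F -> F `<=` measurable ->
  sigma_algebra setT H1 -> H1 `<=` measurable ->
  sigma_algebra setT H2 -> H2 `<=` measurable ->
  (forall A1 A2 p1 p2, H1 A1 -> H2 A2 ->
     cond_exp_version P F (\1_A1) p1 -> cond_exp_version P F (\1_A2) p2 ->
     cond_exp_version P F (\1_(A1 `&` A2)) (fun w => p1 w * p2 w)) ->
  smeas H1 X1 -> smeas H2 X2 ->
  cond_exp_version P F X1 Y1 -> cond_exp_version P F X2 Y2 ->
  sqint X1 -> sqint Y1 -> sqint X2 -> sqint Y2 ->
  \int[P]_w ((X1 w - Y1 w) * (X2 w - Y2 w)) = 0.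
Proof.
move=> sF FT sH1 H1T sH2 H2T ind mX1 mX2 c1 c2 q1 r1 q2 r2.
have FsetT : F setT by have [h0 hC _] := sF; have := hC _ h0; rewrite setD0.
have sq1 : sqint (fun w => X1 w - Y1 w) by exact: sqintB.
have key A2 : H2 A2 -> \int[P]_(w in A2) (X1 w - Y1 w) = 0.
  move=> HA2; have mA2 := H2T _ HA2.
  have [p2 cp2 p2b] := cond_prob_exists01 sF FT mA2.
  have [i2 ip2 mp2 _] := cp2.
  have mp2T := smeas_measurable FT mp2.
  have bp2 w : `|p2 w| <= 1 by have /andP[a b] := p2b w; rewrite ger0_norm.
  have sp2 : sqint p2.
    apply: (@sqint_of_sqr _ (fun=> 1)) => //; first exact: integrable_cstR.
    by move=> w; rewrite -(real_normK (num_real _)) expr_le1.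
  have sind (A : set T) : measurable A -> sqint (\1_A).
    move=> mA; apply: (@sqint_of_sqr _ (fun=> 1)); first exact: measurable_indic.
      exact: integrable_cstR.
    by move=> w; rewrite indicE; case: (_ \in _); rewrite ?expr1n ?expr0n.
  have s1p : sqint (fun w => \1_A2 w - p2 w) by apply: sqintB => //; exact: sind.
  (* P(A1 [&] A2) is the integral of p1 p2 by independence, and p2 being F-measurable this is the
     integral of p2 over A1. *)
  have step1 A1 : H1 A1 -> \int[P]_(w in A1) (\1_A2 w - p2 w) = 0.
    move=> HA1; have mA1 := H1T _ HA1.
    have [p1 cp1 p1b] := cond_prob_exists01 sF FT mA1.
    have [_ ip12 _ e12] := ind _ _ _ _ HA1 HA2 cp1 cp2.
    have [_ ip1 mp1 _] := cp1.
    have h12 : \int[P]_w (\1_(A1 `&` A2) w) = \int[P]_w (p1 w * p2 w).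
      by rewrite /Rintegral e12.
    have i12 : P.-integrable setT (EFin \o (fun w => p2 w * \1_A1 w)).
      by apply: sqintM => //; exact: sind.
    have ip21 : P.-integrable setT (EFin \o (fun w => p2 w * p1 w)).
      by apply: eq_integrable ip12 => // w _ /=; rewrite mulrC.
    have h1 : \int[P]_w (p2 w * (\1_A1 w - p1 w)) = 0.
      apply: (pull_out sF FT cp1 mp2).
      by have := integrableBR i12 ip21; apply: eq_integrable => // w _ /=; rewrite mulrBr.
    move: h1; under eq_Rintegral do rewrite mulrBr.
    rewrite RintegralB // => /eqP; rewrite subr_eq0 => /eqP h1.
    rewrite Rintegral_setI //.
    under eq_Rintegral do rewrite mulrBl.
    rewrite RintegralB //; last by apply: sqintM; exact: sind.
    rewrite h1.
    have -> : \int[P]_x (\1_A2 x * \1_A1 x) = \int[P]_w (\1_(A1 `&` A2) w).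
      by apply: eq_Rintegral => w _; rewrite indicI mulrC.
    rewrite h12; apply/eqP; rewrite subr_eq0; apply/eqP.
    by apply: eq_Rintegral => w _; rewrite mulrC.
  (* [step1] says that the indicator of A2 minus p2 is orthogonal to the events of H1, hence to
     X1. *)
  have e1 : \int[P]_w (X1 w * (\1_A2 w - p2 w)) = 0.
    apply: (Rintegral_orthogonal sH1 H1T _ step1 mX1); last exact: sqintM.
    exact: sqint_integrable.
  have e2 : \int[P]_w (p2 w * (X1 w - Y1 w)) = 0.
    by apply: (pull_out sF FT c1 mp2); exact: sqintM.
  have e3 : \int[P]_w (Y1 w * (\1_A2 w - p2 w)) = 0.
    have [_ _ mY1 _] := c1.
    by apply: (pull_out sF FT cp2 mY1); exact: sqintM.
  rewrite Rintegral_setI //.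
  have -> : \int[P]_w ((X1 w - Y1 w) * \1_A2 w) =
    \int[P]_w ((X1 w * (\1_A2 w - p2 w) + p2 w * (X1 w - Y1 w)) - Y1 w * (\1_A2 w - p2 w)).
    by apply: eq_Rintegral => w _; ring.
  rewrite RintegralB ?RintegralD ?e1 ?e2 ?e3 ?addr0 ?subrr //; try exact: sqintM.
  by apply: integrableDR; exact: sqintM.
have i1 := sqint_integrable sq1.
have z1 : \int[P]_w (X2 w * (X1 w - Y1 w)) = 0.
  by apply: (Rintegral_orthogonal sH2 H2T i1 key mX2); exact: sqintM.
have z2 : \int[P]_w (Y2 w * (X1 w - Y1 w)) = 0.
  have [_ _ mY2 _] := c2.
  by apply: (pull_out sF FT c1 mY2); exact: sqintM.
have -> : \int[P]_w ((X1 w - Y1 w) * (X2 w - Y2 w)) =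
   \int[P]_w (X2 w * (X1 w - Y1 w) - Y2 w * (X1 w - Y1 w)).
  by apply: eq_Rintegral => w _; ring.
by rewrite RintegralB ?z1 ?z2 ?subrr //; exact: sqintM.
Qed.

End cond_exp.

(** * Averages and dispersion over the nodes *)

Section dot.
Context {R : realType}.

(** Frobenius inner product, which on column vectors is the Euclidean one; a single definition
    serves the d x M states and their averages. *)
Definition dot {m n} (A B : 'M[R]_(m, n)) : R := \sum_i \sum_j A i j * B i j.
Definition normsq {m n} (A : 'M[R]_(m, n)) : R := dot A A.

Lemma dotC m n (A B : 'M[R]_(m, n)) : dot A B = dot B A.
Proof. by apply: eq_bigr => i _; apply: eq_bigr => j _; rewrite mulrC. Qed.

Lemma dotDl m n (A B C : 'M[R]_(m, n)) : dot (A + B) C = dot A C + dot B C.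
Proof.
rewrite /dot -big_split /=; apply: eq_bigr => i _; rewrite -big_split /=.
by apply: eq_bigr => j _; rewrite mxE mulrDl.
Qed.

Lemma dotZl m n c (A B : 'M[R]_(m, n)) : dot (c *: A) B = c * dot A B.
Proof.
rewrite /dot mulr_sumr; apply: eq_bigr => i _; rewrite mulr_sumr.
by apply: eq_bigr => j _; rewrite mxE mulrA.
Qed.

Lemma dotDr m n (A B C : 'M[R]_(m, n)) : dot C (A + B) = dot C A + dot C B.
Proof. by rewrite dotC dotDl !(dotC C). Qed.

Lemma dotZr m n c (A B : 'M[R]_(m, n)) : dot A (c *: B) = c * dot A B.
Proof. by rewrite dotC dotZl dotC. Qed.

Lemma dotNl m n (A B : 'M[R]_(m, n)) : dot (- A) B = - dot A B.
Proof. by rewrite -scaleN1r dotZl mulN1r. Qed.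

Lemma dotNr m n (A B : 'M[R]_(m, n)) : dot A (- B) = - dot A B.
Proof. by rewrite dotC dotNl dotC. Qed.

Lemma dot0l m n (A : 'M[R]_(m, n)) : dot 0 A = 0.
Proof. by rewrite -(scale0r A) dotZl mul0r. Qed.

Definition dotE := (dotDl, dotDr, dotNl, dotNr, dotZl, dotZr).

Lemma dot_sumr m n I (s : seq I) (F : I -> 'M[R]_(m, n)) A :
  dot A (\sum_(i <- s) F i) = \sum_(i <- s) dot A (F i).
Proof.
elim: s => [|i s IH]; first by rewrite !big_nil dotC dot0l.
by rewrite !big_cons dotDr IH.
Qed.

Lemma normsq_ge0 m n (A : 'M[R]_(m, n)) : 0 <= normsq A.
Proof. by apply: sumr_ge0 => i _; apply: sumr_ge0 => j _; rewrite -expr2 sqr_ge0. Qed.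

Lemma normsqD m n (A B : 'M[R]_(m, n)) : normsq (A + B) = normsq A + 2 * dot A B + normsq B.
Proof. by rewrite /normsq !dotE (dotC B A); ring. Qed.

Lemma normsqB m n (A B : 'M[R]_(m, n)) : normsq (A - B) = normsq A - 2 * dot A B + normsq B.
Proof. by rewrite /normsq !dotE (dotC B A); ring. Qed.

Lemma normsqZ m n c (A : 'M[R]_(m, n)) : normsq (c *: A) = c ^+ 2 * normsq A.
Proof. by rewrite /normsq !dotE; ring. Qed.

Lemma normsq0 m n : normsq (0 : 'M[R]_(m, n)) = 0.
Proof. exact: dot0l. Qed.

Lemma normsqN m n (A : 'M[R]_(m, n)) : normsq (- A) = normsq A.
Proof. by rewrite /normsq dotNl dotNr opprK. Qed.

Lemma young m n (A B : 'M[R]_(m, n)) c : 0 < c -> 2 * dot A B <= c * normsq A + normsq B / c.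
Proof.
move=> c0; have := normsq_ge0 (c *: A - B); rewrite normsqB normsqZ dotZl => h.
have -> : c * normsq A + normsq B / c = (c ^+ 2 * normsq A + normsq B) / c.
  by field; rewrite gt_eqF.
by rewrite ler_pdivlMr //; lra.
Qed.

Lemma normsqD_le m n (A B : 'M[R]_(m, n)) : normsq (A + B) <= 2 * normsq A + 2 * normsq B.
Proof. have := normsq_ge0 (A - B); rewrite normsqB normsqD; lra. Qed.

Lemma normsqB_le m n (A B : 'M[R]_(m, n)) : normsq (A - B) <= 2 * normsq A + 2 * normsq B.
Proof. by have := normsqD_le A (- B); rewrite normsqN. Qed.

Lemma normsq_convex m n (A B : 'M[R]_(m, n)) t : 0 <= t <= 1 ->
  normsq ((1 - t) *: A + t *: B) <= (1 - t) * normsq A + t * normsq B.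
Proof.
move=> /andP[t0 t1]; have := normsq_ge0 (A - B).
rewrite normsqB normsqD !normsqZ dotZl dotZr => h.
have h2 : 0 <= t * (1 - t) by rewrite mulr_ge0 // subr_ge0.
by have := mulr_ge0 h2 h; lra.
Qed.

Lemma normsq_sum_le m n (k : nat) (F : nat -> 'M[R]_(m, n)) :
  normsq (\sum_(i < k) F i) <= k%:R * \sum_(i < k) normsq (F i).
Proof.
elim: k => [|k IH]; first by rewrite !big_ord0 normsq0 mulr0.
case: k IH => [|k] IH.
  by rewrite !big_ord_recr !big_ord0 /= !add0r mul1r.
rewrite big_ord_recr [in leRHS]big_ord_recr /=; move: IH.
move: (\sum_(i < k.+1) F i) (\sum_(i < k.+1) normsq _) => S N IH.
have k0 : (0 : R) < k.+1%:R by [].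
(* The weight 1/(k+1) is the balanced one: |S|^2 <= (k+1) N then yields exactly the factor k+2 for
   both parts. *)
have := young S (F k.+1) (c := k.+1%:R^-1); rewrite invr_gt0 => /(_ k0).
rewrite invrK => y.
have h : k.+1%:R^-1 * normsq S <= N by rewrite mulrC ler_pdivrMr // mulrC.
rewrite normsqD -(natr1 k.+1); move: k0 IH h y.
move: (k.+1%:R : R) (normsq S) (normsq (F k.+1)) (dot _ _) => c a b e c0 h1 h2 h3.
by nra.
Qed.

Lemma enorm_sqr d (v : 'cV[R]_d) : enorm v ^+ 2 = normsq v.
Proof.
rewrite /enorm sqr_sqrtr; last by apply: sumr_ge0 => i _; rewrite sqr_ge0.
by apply: eq_bigr => i _; rewrite big_ord1 expr2.
Qed.

Lemma dot_mulmxr m n (A B : 'M[R]_(m, n)) (S : 'M[R]_n) :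
  dot (A *m S) B = dot A (B *m S^T).
Proof.
rewrite /dot; apply: eq_bigr => i _.
under eq_bigr do rewrite mxE mulr_suml.
rewrite exchange_big /=; apply: eq_bigr => j _.
by rewrite mxE mulr_sumr; apply: eq_bigr => k _; rewrite mxE; ring.
Qed.

Lemma normsq_col m n (A : 'M[R]_(m, n)) : normsq A = \sum_i normsq (col i A).
Proof.
rewrite /normsq /dot exchange_big /=; apply: eq_bigr => j _; apply: eq_bigr => i _.
by rewrite big_ord1 !mxE.
Qed.

Lemma normsq_row m n (A : 'M[R]_(m, n)) : normsq A = \sum_i normsq (row i A).
Proof.
rewrite /normsq /dot; apply: eq_bigr => j _; rewrite big_ord1.
by apply: eq_bigr => i _; rewrite !mxE.
Qed.

Lemma normsq_col_le m n (A : 'M[R]_(m, n)) i : normsq (col i A) <= normsq A.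
Proof. by rewrite [leRHS]normsq_col (bigD1 i) //= lerDl sumr_ge0 // => j _; exact: normsq_ge0. Qed.
End dot.

Section mean.
Context {R : realType} {d M : nat}.
Implicit Types X Y : 'M[R]_(d, M).

Definition ones : 'rV[R]_M := const_mx 1.
Definition mean X : 'cV[R]_d := X *m const_mx (M%:R^-1).
(** Orthogonal projection onto the rows with zero sum. As a right multiplication it is linear by
    construction and commutes with gossip ([dis_gossip]). *)
Definition disM : 'M[R]_M := 1%:M - const_mx (M%:R^-1).
Definition dis X := X *m disM.

Lemma meanD X Y : mean (X + Y) = mean X + mean Y. Proof. exact: mulmxDl. Qed.
Lemma meanB X Y : mean (X - Y) = mean X - mean Y. Proof. exact: mulmxBl. Qed.
Lemma meanZ c X : mean (c *: X) = c *: mean X. Proof. by rewrite /mean scalemxAl. Qed.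
Lemma disD X Y : dis (X + Y) = dis X + dis Y. Proof. exact: mulmxDl. Qed.
Lemma disB X Y : dis (X - Y) = dis X - dis Y. Proof. exact: mulmxBl. Qed.
Lemma disZ c X : dis (c *: X) = c *: dis X. Proof. by rewrite /dis scalemxAl. Qed.

Lemma meanE X k j : mean X k j = M%:R^-1 * \sum_i X k i.
Proof. by rewrite mxE mulr_sumr; apply: eq_bigr => i _; rewrite mxE mulrC. Qed.

Lemma mean_col X : mean X = M%:R^-1 *: \sum_i col i X.
Proof.
apply/colP => k; rewrite meanE mxE summxE; congr (_ * _).
by apply: eq_bigr => i _; rewrite mxE.
Qed.

Lemma disE X k i : dis X k i = X k i - mean X k 0.
Proof.
rewrite mxE /mean mxE.
under eq_bigr do rewrite !mxE mulrBr.
rewrite sumrB; congr (_ - _); last by apply: eq_bigr => j _; rewrite mxE.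
rewrite (bigD1 i) //= eqxx mulr1 big1 ?addr0 // => j /negbTE ->; by rewrite mulr0.
Qed.

Hypothesis M0 : (0 < M)%N.
Let Mr0 : (M%:R : R) != 0. Proof. by rewrite pnatr_eq0 -lt0n. Qed.

Lemma mean_rank1 (c : 'cV[R]_d) : mean (c *m ones) = c.
Proof.
apply/colP => k; rewrite meanE.
under eq_bigr do rewrite mxE big_ord1 mxE mulr1.
by rewrite sumr_const card_ord -(mulr_natl (c k 0)) mulKf.
Qed.

Lemma dis_rank1 (c : 'cV[R]_d) : dis (c *m ones) = 0.
Proof.
apply/matrixP => k i; rewrite disE mean_rank1 !mxE big_ord1 mxE mulr1 subrr //.

Qed.

Lemma sum_dis X k : \sum_i dis X k i = 0.
Proof.
under eq_bigr do rewrite disE.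
rewrite sumrB sumr_const card_ord -(mulr_natl (mean X k 0)) meanE.
by rewrite mulrA divff // mul1r subrr.
Qed.

Lemma dis_ones X : dis X *m ones^T = 0.
Proof.
apply/matrixP => k i; rewrite [LHS]mxE [RHS]mxE.
transitivity (\sum_j dis X k j); last exact: sum_dis.
by apply: eq_bigr => j _; rewrite [ones^T _ _]mxE [ones _ _]mxE mulr1.
Qed.

Lemma dot_dis_rank1 X (c : 'cV[R]_d) : dot (dis X) (c *m ones) = 0.
Proof.
rewrite /dot big1 // => k _.
under eq_bigr do rewrite [_ k _ in X in _ * X]mxE big_ord1 [ones _ _]mxE mulr1.
by rewrite -mulr_suml sum_dis mul0r.
Qed.

Lemma normsq_rank1 (c : 'cV[R]_d) : normsq (c *m ones) = M%:R * normsq c.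
Proof.
rewrite normsq_col.
have e i : col i (c *m ones) = c by apply/colP => k; rewrite mxE mxE big_ord1 mxE mulr1.
under eq_bigr do rewrite e.
by rewrite sumr_const card_ord mulr_natl.
Qed.

Lemma dis_decomp X : X = dis X + mean X *m ones.
Proof.
apply/matrixP => k i; rewrite [RHS]mxE disE.
by rewrite [X in _ + X]mxE big_ord1 [ones _ _]mxE mulr1 subrK.
Qed.

(** Pythagoras: the dispersion is orthogonal to matrices with equal columns. *)
Lemma normsq_sub_rank1 X c :
  normsq (X - c *m ones) = normsq (dis X) + M%:R * normsq (mean X - c).
Proof.
have -> : X - c *m ones = dis X + (mean X - c) *m ones.
  by rewrite [in LHS](dis_decomp X) mulmxBl addrA.
by rewrite (normsqD (dis X)) dot_dis_rank1 mulr0 addr0 normsq_rank1.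
Qed.

Lemma normsq_dis_le X c : normsq (dis X) <= normsq (X - c *m ones).
Proof. by rewrite normsq_sub_rank1 lerDl mulr_ge0 ?normsq_ge0. Qed.

Lemma col_sub_rank1 X c i : col i (X - c *m ones) = col i X - c.
Proof. by apply/colP => k; rewrite !mxE big_ord1 mxE mulr1. Qed.

Lemma normsq_col_mean_le X i : normsq (col i X - mean X) <= normsq (dis X).
Proof.
have := normsq_col_le (X - mean X *m ones) i.
by rewrite col_sub_rank1 normsq_sub_rank1 subrr normsq0 mulr0 addr0.
Qed.
End mean.
Arguments ones {R M}.

(** * Accelerated gossip *)

Section gossip.
Context {R : realType} {d M : nat}.
Variables (W : 'M[R]_M) (edge : rel 'I_M) (rho : R).
Hypotheses (M0 : (0 < M)%N) (gW : gossip_matrix edge W).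
Hypothesis rho01 : 0 < rho <= 1.
(** The spectral gap in variational form, supplied by [spectral_gap]. *)
Hypothesis gap : forall Y : 'M[R]_(d, M), Y *m ones^T = 0 ->
  dot Y (Y *m W) <= (1 - rho) * normsq Y.
Implicit Types X Y : 'M[R]_(d, M).

Lemma gossip_onesT : W *m ones^T = ones^T.
Proof.
have [_ _ r _ _] := gW; apply/matrixP => i j; rewrite mxE [RHS]mxE [RHS]mxE -[RHS](r i).
by apply: eq_bigr => k _; rewrite [X in _ * X]mxE [X in _ * X]mxE mulr1.
Qed.

Lemma mean_gossip Y : mean (Y *m W) = mean Y.
Proof.
rewrite /mean -mulmxA; congr (_ *m _).
rewrite (_ : const_mx _ = M%:R^-1 *: ones^T :> 'cV[R]_M); last first.
  by apply/colP => i; rewrite !mxE mulr1.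
by rewrite -scalemxAr gossip_onesT.
Qed.

Lemma dis_gossip Y : dis (Y *m W) = dis Y *m W.
Proof.
have e Z : dis Z = Z - mean Z *m ones by apply/eqP; rewrite eq_sym subr_eq -dis_decomp.
rewrite !e mean_gossip mulmxBl -(mulmxA (mean Y)); congr (_ - _ *m _).
have [_ WT _ _ _] := gW.
by rewrite -[RHS]trmxK trmx_mul WT gossip_onesT trmxK.
Qed.

(** The spectrum of W is at least -1: as the rows and columns of W sum to 1, the sum of the two
    sides is a combination of the squares (Y k i + Y k j)^2 with weights W i j / 2. *)
Lemma dot_gossip_ge Y : - normsq Y <= dot Y (Y *m W).
Proof.
have [W01 WT r c _] := gW.
have Wsym i j : W i j = W j i by rewrite -[in LHS]WT mxE.
rewrite -subr_ge0 opprK /dot /normsq /dot -big_split /=.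
apply: sumr_ge0 => k _; have -> : \sum_j Y k j * Y k j = \sum_i \sum_j 2^-1 * W i j * (Y k i ^+ 2 + Y k j ^+ 2).
  have -> : \sum_i \sum_j 2^-1 * W i j * (Y k i ^+ 2 + Y k j ^+ 2) =
     \sum_i 2^-1 * Y k i ^+ 2 + \sum_j 2^-1 * Y k j ^+ 2.
    under eq_bigr => i _ do under eq_bigr do rewrite mulrDr.
    under eq_bigr do rewrite big_split /=.
    rewrite big_split /=; congr (_ + _).
      apply: eq_bigr => i _; rewrite -mulr_suml -mulr_sumr r; ring.
    rewrite exchange_big /=; apply: eq_bigr => i _.
    by rewrite -mulr_suml -mulr_sumr c; ring.
  by rewrite -big_split /=; apply: eq_bigr => i _; field.
have -> : \sum_j Y k j * (Y *m W) k j = \sum_i \sum_j W i j * (Y k i * Y k j).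
  rewrite exchange_big /=; apply: eq_bigr => j _; rewrite mxE mulr_sumr.
  by apply: eq_bigr => i _; ring.
rewrite -big_split /=; apply: sumr_ge0 => i _; rewrite -big_split /=.
apply: sumr_ge0 => j _.
have -> : W i j * (Y k i * Y k j) + 2^-1 * W i j * (Y k i ^+ 2 + Y k j ^+ 2) =
  2^-1 * W i j * (Y k i + Y k j) ^+ 2 by field.
by have /andP[w0 _] := W01 i j; rewrite mulr_ge0 ?sqr_ge0 // mulr_ge0.
Qed.

Let kap : R := Num.sqrt (rho / 2).
Let be : R := (1 - kap) / (1 + kap).

Let kap2 : kap ^+ 2 = rho / 2.
Proof. by rewrite sqr_sqrtr //; case/andP: rho01 => ? ?; lra. Qed.

Let kap0 : 0 < kap.
Proof. by rewrite sqrtr_gt0; case/andP: rho01 => ? ?; lra. Qed.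
Let kap1 : kap < 1.
Proof. by case/andP: rho01 => ? ?; have := kap2; have := kap0; rewrite expr2; nra. Qed.

(* Nesterov's method on y |-> <y, y (I - A)> / 2 with A = (I + W) / 2; [z] is
   the estimate-sequence variable. *)
Let A := (2^-1 : R) *: (1%:M + W).
Let bil X Y := dot X (Y - Y *m A).
Let lyap X (Z : 'M[R]_(d, M)) := 2^-1 * bil X X + kap ^+ 2 / 2 * normsq Z.

Let AT : A^T = A.
Proof. by have [_ WT _ _ _] := gW; rewrite /A linearZ /= linearD /= trmx1 WT. Qed.

Let mulA Y : Y *m A = 2^-1 *: (Y + Y *m W).
Proof. by rewrite -scalemxAr mulmxDr mulmx1. Qed.

Let bilC X Y : bil X Y = bil Y X.
Proof.
rewrite /bil !dotDr !dotNr (dotC X Y); congr (_ - _).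
by rewrite dotC dot_mulmxr AT.
Qed.

(** With [bil_ge], the quadratic form has curvature between kap^2 = rho / 2 and 1 off the consensus.
    Thus kap is the square root of the inverse condition number, whence the momentum [be]. *)
Let bil_le Y : bil Y Y <= normsq Y.
Proof.
rewrite /bil !dotE mulA !dotE -/(normsq Y).
by have := dot_gossip_ge Y; rewrite /normsq; lra.
Qed.

Let bil_ge Y : Y *m ones^T = 0 -> kap ^+ 2 * normsq Y <= bil Y Y.
Proof.
move=> Y0; rewrite /bil !dotE mulA !dotE -/(normsq Y).
by have := gap Y0; rewrite kap2; lra.
Qed.

(** The usual strongly convex estimate-sequence step with minimizer 0. Smoothness enters as [H3] (a
    gradient step of length 1), strong convexity as [H1] at y, and [H4] splits the squared norm of
    (1 - kap) z + kap y. *)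
Let lyap_step x z : let y := (1 + kap)^-1 *: (x + kap *: z) in
  x *m ones^T = 0 -> z *m ones^T = 0 ->
  let x' := y *m A in let z' := kap^-1 *: x' - ((1 - kap) / kap) *: x in
  lyap x' z' <= (1 - kap) * lyap x z.
Proof.
move=> y x0 z0; cbv zeta; set x' := y *m A; set z' := _ - _ *: x.
have k1 : 1 + kap != 0 by rewrite gt_eqF // addr_gt0.
have k0 : kap != 0 by rewrite gt_eqF.
have y0 : y *m ones^T = 0.
  by rewrite /y -scalemxAl mulmxDl -scalemxAl x0 z0 scaler0 addr0 scaler0.
pose g := y - y *m A.
have ex : x = (1 + kap) *: y - kap *: z.
  by rewrite /y scalerA divff // scale1r addrK.
have ex' : x' = y - g by rewrite /g opprB addrC subrK.
have ez' : z' = (1 - kap) *: z + kap *: y - kap^-1 *: g.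
  rewrite /z' ex' ex !scalerBr !scalerA.
  apply/matrixP => i j; rewrite !mxE; by field; rewrite ?k0 ?k1.
have byg Y : bil Y y = dot Y g by [].
clearbody z' x' g y.
have H1 := bil_ge y0.
have xy0 : (x - y) *m ones^T = 0 by rewrite mulmxBl x0 y0 subrr.
have H2 := bil_ge xy0.
have H2' : 0 <= bil (x - y) (x - y) by apply: le_trans H2; rewrite mulr_ge0 ?sqr_ge0 ?normsq_ge0.
have H3 := bil_le g.
have H4 := normsq_convex z y (t := kap).
have k01 : 0 <= kap <= 1 by rewrite !ltW.
have {}H4 := H4 k01.
have bilDl X Y Z : bil (X + Y) Z = bil X Z + bil Y Z by rewrite /bil dotDl.
have bilZl c X Z : bil (c *: X) Z = c * bil X Z by rewrite /bil dotZl.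
have bilNl X Z : bil (- X) Z = - bil X Z by rewrite /bil dotNl.
have bilDr X Y Z : bil Z (X + Y) = bil Z X + bil Z Y by rewrite bilC bilDl !(bilC Z).
have bilZr c X Z : bil Z (c *: X) = c * bil Z X by rewrite bilC bilZl (bilC Z).
have bilNr X Z : bil Z (- X) = - bil Z X by rewrite bilC bilNl (bilC Z).
have e1 : bil x' x' = bil y y - 2 * normsq g + bil g g.
  by rewrite ex' !(bilDl, bilDr, bilNl, bilNr) (bilC y g) (byg g) /normsq; ring.
have e2 : kap ^+ 2 * normsq z' = kap ^+ 2 * normsq ((1 - kap) *: z + kap *: y)
   - 2 * kap * ((1 - kap) * dot z g + kap * dot y g) + normsq g.
  rewrite ez' normsqB normsqZ !dotE; by field; rewrite ?k0 ?k1.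
have e3 : bil x x = bil y y + 2 * (kap * dot y g - kap * dot z g) + bil (x - y) (x - y).
  have {1 2}-> : x = y + (x - y) by rewrite addrC subrK.
  rewrite bilDl !(bilDr y (x - y)) (bilC y (x - y)) (byg (x - y)).
  rewrite (_ : dot (x - y) g = kap * dot y g - kap * dot z g); first by ring.
  by rewrite [in LHS]ex !dotE; ring.
have e4 : bil y y = dot y g by rewrite byg.
have e5 : 0 <= (1 - kap) * bil (x - y) (x - y) by rewrite mulr_ge0 // subr_ge0 ltW.
have e6 : kap ^+ 2 * normsq ((1 - kap) *: z + kap *: y) <=
   kap ^+ 2 * ((1 - kap) * normsq z + kap * normsq y) by rewrite ler_wpM2l ?sqr_ge0.
have e7 : kap * (kap ^+ 2 * normsq y) <= kap * bil y y by rewrite ler_wpM2l // ltW.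
rewrite /lyap e1 e3.
have -> : kap ^+ 2 / 2 * normsq z' = 2^-1 * (kap ^+ 2 * normsq z') by ring.
rewrite e2; rewrite -e4 in e7 *; lra.
Qed.

(** With mixing weight 1/2 each inner step multiplies by A, so [lyap_step] iterates. Initially
    [lyap] is at most the squared dispersion, and it dominates rho / 4 times the current one; this
    is the factor 4 / rho. *)
Lemma gossip_contract X s :
  normsq (dis (gossip_iter (1 / 2) be W X s).1) <=
  4 / rho * (1 - kap) ^+ s * normsq (dis X).
Proof.
pose x s := dis (gossip_iter (1 / 2) be W X s).1.
pose x_ s := dis (gossip_iter (1 / 2) be W X s).2.
(* The estimate-sequence variable is recovered from two consecutive iterates; since the iteration
   starts from the pair (X, X), its initial value is [dis X]. *)
pose z s := kap^-1 *: x s - ((1 - kap) / kap) *: x_ s.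
have k1 : 1 + kap != 0 by rewrite gt_eqF // addr_gt0.
have k0 : kap != 0 by rewrite gt_eqF.
have rec k : x k.+1 = ((1 + kap)^-1 *: (x k + kap *: z k)) *m A /\ x_ k.+1 = x k.
  rewrite /z /x /x_ /=; case: (gossip_iter _ _ _ _ k) => Y Y' /=; split => //.
  have -> : (1 + kap)^-1 *: (dis Y + kap *: (kap^-1 *: dis Y - ((1 - kap) / kap) *: dis Y')) =
     dis (Y + be *: (Y - Y')).
    rewrite disD disZ disB; move: (dis Y) (dis Y') => a b.
    by apply/matrixP => i j; rewrite !mxE /be; field; rewrite ?k0 ?k1.
  move: (Y + be *: (Y - Y')) => V; rewrite mulA disD !disZ dis_gossip.
  move: (dis V) (dis V *m W) => a b.
  by apply/matrixP => i j; rewrite !mxE; field.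
have x0 k : x k *m ones^T = 0 by exact: dis_ones.
have z0 k : z k *m ones^T = 0 by rewrite /z mulmxBl -!scalemxAl !dis_ones // !scaler0 subrr.
have L k : lyap (x k) (z k) <= (1 - kap) ^+ k * normsq (dis X).
  elim: k => [|k IH].
    rewrite expr0 mul1r.
    have -> : z 0%N = dis X.
      rewrite /z /x /x_ /=; move: (dis X) => a.
      by apply/matrixP => i j; rewrite !mxE; field; rewrite ?k0 ?k1.
    rewrite /lyap /x /= kap2; have := bil_le (dis X); have := normsq_ge0 (dis X).
    by case/andP: rho01 => ? ?; nra.
  have [e1 e2] := rec k.
  have -> : z k.+1 = kap^-1 *: x k.+1 - ((1 - kap) / kap) *: x k by rewrite /z e2.
  rewrite e1; apply: le_trans (lyap_step (x0 k) (z0 k)) _.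
  by rewrite exprS -mulrA ler_wpM2l // subr_ge0 ltW.
have := L s; rewrite /lyap => h; have h2 := bil_ge (x0 s).
have h3 := normsq_ge0 (z s).
have r0 : 0 < rho by case/andP: rho01.
rewrite -/(x s) (_ : _ * _ * _ = 4 * ((1 - kap) ^+ s * normsq (dis X)) / rho); last by field; rewrite gt_eqF.
rewrite ler_pdivlMr //; move: h h2; rewrite kap2.
have := mulr_ge0 (ltW r0) h3; lra.
Qed.
End gossip.

(** * Spectral gap of the gossip matrix from its ordered eigenvalues *)

Lemma char_poly_unitary_diag {C : fieldType} n (S : 'M[C]_n) (D : 'rV[C]_n) :
  S \in unitmx ->
  char_poly (invmx S *m diag_mx D *m S) = \prod_(i < n) ('X - (D 0 i)%:P).
Proof.
move=> uS; have -> : \prod_(i < n) ('X - (D 0 i)%:P) = char_poly (diag_mx D).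
  rewrite char_poly_trig ?diag_mx_is_trig //.
  by apply: eq_bigr => i _; rewrite !mxE eqxx mulr1n.
rewrite /char_poly /char_poly_mx.
have -> : 'X%:M - map_mx polyC (invmx S *m diag_mx D *m S) =
  map_mx polyC (invmx S) *m ('X%:M - map_mx polyC (diag_mx D)) *m map_mx polyC S.
  rewrite !map_mxM mulmxBr mulmxBl; congr (_ - _).
  by rewrite scalar_mxC -mulmxA -map_mxM mulVmx // map_mx1 mulmx1.
rewrite !det_mulmx mulrC mulrA -det_mulmx -map_mxM mulmxV // map_mx1 det1 mul1r //.
Qed.

Section spectral_gap.
Local Open Scope sesquilinear_scope.
Context {R : realType} {M : nat}.
Variables (W : 'M[R]_M) (lam : 'I_M -> R) (rho : R).
Hypotheses (WT : W^T = W) (W1 : W *m ones^T = ones^T :> 'cV[R]_M).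
Hypotheses (spec : ordered_spectrum W lam) (rho0 : 0 < rho).
Hypothesis lam1 : forall i : 'I_M, nat_of_ord i = 1%N -> rho <= 1 - lam i.
Hypothesis M0 : (0 < M)%N.

Let C : numClosedFieldType := R[i]%C.
Let toC : {rmorphism R -> C} := real_complex R.
Let WC : 'M[C]_M := map_mx toC W.
Let S := spectralmx WC.
Let D := spectral_diag WC.

Let toC_le x y : (toC x <= toC y) = (x <= y).
Proof. exact: lecR. Qed.

Let toC_real x : toC x \is Num.real.
Proof.
have e0 : toC 0 = 0 by exact: rmorph0.
by rewrite realE -e0 !toC_le -realE num_real.
Qed.

Let toC_conj x : (toC x)^* = toC x.
Proof. by apply/CrealP; exact: toC_real. Qed.

Let WCE : WC = S^t* *m diag_mx D *m S.
Proof.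
have h : WC \is hermsymmx.
  apply: realsym_hermsym; last by apply/mxOverP => i j; rewrite mxE toC_real.
  by apply/is_hermitianmxP; rewrite expr0 scale1r map_mx_id // map_trmx WT.
have /orthomx_spectralP := hermitian_normalmx h.
by rewrite invmx_unitary // spectral_unitarymx.
Qed.

(** The diagonal of the complex unitary diagonalization and [lam] are root lists of the same
    characteristic polynomial, so they agree up to order. In particular the diagonal is real. *)
Let spec_perm : perm_eq [seq D 0 i | i <- enum 'I_M] [seq toC (lam i) | i <- enum 'I_M].
Proof.
have eb (F : 'I_M -> {poly C}) : \prod_(i <- enum 'I_M) F i = \prod_i F i by rewrite big_enum.
apply: prod_XsubC_eq; rewrite big_map [in RHS]big_map !eb.
have uS : S \in unitmx by exact: spectral_unit.
have := char_poly_unitary_diag D uS; rewrite invmx_unitary ?spectral_unitarymx // -WCE.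
move=> <-.
have [cp _] := spec; rewrite -map_char_poly cp map_prod_XsubC //.
Qed.

Let D_real i : {x : R | D 0 i = toC x}.
Proof.
have : D 0 i \in [seq toC (lam i) | i <- enum 'I_M].
  by rewrite -(perm_mem spec_perm) map_f // mem_enum.
case: (D 0 i) => a b h; exists a.
by case/mapP: h => j _ [_ ->].
Qed.
Let Dr i := sval (D_real i).
Let DrE i : D 0 i = toC (Dr i). Proof. exact: svalP (D_real i). Qed.

Let Dr_perm : perm_eq [seq Dr i | i <- enum 'I_M] [seq lam i | i <- enum 'I_M].
Proof.
have inj : injective toC by exact: fmorph_inj.
apply: (perm_map_inj inj).
have e1 : map toC (map Dr (enum 'I_M)) = map (fun i => D 0 i) (enum 'I_M).
  by rewrite -map_comp; apply: eq_map => i /=; rewrite DrE.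
have e2 : map toC (map lam (enum 'I_M)) = map (fun i => toC (lam i)) (enum 'I_M).
  by rewrite -map_comp.
have := spec_perm; rewrite -e1 -e2; exact.
Qed.

(** In the nonincreasing list [lam] only index 0 can exceed 1 - rho, and the number of such values
    is invariant under permutation. *)
Let Dr_gt (i j : 'I_M) : 1 - rho < Dr i -> 1 - rho < Dr j -> i = j.
Proof.
move=> hi hj; apply/eqP/negP => /negP ij.
pose p x := 1 - rho < x.
have cc (h : 'I_M -> R) : count p [seq h i | i <- enum 'I_M] = #|[pred i | p (h i)]|.
  by rewrite count_map cardE -size_filter enumT.
have c1 : (count p [seq lam i | i <- enum 'I_M] <= 1)%N.
  have [_ srt] := spec.
  rewrite cc; apply/card_le1_eqP.
  have z (k : 'I_M) : p (lam k) -> nat_of_ord k = 0%N.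
    rewrite /p => pk; apply/eqP; rewrite -leqn0 leqNgt; apply/negP => k0.
    have M1 : (1 < M)%N by apply: leq_ltn_trans k0 _; exact: ltn_ord.
    have := srt (Ordinal M1) k k0; have := lam1 (i := Ordinal M1) erefl.
    by move=> a b; lra.
  by move=> a b; rewrite !inE => /z za /z zb; apply: ord_inj; rewrite za zb.
have c2 : (1 < count p [seq Dr i | i <- enum 'I_M])%N.
  by rewrite cc; apply/card_gt1P; exists i, j; rewrite !inE.
by rewrite (permP Dr_perm) ltnNge c1 in c2.
Qed.

Let SS : S *m S^t* = 1%:M.
Proof. exact/unitarymxP/spectral_unitarymx. Qed.
Let SS' : S^t* *m S = 1%:M.
Proof. exact: mulmx1C SS. Qed.

Let coords (y : 'rV[R]_M) : 'rV[C]_M := map_mx toC y *m S^t*.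

Let toC_adj m n (A : 'M[R]_(m, n)) : (map_mx toC A)^t* = map_mx toC A^T.
Proof. by apply/matrixP => i j; rewrite !mxE toC_conj. Qed.

Let coords_adj y : (coords y)^t* = S *m map_mx toC y^T.
Proof. by rewrite /coords trmx_mul map_mxM /= toC_adj -[in RHS](trmxCK S). Qed.

Let coords_dot x y : (coords x *m (coords y)^t*) 0 0 = toC (dot x y).
Proof.
rewrite coords_adj /coords mulmxA -(mulmxA (map_mx _ x)) SS' mulmx1 -map_mxM mxE.
rewrite mxE /dot big_ord1; apply: (congr1 toC).
by apply: eq_bigr => i _; rewrite mxE.
Qed.

Let coords_W x y : (coords x *m diag_mx D *m (coords y)^t*) 0 0 = toC (dot (x *m W) y).
Proof.
rewrite coords_adj /coords !mulmxA.
rewrite -(mulmxA (map_mx _ x)) -(mulmxA (map_mx _ x)) -WCE.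
rewrite -!map_mxM mxE /dot big_ord1 mxE; apply: (congr1 toC).
by apply: eq_bigr => i _; rewrite [y^T _ _]mxE.
Qed.

Let coords_adjE y k : ((coords y)^t*) k 0 = (coords y 0 k)^*.
Proof. by move: (coords y) => v; rewrite mxE mxE. Qed.

(** The all-ones row is fixed by W, so its coordinates vanish on every eigenvalue other than 1, and
    1 > 1 - rho. *)
Let coords_ones k : Dr k <= 1 - rho -> coords ones 0 k = 0.
Proof.
move=> hk.
have e : coords ones *m diag_mx D = coords ones.
  have o : ones *m W = ones :> 'rV[R]_M by rewrite -[LHS]trmxK trmx_mul WT W1 trmxK.
  have h : map_mx toC ones *m WC = map_mx toC ones by rewrite -map_mxM o.
  rewrite -[RHS]/(map_mx toC ones *m S^t*) -[in RHS]h WCE !mulmxA.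
  by rewrite -(mulmxA _ S) SS mulmx1.
have := congr1 (fun A : 'rV[C]_M => A 0 k) e.
rewrite mul_mx_diag mxE DrE => /eqP.
rewrite -subr_eq0 -{2}[coords _ _ _]mulr1 -mulrBr mulf_eq0 => /orP[/eqP //|].
rewrite -(rmorph1 toC) -rmorphB fmorph_eq0 subr_eq0 => /eqP h.
by exfalso; move: hk rho0; rewrite h; lra.
Qed.

(** By [Dr_gt] and [coords_ones] the all-ones row has no coordinate other than k, and that one is
    nonzero because M > 0. Orthogonality to this row therefore removes coordinate k of y. *)
Let coords_top y k : y *m ones^T = 0 -> 1 - rho < Dr k -> coords y 0 k = 0.
Proof.
move=> y0 hk.
have others j : j != k -> coords ones 0 j = 0.
  move=> jk; apply: coords_ones; rewrite leNgt; apply/negP => hj.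
  by move/eqP: jk; apply; exact: Dr_gt.
have : (coords y *m (coords ones)^t*) 0 0 = 0.
  rewrite coords_dot -(rmorph0 toC); apply: (congr1 toC).
  have := congr1 (fun A : 'M[R]_1 => A 0 0) y0; rewrite [RHS]mxE mxE => <-.
  by rewrite /dot big_ord1; apply: eq_bigr => i _; rewrite [ones^T _ _]mxE.
rewrite mxE (bigD1 k) //= big1 ?addr0; last first.
  by move=> j /others e; rewrite coords_adjE e conjC0 mulr0.
move/eqP; rewrite mulf_eq0 => /orP[/eqP //|].
rewrite coords_adjE conjC_eq0 => /eqP e.
have c0 : coords ones = 0.
  by apply/rowP => j; rewrite [RHS]mxE; have [->|/others] := eqVneq j k.
have : toC (dot (ones : 'rV[R]_M) ones) = 0 by rewrite -coords_dot c0 mul0mx mxE.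
have -> : dot (ones : 'rV[R]_M) ones = M%:R.
  rewrite /dot big_ord1; under eq_bigr do rewrite !mxE mulr1.
  by rewrite sumr_const card_ord.
by move/eqP; rewrite fmorph_eq0 pnatr_eq0 (gtn_eqF M0).
Qed.

(** Rayleigh quotient in eigencoordinates: each k has eigenvalue at most 1 - rho or coordinate 0. *)
Let gap_row (y : 'rV[R]_M) : y *m ones^T = 0 ->
  dot y (y *m W) <= (1 - rho) * normsq y.
Proof.
move=> y0; rewrite dotC -toC_le rmorphM -coords_W -coords_dot.
rewrite mul_mx_diag [leLHS]mxE [(coords y *m _) 0 0]mxE mulr_sumr.
apply: ler_sum => k _; rewrite coords_adjE [X in X * _]mxE.
move: (coords_top (y := y) (k := k) y0); move: (coords y 0 k) => c ctop.
rewrite (_ : c * D 0 k * c^* = D 0 k * (c * c^*)); last by ring.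
rewrite -normCK.
have [h|h] := leP (Dr k) (1 - rho); last by rewrite ctop // normr0 expr0n !mulr0.
by rewrite DrE ler_wpM2r ?toC_le // exprn_ge0.
Qed.

Lemma spectral_gap d (Y : 'M[R]_(d, M)) : Y *m ones^T = 0 ->
  dot Y (Y *m W) <= (1 - rho) * normsq Y.
Proof.
move=> Y0.
have -> : dot Y (Y *m W) = \sum_i dot (row i Y) (row i Y *m W).
  rewrite /dot; apply: eq_bigr => i _; rewrite big_ord1 -row_mul.
  by apply: eq_bigr => j _; rewrite !mxE.
rewrite normsq_row mulr_sumr; apply: ler_sum => i _; apply: gap_row.
by rewrite -row_mul Y0 row0.
Qed.
End spectral_gap.

(** * Smooth convex functions *)

Section smooth.
Context {R : realType}.

(** The mean value theorem for phi minus its quadratic model, whose derivative is nonpositive on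
    [0, 1]. *)
Lemma taylor_upper (phi dphi : R -> R) (K : R) :
  (forall t : R, is_derive t 1 phi (dphi t)) ->
  (forall t, 0 <= t <= 1 -> dphi t - dphi 0 <= K * t) ->
  phi 1 <= phi 0 + dphi 0 + K / 2.
Proof.
move=> dp h.
pose psi : R -> R := phi - (dphi 0 \*: (@id R) + (K / 2) \*: (@id R) ^+ 2).
have psiE t : psi t = phi t - (dphi 0 * t + K / 2 * t ^+ 2) by [].
have dpsi (t : R) : is_derive t 1 psi (dphi t - dphi 0 - K * t).
  have d0 := dp t.
  have d1 := is_deriveB d0 (is_deriveD (is_deriveZ (dphi 0) (is_derive_id t (1:R)))
    (is_deriveZ (K / 2) (is_deriveX 2 (is_derive_id t (1:R))))).
  have -> : dphi t - dphi 0 - K * t =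
      dphi t - ((dphi 0)%:A + (K / 2) *: (2 * t ^+ 2.-1)%:A).
    by rewrite /GRing.scale /=; field.
  exact: d1.
have cpsi : {within `[0, 1], continuous psi}.
  by apply: derivable_within_continuous => x _; exact: (@ex_derive _ _ _ _ _ _ _ (dpsi x)).
have [c] := MVT_segment ler01 (fun x _ => dpsi x) cpsi.
rewrite in_itv /= => c01; rewrite subr0 mulr1 !psiE expr1n expr0n /= !mulr0 !mulr1.
by have := h _ c01; lra.
Qed.

Variables (d : nat) (L : R).
Hypothesis L0 : 0 < L.
Implicit Types (f : 'cV[R]_d -> R) (x v : 'cV[R]_d).

Lemma derive_gradient f x v : differentiable (f : 'cV[R]_d -> R^o) x ->
  'D_v (f : 'cV[R]_d -> R^o) x = dot (gradient f x) v.
Proof.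
move=> df; rewrite deriveE // [in LHS](matrix_sum_delta v).
under eq_bigr do rewrite big_ord1.
rewrite linear_sum /dot; apply: eq_bigr => k _; rewrite big_ord1 linearZ /=.
by rewrite mxE deriveE // mulrC.
Qed.

Lemma is_derive_line f x v (t : R) :
  differentiable (f : 'cV[R]_d -> R^o) (x + t *: v) ->
  is_derive t 1 (fun s : R => f (x + s *: v)) (dot (gradient f (x + t *: v)) v).
Proof.
move=> df; have dv := @diff_derivable _ _ _ _ _ v df.
have e : (fun h : R => h^-1 *: (((fun s : R => f (x + s *: v)) \o shift t) (h *: (1:R)) - f (x + t *: v))) =
  (fun h : R => h^-1 *: (((f : 'cV[R]_d -> R^o) \o shift (x + t *: v)) (h *: v) - f (x + t *: v))).
  apply/funext => h /=; congr (_ *: (f _ - _)).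
  by rewrite [h%:A]mulr1 scalerDl addrCA.
split; first by rewrite /derivable e.
by rewrite -derive_gradient // /derive e.
Qed.

(** [taylor_upper] along the segment, for phi and for its opposite: the lower side is what
    [convex_lower] needs. *)
Lemma descent_both f x v : L_smooth L f ->
  `|f (x + v) - f x - dot (gradient f x) v| <= L / 2 * normsq v.
Proof.
move=> [df gL].
pose phi s := f (x + s *: v); pose dphi s := dot (gradient f (x + s *: v)) v.
have d1 (t : R) : is_derive t 1 phi (dphi t) by exact: is_derive_line.
have d2 (t : R) : is_derive t 1 (- phi) (- dphi t) by have := d1 t => ?; exact: is_deriveN.
have [e0 e1] : phi 0 = f x /\ phi 1 = f (x + v) by rewrite /phi scale0r addr0 scale1r.
have e2 : dphi 0 = dot (gradient f x) v by rewrite /dphi scale0r addr0.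
have key t : 0 <= t <= 1 -> `|dphi t - dphi 0| <= L * normsq v * t.
  move=> /andP[t0 _].
  have [->|tn0] := eqVneq t 0; first by rewrite subrr normr0 mulr0.
  have tp : 0 < t by rewrite lt_neqAle eq_sym tn0.
  pose g := gradient f (x + t *: v) - gradient f x.
  have en0 (w : 'cV[R]_d) : 0 <= enorm w by exact: sqrtr_ge0.
  have sqle (a b : R) : 0 <= a -> a <= b -> a ^+ 2 <= b ^+ 2 by nra.
  have gle : normsq g <= (L * t) ^+ 2 * normsq v.
    rewrite -!enorm_sqr; have := gL (x + t *: v) x.
    have -> : x + t *: v - x = t *: v by rewrite addrC addKr.
    move=> h.
    have : enorm g ^+ 2 <= (L * enorm (t *: v)) ^+ 2.
      exact: sqle (en0 g) h.
    by rewrite !exprMn !enorm_sqr normsqZ mulrA.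
  (* With this weight Young's inequality gives the Cauchy-Schwarz bound for dot g v; it is undefined
     at t = 0, hence the separate case. *)
  have c0 : 0 < (L * t)^-1 by rewrite invr_gt0 mulr_gt0.
  have y w : normsq w = normsq v -> 2 * dot g w <= 2 * (L * t) * normsq v.
    move=> e; apply: le_trans (young g w c0) _; rewrite invrK e.
    have : (L * t)^-1 * normsq g <= L * t * normsq v.
      rewrite mulrC ler_pdivrMr ?mulr_gt0 // mulrC; apply: le_trans gle _.
      lra.
    by lra.
  have -> : dphi t - dphi 0 = dot g v by rewrite /g dotDl dotNl e2.
  have := y v erefl; have := y (- v) (normsqN v); rewrite dotNr => y1 y2.
  by rewrite ler_norml; apply/andP; split; lra.
rewrite -e0 -e1 -e2 ler_norml; apply/andP; split.
  have := @taylor_upper (- phi) (fun t => - dphi t) (L * normsq v) d2.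
  rewrite /= => H; have {}H := H _; rewrite lerNl.
  have : - phi 1 <= - phi 0 + - dphi 0 + L * normsq v / 2.
    by apply: H => t /key; rewrite ler_norml => /andP[]; lra.
  by lra.
have : phi 1 <= phi 0 + dphi 0 + L * normsq v / 2.
  by apply: (taylor_upper d1) => t /key; rewrite ler_norml => /andP[]; lra.
by lra.
Qed.

Lemma convex_segment f x y t : convex_on_space f -> 0 <= t <= 1 ->
  f (t *: x + (1 - t) *: y) <= t * f x + (1 - t) * f y.
Proof.
move=> cf /andP[t0 t1]; have p : Itv.spec (@Itv.num_sem R) (Itv.Real `[0%Z, 1%Z]) t.
  by rewrite /Itv.spec /= /Itv.num_sem /= in_itv /= t0 t1 num_real.
have := cf (Itv.mk p) x y; rewrite !inE => /(_ I I).
by [].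
Qed.

(** If the tangent inequality failed by a > 0, convexity would make f lie at least t a below its
    tangent at x + t v, while [descent_both] allows only t^2 b. *)
Lemma convex_lower f x v : convex_on_space f -> L_smooth L f ->
  f x + dot (gradient f x) v <= f (x + v).
Proof.
move=> cf sf; rewrite leNgt; apply/negP => lt.
pose a := f x + dot (gradient f x) v - f (x + v).
have a0 : 0 < a by rewrite subr_gt0.
pose b := L / 2 * normsq v; have b0 : 0 <= b by rewrite mulr_ge0 ?normsq_ge0 // divr_ge0 // ltW.
(* Small enough for t b < a; the added 1 avoids a division by zero when b = 0. *)
pose t := Num.min 1 (a / (2 * (b + 1))).
have t0 : 0 < t by rewrite lt_min ltr01 divr_gt0 // mulr_gt0 //; lra.
have t1 : t <= 1 by rewrite ge_min lexx.
have tb : t * b < a.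
  have b1 : 0 < 2 * (b + 1) by lra.
  have : t <= a / (2 * (b + 1)) by rewrite ge_min lexx orbT.
  rewrite ler_pdivlMr //; nra.
have := descent_both x (t *: v) sf; rewrite ler_norml => /andP[h _].
have c01 : 0 <= t <= 1 by rewrite ltW.
have := convex_segment (x + v) x cf c01.
have -> : t *: (x + v) + (1 - t) *: x = x + t *: v.
  by apply/matrixP => i j; rewrite !mxE; ring.
move: h; rewrite normsqZ dotZr /a /b in tb *; move: tb; rewrite /a /b.
move=> h1 h2 h3.
have : t * (dot (gradient f x) v - (f (x + v) - f x)) <= t * (t * (L / 2 * normsq v)) by lra.
by rewrite ler_pM2l //; lra.
Qed.

End smooth.

Section oracle.
Context {R : realType} {d M : nat}.
Variables (f_ : 'I_M -> 'cV[R]_d -> R) (L : R).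
Hypotheses (M0 : (0 < M)%N) (L0 : 0 < L).
Hypothesis cvx : forall i, convex_on_space (f_ i).
Hypothesis smooth : forall i, L_smooth L (f_ i).
Local Notation f := (average f_).
Implicit Types (Q : 'M[R]_(d, M)) (x v z : 'cV[R]_d).

Let Mr : (0 : R) < M%:R. Proof. by rewrite ltr0n. Qed.

Definition grads Q : 'M[R]_(d, M) := \matrix_(k, i) gradient (f_ i) (col i Q) k 0.

Lemma col_grads Q i : col i (grads Q) = gradient (f_ i) (col i Q).
Proof. by apply/colP => k; rewrite !mxE. Qed.

(* Inexact first-order oracle: queries spread around their mean only cost the
   dispersion of Q. *)
Lemma mean_oracle Q : exists c, forall v,
  c + dot (mean (grads Q)) v <= f v /\
  f v <= c + dot (mean (grads Q)) v +
         L / 2 * (normsq (v - mean Q) + normsq (dis Q) / M%:R).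
Proof.
(* The part independent of v in the average of the tangents of the f_i at their own query points. *)
exists (M%:R^-1 * \sum_i (f_ i (col i Q) - dot (gradient (f_ i) (col i Q)) (col i Q))) => v.
have -> : dot (mean (grads Q)) v = M%:R^-1 * \sum_i dot (gradient (f_ i) (col i Q)) v.
  rewrite mean_col dotZl dotC dot_sumr; congr (_ * _).
  by apply: eq_bigr => i _; rewrite col_grads dotC.
rewrite /average -mulrDr -big_split /=.
have e : normsq (v - mean Q) + normsq (dis Q) / M%:R = M%:R^-1 * \sum_i normsq (v - col i Q).
  have -> : \sum_i normsq (v - col i Q) = normsq (Q - v *m ones).
    rewrite normsq_col; apply: eq_bigr => i _.
    by rewrite col_sub_rank1 -normsqN opprB.
  rewrite normsq_sub_rank1 // -(normsqN (mean Q - v)) opprB.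
  by field; rewrite gt_eqF.
split.
  apply: ler_wpM2l; first by rewrite invr_ge0 ltW.
  apply: ler_sum => i _.
  have := convex_lower L0 (col i Q) (v - col i Q) (cvx i) (smooth i).
  have ev : col i Q + (v - col i Q) = v by rewrite addrC subrK.
  by rewrite ev dotDr dotNr; lra.
rewrite e (mulrCA (L / 2)) -mulrDr [L / 2 * _]mulr_sumr -big_split /=.
apply: ler_wpM2l; first by rewrite invr_ge0 ltW.
apply: ler_sum => i _.
have := descent_both L0 (col i Q) (v - col i Q) (smooth i).
rewrite ler_norml => /andP[_].
have ev : col i Q + (v - col i Q) = v by rewrite addrC subrK.
by rewrite ev dotDr dotNr; lra.
Qed.

(** One step of the potential A (f x - f xs) + b/2 |z - xs|^2, with an arbitrary query Q. The
    mismatch between x' and the mean query stays as an error, and a term -b/4 |z' - z|^2 is left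
    over to pay for it. *)
Lemma dual_averaging_step Q A a b x z xs (gb : 'cV[R]_d) :
  0 <= A -> 0 < a -> 0 < b ->
  let e := gb - mean (grads Q) in
  let z' := z - (a / b) *: gb in
  let x' := (A + a)^-1 *: (A *: x + a *: z') in
  (A + a) * (f x' - f xs) + b / 2 * normsq (z' - xs) <=
  A * (f x - f xs) + b / 2 * normsq (z - xs)
  + a ^+ 2 * normsq e / b - a * dot e (z - xs) - b / 4 * normsq (z' - z)
  + (A + a) * (L / 2 * normsq (x' - mean Q)) + (A + a) * (L / 2 * (normsq (dis Q) / M%:R)).
Proof.
move=> A0 a0 b0; have Aa0 : 0 < A + a by lra.
cbv zeta; set e := gb - _; set z' := z - (a / b) *: gb; set x' := _^-1 *: _.
have [c h] := mean_oracle Q; set g := mean (grads Q) in h e *.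
have egb : gb = g + e by rewrite /e addrC subrK.
have h1 := proj1 (h x); have h2 := proj1 (h xs); have h3 := proj2 (h x').
have ex : (A + a) * dot g x' = A * dot g x + a * dot g z'.
  by rewrite /x' dotZr mulrA divff ?gt_eqF // mul1r dotDr (dotZr A) (dotZr a).
pose D := z' - z.
have ez' : z' = z + D by rewrite /D addrC subrK.
have eD : a *: gb = - (b *: D).
  by rewrite /D /z'; apply/matrixP => i j; rewrite !mxE; field; rewrite gt_eqF.
have eD0 : z' - z = D by [].
clearbody D z'.
have n1 : normsq (z' - xs) = normsq (z - xs) + 2 * dot (z - xs) D + normsq D.
  by rewrite ez' addrAC (normsqD (z - xs)).
have gd w : a * dot g w + a * dot e w = - b * dot D w.
  rewrite -mulrDr -dotDl -egb -dotZl eD dotNl dotZl; lra.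
(* The weight is chosen so that the noise uses half of the proximal term b/2 |D|^2; the other half
   is the -b/4 |z' - z|^2 of the statement when added to the b/4 spent here. *)
have y := young (- e) D (c := 2 * a / b).
have ab : 0 < 2 * a / b by rewrite divr_gt0 // mulr_gt0.
have {}y := y ab.
have y' : - (a * dot e D) <= a ^+ 2 * normsq e / b + b / 4 * normsq D.
  have a20 : 0 < a / 2 by rewrite divr_gt0.
  have := y; rewrite -(ler_pM2l a20) dotNl normsqN => h4.
  have -> : a ^+ 2 * normsq e / b + b / 4 * normsq D =
     a / 2 * (2 * a / b * normsq e + normsq D / (2 * a / b)).
    by field; rewrite !gt_eqF.
  by apply: le_trans h4; rewrite -subr_ge0; lra.
have gz := gd (z - xs); have gD := gd D.
have dz : dot g z' = dot g xs + dot g (z - xs) + dot g D by rewrite ez' !dotE; ring.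
have h1' := ler_wpM2l A0 h1.
have h2' := ler_wpM2l (ltW a0) h2.
have h3' := ler_wpM2l (ltW Aa0) h3.
have hc : dot (z - xs) D = dot D (z - xs) by rewrite dotC.
rewrite n1 eD0 hc.
have gDD : a * dot g D + a * dot e D = - b * normsq D by exact: gD.
rewrite dz in ex; lra.
Qed.
End oracle.

(** * Pathwise analysis of a run *)

Section run.
Context {R : realType} {d M : nat}.
Variables (f_ : 'I_M -> 'cV[R]_d -> R) (L sigma rho rad : R) (T B : nat).
Variables (W : 'M[R]_M) (edge : rel 'I_M).
Variables (orc : nat -> 'M[R]_(d, M) -> 'M[R]_(d, M)) (U : 'M[R]_(d, M)).
Hypotheses (M0 : (0 < M)%N) (L0 : 0 < L).
Hypothesis cvx : forall i, convex_on_space (f_ i).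
Hypothesis smooth : forall i, L_smooth L (f_ i).
Hypothesis gW : gossip_matrix edge W.
Hypothesis b1 : 1 <= beta_coef M L sigma rad T B.

Local Notation f := (average f_).
Local Notation prm := (rule_params M L sigma rho rad T B).
Local Notation st := (dda_run prm W orc U).
Local Notation b := (beta_coef M L sigma rad T B).
Local Notation a := (a_coef L).
Local Notation x t := (mean (dX (st t))).
Local Notation z t := (mean (dZ (st t))).
Local Notation g t := (mean (orc t (dQ (st t)))).
Local Notation err t := (g t - mean (grads f_ (dQ (st t)))).

(* The sum of the dual averaging weights [a_coef L i] over i < t. *)
Definition asum (L : R) (t : nat) : R := t%:R * t.+1%:R / (256 * L).

Lemma mean_gossip_iter al be (X : 'M[R]_(d, M)) s :
  mean (gossip_iter al be W X s).1 = mean X /\ mean (gossip_iter al be W X s).2 = mean X.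
Proof.
elim: s => [|s [IH1 IH2]] //=.
case: (gossip_iter al be W X s) IH1 IH2 => Y Y' /= IH1 IH2; split => //.
rewrite meanD !meanZ (mean_gossip gW) -scalerDl subrK scale1r.
by rewrite meanD meanZ meanB IH1 IH2 subrr scaler0 addr0.
Qed.

Lemma dZS t : dZ (st t.+1) = dZ (st t) - Defs.eta prm t *: orc t (dQ (st t)).
Proof. by []. Qed.
Lemma dXS t : dX (st t.+1) = (1 - theta prm t) *: dX (st t) + theta prm t *: dZ (st t.+1).
Proof. by []. Qed.

Lemma mean_dXS t : x t.+1 = (1 - theta prm t) *: x t + theta prm t *: z t.+1.
Proof. by rewrite dXS meanD !meanZ. Qed.
Lemma mean_dZS t : z t.+1 = z t - Defs.eta prm t *: g t.
Proof. by rewrite dZS meanB meanZ. Qed.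
Lemma mean_dXgS t : mean (dXg (st t.+1)) = x t.
Proof. by rewrite /=; case: (mean_gossip_iter (alpha_g prm) (beta_g prm) (dX (st t)) B). Qed.
Lemma mean_dQS t : mean (dQ (st t.+1)) =
  x t + (mom prm t * (1 + mom prm t.+1)) *: (x t - mean (dXg (st t))).
Proof.
rewrite [in LHS]/= meanD meanZ meanB.
by case: (mean_gossip_iter (alpha_g prm) (beta_g prm) (dX (st t)) B) => -> _.
Qed.

Lemma thetaE t : (t < T)%N -> theta prm t = 2 / (t%:R + 2).
Proof. by move=> tT; rewrite /= tT. Qed.
Lemma momE t : (t.+1 <= T)%N -> mom prm t.+1 = t%:R / (t%:R + 3).
Proof.
move=> tT; rewrite /= tT; congr (_ / _); rewrite -natr1; ring.
Qed.
Lemma mom0 : mom prm 0 = 0. Proof. by []. Qed.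
Lemma etaE t : (t < T)%N -> Defs.eta prm t = a t / b.
Proof. by move=> tT; rewrite /= tT. Qed.

(* X_{t+1} - Q_t splits into the current step and the step missed by the
   delayed extrapolation. *)
Lemma query_lag t : (t < T)%N ->
  x t.+1 - mean (dQ (st t)) =
  (2 / (t%:R + 2)) *: (z t.+1 - z t) +
  (if t is t'.+1 then ((2 * t%:R + 1) / (t%:R + 2) * (2 / (t%:R + 1))) *: (z t - z t') else 0).
Proof.
have nat0 k c : 0 < c -> (k%:R : R) + c != 0 by move=> c0; rewrite gt_eqF // ltr_wpDl.
(* Rounds 0 and 1 are separate: at first X, Z and Q coincide, then [mom0] cancels the
   extrapolation. *)
move=> tT; case: t tT => [|t] tT.
  rewrite mean_dXS thetaE // addr0.
  change (mean (dQ (st 0))) with (z 0).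
  change (x 0) with (z 0).
  move: (z 1%N) (z 0%N) => w w'.
  by apply/matrixP => i j; rewrite !mxE; field.
have tT' : (t < T)%N by exact: ltnW.
rewrite (mean_dQS t) (mean_dXS t.+1) (thetaE tT) (momE tT') -[in t.+1%:R](natr1 t).
case: t tT tT' => [|t] tT tT'.
  rewrite mom0 mul0r scale0r addr0 (mean_dXS 0) (thetaE tT').
  change (x 0) with (z 0).
  move: (z 2%N) (z 1%N) (z 0%N) => w w' w''.
  by apply/matrixP => i j; rewrite !mxE; field.
have tT'' : (t < T)%N by exact: ltnW.
rewrite mean_dXgS (momE tT'') -[in t.+1%:R](natr1 t) (mean_dXS t.+1) (thetaE tT') -[in t.+1%:R](natr1 t).
rewrite (mean_dXS t) (thetaE tT'').
move: (z t.+3) (z t.+2) (z t.+1) (x t) => w w' w'' v.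
apply/matrixP => i j; rewrite !mxE; field.
by rewrite -!addrA !nat0 ?addr_gt0.
Qed.

Lemma asum_rec t : asum L t.+1 = asum L t + a t.
Proof. by rewrite /asum /a_coef -!natr1; field; rewrite gt_eqF. Qed.

(** The rule for theta_t is the dual averaging weight a_t / A_{t+1}, so the algorithm's X is the
    convex combination in [dual_averaging_step]. *)
Lemma asum_theta t : a t / asum L t.+1 = 2 / (t%:R + 2).
Proof.
have nat0 c : 0 < c -> (t%:R : R) + c != 0 by move=> c0; rewrite gt_eqF // ltr_wpDl.
rewrite /asum /a_coef -(natr1 t.+1) -!natr1; field.
by rewrite !nat0 // gt_eqF.
Qed.

Lemma asum_ge0 t : 0 <= asum L t.
Proof. by rewrite /asum divr_ge0 ?mulr_ge0 // ltW. Qed.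
Lemma a_gt0 t : 0 < a t.
Proof. by rewrite /a_coef divr_gt0 ?mulr_gt0. Qed.

Let b0 : 0 < b. Proof. exact: lt_le_trans b1. Qed.

Definition zstep t : R := if t is t'.+1 then normsq (z t - z t') else 0.

(** The factor 128 in [a_coef] yields the coefficients 1/64 and 1/16, whose sum is below the 1/4
    available since b >= 1. *)
Lemma query_lag_sq t : (t < T)%N ->
  asum L t.+1 * (L / 2 * normsq (x t.+1 - mean (dQ (st t)))) <=
  1 / 64 * normsq (z t.+1 - z t) + 1 / 16 * zstep t.
Proof.
move=> tT; rewrite query_lag //.
set u := z t.+1 - z t; set c := 2 / (t%:R + 2).
have t0 : (0 : R) <= t%:R by [].
have A0 := asum_ge0 t.+1.
have AL : 0 <= asum L t.+1 * L by rewrite mulr_ge0 // ltW.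
have h1 : asum L t.+1 * L * c ^+ 2 <= 1 / 64.
  have -> : asum L t.+1 * L * c ^+ 2 = (t%:R + 1) / (64 * (t%:R + 2)).
    rewrite /asum /c -(natr1 t.+1) -!natr1; field.
    by rewrite !gt_eqF // ltr_wpDl.
  rewrite ler_pdivrMr; last by rewrite mulr_gt0 // ltr_wpDl.
  by lra.
case: t @u @c tT t0 A0 AL h1 => [|t] u c tT t0 A0 AL h1.
  rewrite addr0 normsqZ /zstep mulr0 addr0.
  have := normsq_ge0 u; move: h1; nra.
rewrite /zstep; set v := z t.+1 - z t; set c' := _ * (2 / _).
have h2 : asum L t.+2 * L * c' ^+ 2 <= 1 / 16.
  have -> : asum L t.+2 * L * c' ^+ 2 = (2 * t.+1%:R + 1) ^+ 2 / (64 * ((t.+1%:R + 2) * (t.+1%:R + 1))).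
    rewrite /asum /c' -(natr1 t.+2) -(natr1 t.+1); field.
    by rewrite !gt_eqF // ltr_wpDl.
  rewrite ler_pdivrMr; last by rewrite !mulr_gt0 // ltr_wpDl.
  by move: t0; move: (t.+1%:R : R) => s s0; nra.
have := normsqD_le (c *: u) (c' *: v); rewrite !normsqZ => h3.
have n1 := normsq_ge0 u; have n2 := normsq_ge0 v.
have := ler_wpM2l AL h3; have := ler_wpM2r n1 h1; have := ler_wpM2r n2 h2.
lra.
Qed.

(** The potential carries [zstep] / 16: the older increment in the lag is paid one round earlier, by
    the proximal term of the round that produced it. *)
Lemma run_step xs t : (t < T)%N ->
  asum L t.+1 * (f (x t.+1) - f xs) + b / 2 * normsq (z t.+1 - xs) + 1 / 16 * zstep t.+1 <=
  asum L t * (f (x t) - f xs) + b / 2 * normsq (z t - xs) + 1 / 16 * zstep t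
  + (a t ^+ 2 * normsq (err t) / b - a t * dot (err t) (z t - xs)
     + asum L t.+1 * (L / 2 * (normsq (dis (dQ (st t))) / M%:R))).
Proof.
move=> tT.
have h := dual_averaging_step M0 L0 cvx smooth (dQ (st t)) (x t) (z t) xs (g t)
  (asum_ge0 t) (a_gt0 t) b0.
have q := query_lag_sq tT.
have ez : z t - (a t / b) *: g t = z t.+1 by rewrite mean_dZS etaE.
move: h; cbv zeta; rewrite ez -asum_rec //.
have A0 : 0 < asum L t.+1 by rewrite /asum divr_gt0 ?mulr_gt0.
have ex : (asum L t.+1)^-1 *: (asum L t *: x t + a t *: z t.+1) = x t.+1.
  rewrite mean_dXS thetaE // -asum_theta scalerDr !scalerA; congr (_ *: _ + _ *: _).
    have -> : asum L t = asum L t.+1 - a t by rewrite asum_rec // addrK.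
    by field; rewrite gt_eqF.
  by rewrite mulrC.
rewrite ex => h.
have bb : 1 / 4 * normsq (z t.+1 - z t) <= b / 4 * normsq (z t.+1 - z t).
  by apply: ler_wpM2r; [exact: normsq_ge0 | rewrite ler_pM2r ?invr_gt0].
rewrite {1}/zstep; have := normsq_ge0 (z t.+1 - z t); lra.
Qed.

Lemma run_pathwise xs t : (t <= T)%N ->
  asum L t * (f (x t) - f xs) + b / 2 * normsq (z t - xs) <=
  b / 2 * normsq (mean U - xs)
  + \sum_(s < t) (a s ^+ 2 * normsq (err s) / b - a s * dot (err s) (z s - xs)
       + asum L s.+1 * (L / 2 * (normsq (dis (dQ (st s))) / M%:R))).
Proof.
suff h : (t <= T)%N ->
  asum L t * (f (x t) - f xs) + b / 2 * normsq (z t - xs) + 1 / 16 * zstep t <=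
  b / 2 * normsq (mean U - xs)
  + \sum_(s < t) (a s ^+ 2 * normsq (err s) / b - a s * dot (err s) (z s - xs)
       + asum L s.+1 * (L / 2 * (normsq (dis (dQ (st s))) / M%:R))).
  move=> /h; have : 0 <= zstep t by rewrite /zstep; case: (t) => // t'; exact: normsq_ge0.
  by lra.
elim: t => [|t IH] tT.
  by rewrite big_ord0 addr0 /zstep /asum mul0r mul0r mul0r mulr0 add0r addr0.
have := run_step xs tT; have := IH (ltnW tT); rewrite big_ord_recr /=.
move: (\sum_(i < t) _) => S; lra.
Qed.

Let be : R := (1 - Num.sqrt (rho / 2)) / (1 + Num.sqrt (rho / 2)).
Variable del : R.
Hypothesis del0 : 0 <= del.
Hypothesis contract : forall X : 'M[R]_(d, M),
  normsq (dis (gossip_iter (1 / 2) be W X B).1) <= del * normsq (dis X).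

Lemma normsq_dis_dZ t : (t <= T)%N ->
  normsq (dis (dZ (st t))) <= 2 * normsq (dis U)
    + 2 * (t%:R * \sum_(s < t) (a s / b) ^+ 2 * normsq (dis (orc s (dQ (st s))))).
Proof.
move=> tT.
have -> : dis (dZ (st t)) = dis U - \sum_(s < t) (a s / b) *: dis (orc s (dQ (st s))).
  elim: t tT => [|t IH] tT; first by rewrite big_ord0 subr0.
  by rewrite dZS disB disZ etaE // (IH (ltnW tT)) big_ord_recr /= opprD addrA.
apply: le_trans (normsqB_le _ _) _; rewrite lerD2l ler_pM2l //.
apply: le_trans (normsq_sum_le _ (fun s => (a s / b) *: dis (orc s (dQ (st s))))) _.
by rewrite ler_wpM2l //; apply: ler_sum => s _; rewrite normsqZ.
Qed.

Lemma normsq_dis_dXS t : (t < T)%N ->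
  normsq (dis (dX (st t.+1))) <=
  (1 - 2 / (t%:R + 2)) * normsq (dis (dX (st t))) + 2 / (t%:R + 2) * normsq (dis (dZ (st t.+1))).
Proof.
move=> tT; rewrite dXS disD !disZ thetaE //; apply: normsq_convex.
have t0 : (0 : R) <= t%:R by [].
by rewrite divr_ge0 ?ler_pdivrMr /=; lra.
Qed.

Lemma normsq_x_err xs t : (t < T)%N ->
  normsq (x t.+1 - xs) <=
  (1 - 2 / (t%:R + 2)) * normsq (x t - xs) + 2 / (t%:R + 2) * normsq (z t.+1 - xs).
Proof.
move=> tT; rewrite mean_dXS thetaE //; set th := _ / _.
have -> : (1 - th) *: x t + th *: z t.+1 - xs = (1 - th) *: (x t - xs) + th *: (z t.+1 - xs).
  by move: (x t) (z t.+1) => u v; apply/matrixP => i j; rewrite !mxE; ring.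
apply: normsq_convex; rewrite /th.
have t0 : (0 : R) <= t%:R by [].
by rewrite divr_ge0 ?ler_pdivrMr /=; lra.
Qed.

Lemma normsq_dis_dXgS t : normsq (dis (dXg (st t.+1))) <= del * normsq (dis (dX (st t))).
Proof. exact: contract. Qed.

Lemma extrapolation_bounds t : (t < T)%N ->
  0 <= mom prm t * (1 + mom prm t.+1) <= 2.
Proof.
case: t => [|t] tT; first by rewrite mom0 mul0r lexx /=.
rewrite (momE tT) (momE (ltnW tT)) -(natr1 t); set s : R := t%:R.
have s0 : 0 <= s by [].
have u0 : 0 <= s / (s + 3) <= 1 by rewrite divr_ge0 ?ler_pdivrMr /=; lra.
have v0 : 0 <= (s + 1) / (s + 1 + 3) <= 1 by rewrite divr_ge0 ?ler_pdivrMr /=; lra.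
by move: u0 v0; move: (s / _) ((s + 1) / _) => u v /andP[? ?] /andP[? ?]; apply/andP; split; nra.
Qed.

(** Here 18 = 2 * 3^2 and 8 = 2 * 2^2. Their sum 26 recurs in the conditions on the epoch. *)
Lemma normsq_extrapolate m n (u v : 'M[R]_(m, n)) c : 0 <= c <= 2 ->
  normsq (u + c *: (u - v)) <= 18 * normsq u + 8 * normsq v.
Proof.
move=> /andP[c0 c2].
have -> : u + c *: (u - v) = (1 + c) *: u - c *: v.
  by apply/matrixP => i j; rewrite !mxE; ring.
apply: le_trans (normsqB_le _ _) _; rewrite !normsqZ.
have h1 : (1 + c) ^+ 2 <= 9 by nra.
have h2 : c ^+ 2 <= 4 by nra.
have := ler_wpM2r (normsq_ge0 u) h1; have := ler_wpM2r (normsq_ge0 v) h2; lra.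
Qed.

Lemma dQS t : dQ (st t.+1) = dXg (st t.+1) +
   (mom prm t * (1 + mom prm t.+1)) *: (dXg (st t.+1) - dXg (st t)).
Proof. by []. Qed.

Lemma normsq_dis_dQS t : (t < T)%N ->
  normsq (dis (dQ (st t.+1))) <=
  del * (18 * normsq (dis (dX (st t))) + 8 * normsq (dis (dX (st t.-1)))).
Proof.
move=> tT; rewrite dQS.
(* At t = 0 the previous gossip output is U itself, which has not been contracted; [mom0] removes
   it. *)
case: t tT => [|t] tT.
  rewrite mom0 mul0r scale0r addr0; apply: le_trans (normsq_dis_dXgS 0) _.
  by rewrite ler_wpM2l //; have := normsq_ge0 (dis (dX (st 0))); rewrite /=; lra.
rewrite disD disZ disB.
apply: le_trans (normsq_extrapolate _ _ (extrapolation_bounds tT)) _.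
have := normsq_dis_dXgS t.+1; have := normsq_dis_dXgS t; rewrite [t.+1.-1]/=; lra.
Qed.

Lemma normsq_mean_dQS xs t : (t < T)%N ->
  normsq (mean (dQ (st t.+1)) - xs) <= 18 * normsq (x t - xs) + 8 * normsq (x t.-1 - xs).
Proof.
move=> tT; rewrite mean_dQS.
case: t tT => [|t] tT.
  rewrite mom0 mul0r scale0r addr0.
  by have := normsq_ge0 (x 0 - xs); rewrite [0.-1]/=; lra.
rewrite mean_dXgS [t.+1.-1]/=.
have -> : x t.+1 + (mom prm t.+1 * (1 + mom prm t.+2)) *: (x t.+1 - x t) - xs =
  (x t.+1 - xs) + (mom prm t.+1 * (1 + mom prm t.+2)) *: ((x t.+1 - xs) - (x t - xs)).
  by move: (x t.+1) (x t) (_ * _) => u v c; apply/matrixP => i j; rewrite !mxE; ring.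
exact: normsq_extrapolate (extrapolation_bounds tT).
Qed.

(** Each gradient is compared with the common vector c through the gradients at xs: noise, then
    Lipschitz error, then heterogeneity at the optimum only. *)
Lemma normsq_dis_oracle xs c zeta (G Q : 'M[R]_(d, M)) :
  \sum_(i < M) normsq (gradient (f_ i) xs - c) <= M%:R * zeta ^+ 2 ->
  normsq (dis G) <= 2 * normsq (G - grads f_ Q)
    + 4 * L ^+ 2 * (normsq (dis Q) + M%:R * normsq (mean Q - xs)) + 4 * (M%:R * zeta ^+ 2).
Proof.
move=> hz; apply: le_trans (normsq_dis_le M0 G c) _.
have -> : G - c *m ones = (G - grads f_ Q) + (grads f_ Q - c *m ones).
  by rewrite addrA subrK.
apply: le_trans (normsqD_le _ _) _; rewrite -addrA lerD2l.
rewrite (normsq_col (grads f_ Q - _)).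
apply: (@le_trans _ _ (2 * \sum_i (2 * (L ^+ 2 * normsq (col i Q - xs)) + 2 * normsq (gradient (f_ i) xs - c)))).
  rewrite ler_pM2l //; apply: ler_sum => i _; rewrite col_sub_rank1 col_grads.
  have -> : gradient (f_ i) (col i Q) - c =
     (gradient (f_ i) (col i Q) - gradient (f_ i) xs) + (gradient (f_ i) xs - c).
    by rewrite addrA subrK.
  apply: le_trans (normsqD_le _ _) _; rewrite lerD2r ler_pM2l //.
  rewrite -!enorm_sqr -exprMn.
  have [_ hL] := smooth i.
  have sqle (u v : R) : 0 <= u -> u <= v -> u ^+ 2 <= v ^+ 2 by nra.
  by apply: sqle; [exact: sqrtr_ge0 | exact: hL].
rewrite big_split /= -!mulr_sumr.
have -> : \sum_i normsq (col i Q - xs) = normsq (dis Q) + M%:R * normsq (mean Q - xs).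
  rewrite -normsq_sub_rank1 // normsq_col; apply: eq_bigr => i _.
  by rewrite col_sub_rank1.
lra.
Qed.

End run.

(** * Oracle noise *)

Section adapted.
Context d (T : measurableType d) (R : realType) (P : probability T R).
Implicit Types (X Y : T -> R) (F G : set (set T)).

Lemma le_RintegralT X Y : P.-integrable setT (EFin \o X) ->
  P.-integrable setT (EFin \o Y) -> (forall w, X w <= Y w) ->
  \int[P]_w X w <= \int[P]_w Y w.
Proof. by move=> iX iY XY; apply: le_Rintegral => // w _; exact: XY. Qed.

Lemma RintegralT_cst (c : R) : \int[P]_w c = c.
Proof. by rewrite Rintegral_cst // [X in fine X]probability_setT mulr1. Qed.

Lemma smeas_mono F G X : F `<=` G -> smeas F X -> smeas G X.
Proof. by move=> FG mX S mS; apply: FG; exact: mX. Qed.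

Lemma smeasD F X Y : sigma_algebra setT F -> smeas F X -> smeas F Y ->
  smeas F (fun w => X w + Y w).
Proof.
move=> sF /(smeasP _ sF) mX /(smeasP _ sF) mY; apply/(smeasP _ sF).
exact: measurable_funD.
Qed.

Lemma smeasZ F c X : sigma_algebra setT F -> smeas F X -> smeas F (fun w => c * X w).
Proof.
move=> sF /(smeasP _ sF) mX; apply/(smeasP _ sF); exact: measurable_funM.
Qed.

Lemma smeas_cst F (c : R) : sigma_algebra setT F -> smeas F (fun _ : T => c).
Proof. by move=> sF; apply/(smeasP _ sF). Qed.

(** Adapted square-integrable variables: stable under the linear operations of the algorithm, with
    integrable products. *)
Definition adm F X := smeas F X /\ sqint P X.

Lemma admD F X Y : sigma_algebra setT F -> adm F X -> adm F Y -> adm F (fun w => X w + Y w).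
Proof. by move=> sF [mX sX] [mY sY]; split; [exact: smeasD | exact: sqintD]. Qed.

Lemma admZ F c X : sigma_algebra setT F -> adm F X -> adm F (fun w => c * X w).
Proof. by move=> sF [mX sX]; split; [exact: smeasZ | exact: sqintZ]. Qed.

Lemma adm_cst F c : sigma_algebra setT F -> adm F (fun=> c).
Proof. by move=> sF; split; [exact: smeas_cst | exact: sqint_cst]. Qed.

Lemma adm_sum F (I : Type) (s : seq I) (h : I -> T -> R) : sigma_algebra setT F ->
  (forall i, adm F (h i)) -> adm F (fun w => \sum_(i <- s) h i w).
Proof.
move=> sF ah; elim: s => [|i s IH].
  by under eq_fun do rewrite big_nil; exact: adm_cst.
by under eq_fun do rewrite big_cons; exact: admD.
Qed.

Lemma adm_mono F G X : F `<=` G -> adm F X -> adm G X.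
Proof. by move=> FG [mX sX]; split => //; exact: smeas_mono mX. Qed.

Definition madm m n F (A : T -> 'M[R]_(m, n)) := forall i j, adm F (fun w => A w i j).

Lemma madmD m n F (A B : T -> 'M[R]_(m, n)) : sigma_algebra setT F ->
  madm F A -> madm F B -> madm F (fun w => A w + B w).
Proof. by move=> sF hA hB i j; under eq_fun do rewrite mxE; exact: admD. Qed.

Lemma madmZ m n F c (A : T -> 'M[R]_(m, n)) : sigma_algebra setT F ->
  madm F A -> madm F (fun w => c *: A w).
Proof. by move=> sF hA i j; under eq_fun do rewrite mxE; exact: admZ. Qed.

Lemma madmB m n F (A B : T -> 'M[R]_(m, n)) : sigma_algebra setT F ->
  madm F A -> madm F B -> madm F (fun w => A w - B w).
Proof.
move=> sF hA hB; under eq_fun do rewrite -scaleN1r.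
by apply: madmD => //; exact: madmZ.
Qed.

Lemma madm_cst m n F (A : 'M[R]_(m, n)) : sigma_algebra setT F -> madm F (fun=> A).
Proof. by move=> sF i j; exact: adm_cst. Qed.

Lemma madm_mulmx m n p F (A : T -> 'M[R]_(m, n)) (C : 'M[R]_(n, p)) : sigma_algebra setT F ->
  madm F A -> madm F (fun w => A w *m C).
Proof.
move=> sF hA i j; under eq_fun do rewrite mxE.
by apply: adm_sum => // k; under eq_fun do rewrite mulrC; exact: admZ.
Qed.

Lemma madm_col m n F (A : T -> 'M[R]_(m, n)) k : madm F A -> madm F (fun w => col k (A w)).
Proof. by move=> hA i j; under eq_fun do rewrite mxE. Qed.

Lemma madm_mono m n F G (A : T -> 'M[R]_(m, n)) : F `<=` G -> madm F A -> madm G A.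
Proof. by move=> FG hA i j; exact: adm_mono (hA i j). Qed.

Lemma dot_integrable m n F (A B : T -> 'M[R]_(m, n)) : madm F A -> madm F B ->
  P.-integrable setT (EFin \o (fun w => dot (A w) (B w))).
Proof.
move=> hA hB; rewrite /dot.
apply: (proj1 (RintegralT_sum _ _)) => i _; apply: (proj1 (RintegralT_sum _ _)) => j _.
exact: (sqintM (proj2 (hA i j)) (proj2 (hB i j))).
Qed.

Lemma normsq_integrable m n F (A : T -> 'M[R]_(m, n)) : madm F A ->
  P.-integrable setT (EFin \o (fun w => normsq (A w))).
Proof. by move=> hA; exact: (dot_integrable hA hA). Qed.

End adapted.

Lemma sigma_of_sigma_algebra {T : Type} {R : realType} {d} (X : T -> 'cV[R]_d) :
  sigma_algebra setT (sigma_of X).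
Proof. exact: smallest_sigma_algebra. Qed.

Lemma smeas_sigma_of {T : Type} {R : realType} {d} (X : T -> 'cV[R]_d) k :
  smeas (sigma_of X) (fun w => X w k 0).
Proof. by move=> S mS; apply: sub_sigma_algebra; exists k, S. Qed.

Section noise.
Context disp (T : measurableType disp) (R : realType) (P : probability T R).
Context {d M : nat} {B : nat}.
Variables (f_ : 'I_M -> 'cV[R]_d -> R) (L sigma : R).
Variables (F F' : set (set T)) (Q : T -> 'M[R]_(d, M)).
Variable ans : 'I_M -> nat -> T -> 'cV[R]_d.
Hypotheses (M0 : (0 < M)%N) (B0 : (0 < B)%N) (L0 : 0 < L).
Hypothesis smooth : forall i, L_smooth L (f_ i).
Hypotheses (sF : sigma_algebra setT F) (FT : F `<=` measurable).
Hypotheses (sF' : sigma_algebra setT F') (FT' : F' `<=` measurable).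
Hypothesis FF' : F `<=` F'.
Hypothesis hQ : madm P F Q.
Hypothesis ans_meas : forall i b, (b < B)%N -> sigma_of (ans i b) `<=` F'.
Hypothesis unbiased : forall i b, (b < B)%N -> forall k,
  cond_exp_version P F (fun w => ans i b w k 0)
    (fun w => gradient (f_ i) (col i (Q w)) k 0).
Hypothesis variance_le : forall i b, (b < B)%N -> exists V : T -> R,
  cond_exp_version P F
    (fun w => enorm (ans i b w - gradient (f_ i) (col i (Q w))) ^+ 2) V /\
  {ae P, forall w, V w <= sigma ^+ 2}.
Hypothesis indep : cond_independent P F
  (fun ib : 'I_M * 'I_B => sigma_of (ans ib.1 ib.2)).

Definition noise i b w := ans i b w - gradient (f_ i) (col i (Q w)).
Definition batch w : 'M[R]_(d, M) := \matrix_(k, i) (B%:R^-1 * \sum_(b < B) ans i b w k 0).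

Let FsetT : F setT. Proof. by have [h0 hC _] := sF; have := hC _ h0; rewrite setD0. Qed.

(** Measurability of the gradient at the query is read off the unbiasedness hypothesis, which needs
    a sample index; square integrability comes from the Lipschitz bound. *)
Lemma madm_grad i : (exists b, (b < B)%N) -> madm P F (fun w => gradient (f_ i) (col i (Q w))).
Proof.
move=> [b bB] k j; rewrite (ord1 j).
have [_ _ m _] := unbiased i bB k; split; first exact: m.
have [_ gL] := smooth i.
set g0 := gradient (f_ i) 0.
have hc : madm P F (fun w => col i (Q w)) by exact: madm_col.
apply: (@sqint_of_sqr _ _ _ _ _ (fun w => 2 * L ^+ 2 * normsq (col i (Q w)) + 2 * normsq g0)).
- exact: smeas_measurable m.
- apply: integrableDR; last exact: integrable_cstR.
  by apply: integrableZlR; exact: (normsq_integrable hc).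
- move=> w; set v := col i (Q w).
  have h1 : normsq (gradient (f_ i) v - g0) <= L ^+ 2 * normsq v.
    have := gL v 0; rewrite subr0 -!enorm_sqr -exprMn.
    have sqle (s t : R) : 0 <= s -> s <= t -> s ^+ 2 <= t ^+ 2 by nra.
    by apply: sqle; exact: sqrtr_ge0.
  have h2 : gradient (f_ i) v k 0 ^+ 2 <= normsq (gradient (f_ i) v).
    rewrite /normsq /dot (bigD1 k) //= big_ord1 expr2 lerDl; apply: sumr_ge0 => l _.
    by rewrite big_ord1 -expr2 sqr_ge0.
  have h3 := normsqD_le (gradient (f_ i) v - g0) g0.
  rewrite subrK in h3; lra.
Qed.

Lemma variance_bound i b : (b < B)%N ->
  P.-integrable setT (EFin \o (fun w => normsq (noise i b w))) /\
  \int[P]_w normsq (noise i b w) <= sigma ^+ 2.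
Proof.
move=> bB; have [V [[iX iV mV e] aeV]] := variance_le i bB.
have iN : P.-integrable setT (EFin \o (fun w => normsq (noise i b w))).
  by apply: eq_integrable iX => // w _ /=; rewrite enorm_sqr.
split => //.
have -> : \int[P]_w normsq (noise i b w) = \int[P]_w V w.
  rewrite -[RHS]/(fine _) -(e _ FsetT); congr fine.
  by apply: eq_integral => w _; rewrite enorm_sqr.
have mVT : measurable_fun setT V := smeas_measurable FT mV.
(* V is bounded by sigma^2 only almost everywhere; the minimum is bounded everywhere and has the
   same integral. *)
have mm : measurable_fun setT (fun w => Num.min (V w) (sigma ^+ 2)).
  exact: measurable_minr.
have im : P.-integrable setT (EFin \o (fun w => Num.min (V w) (sigma ^+ 2))).
  apply: (@integrable_dom _ _ _ _ _ (fun w => `|V w| + sigma ^+ 2)) => //.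
    move=> w; case: (leP (V w) (sigma ^+ 2)) => h; first by rewrite lerDl sqr_ge0.
    by rewrite ger0_norm ?sqr_ge0 // lerDr.
  apply: integrableDR; last exact: integrable_cstR.
  by have := integrable_abse iV; apply: eq_integrable.
have -> : \int[P]_w V w = \int[P]_w Num.min (V w) (sigma ^+ 2).
  congr fine; apply: ae_eq_integral => //; first exact/measurable_EFinP.
    exact/measurable_EFinP.
  by apply: filterS aeV => w Vw _ /=; rewrite min_l.
rewrite -[leRHS](RintegralT_cst P); apply: le_RintegralT => //.
  exact: integrable_cstR.
by move=> w; rewrite ge_min lexx orbT.
Qed.

Let bB_ex : exists b, (b < B)%N. Proof. by exists 0%N. Qed.

(** An answer is noise plus gradient: the first is square integrable by the variance bound, the
    second by [madm_grad]. *)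
Lemma madm_ans i b : (b < B)%N -> madm P F' (ans i b).
Proof.
move=> bB k j; rewrite (ord1 j).
have m : smeas F' (fun w => ans i b w k 0).
  apply: (@smeas_mono _ _ _ _ _ _ (@ans_meas i b bB)).
  exact: (@smeas_sigma_of _ _ _ (ans i b) k).
split => //.
have gr := madm_grad i bB_ex k 0.
have mg : measurable_fun setT (fun w => gradient (f_ i) (col i (Q w)) k 0).
  exact: (proj1 (proj2 gr)).
have mn : measurable_fun setT (fun w => noise i b w k 0).
  rewrite (_ : (fun w => _) = (fun w => ans i b w k 0 - gradient (f_ i) (col i (Q w)) k 0)).
    apply: measurable_funB => //; exact: smeas_measurable m.
  by apply/funext => w; rewrite !mxE.
have sn : sqint P (fun w => noise i b w k 0).
  apply: (sqint_of_sqr mn (proj1 (variance_bound i bB))) => w.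
  rewrite /normsq /dot (bigD1 k) //= big_ord1 expr2 lerDl; apply: sumr_ge0 => l _.
  by rewrite big_ord1 -expr2 sqr_ge0.
have := sqintD sn (proj2 gr).
rewrite (_ : (fun w => _) = (fun w => ans i b w k 0)) //.
by apply/funext => w; rewrite /noise !mxE subrK.
Qed.

Lemma madm_noise i b : (b < B)%N -> madm P F' (noise i b).
Proof.
move=> bB; apply: madmB => //; first exact: madm_ans.
exact: (madm_mono FF' (madm_grad i bB_ex)).
Qed.

Lemma madm_batch : madm P F' batch.
Proof.
move=> k i; under eq_fun do rewrite mxE.
by apply: admZ => //; apply: adm_sum => // b; exact: (madm_ans _ (ltn_ord b) k 0).
Qed.

Lemma madm_grads : madm P F (fun w => grads f_ (Q w)).
Proof. by move=> k i; under eq_fun do rewrite mxE; exact: (madm_grad i bB_ex k 0). Qed.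

Lemma pair_indep (j j' : 'I_M * 'I_B) A1 A2 p1 p2 : j != j' ->
  sigma_of (ans j.1 j.2) A1 -> sigma_of (ans j'.1 j'.2) A2 ->
  cond_exp_version P F (\1_A1) p1 -> cond_exp_version P F (\1_A2) p2 ->
  cond_exp_version P F (\1_(A1 `&` A2)) (fun w => p1 w * p2 w).
Proof.
move=> jj' h1 h2 c1 c2.
pose A (l : 'I_M * 'I_B) : set T := if l == j then A1 else if l == j' then A2 else setT.
pose p (l : 'I_M * 'I_B) : T -> R := if l == j then p1 else if l == j' then p2 else fun=> 1.
have hA (l : 'I_M * 'I_B) : sigma_of (ans l.1 l.2) (A l).
  rewrite /A; case: eqP => [->//|_]; case: eqP => [->//|_].
  have [s0 sC _] := @sigma_of_sigma_algebra _ _ _ (ans l.1 l.2).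
  by have := sC _ s0; rewrite setD0.
have hp (l : 'I_M * 'I_B) : cond_exp_version P F (\1_(A l)) (p l).
  rewrite /A /p; case: eqP => // _; case: eqP => // _.
  have -> : (\1_[set: T] : T -> R) = fun=> 1.
    by apply/funext => w; rewrite indicE mem_set.
  split => //; try exact: integrable_cstR.
  by move=> S mS; exact: (smeas_cst 1 sF).
have := indep hA hp.
have -> : \bigcap_(l in [set: 'I_M * 'I_B]) A l = A1 `&` A2.
  apply/seteqP; split => w /=.
    move=> h; have := h j I; have := h j' I; rewrite /A !eqxx.
    by rewrite eq_sym (negbTE jj').
  by move=> [w1 w2] l _; rewrite /A; case: eqP => // _; case: eqP.
have -> // : (fun w => \prod_l p l w) = (fun w => p1 w * p2 w).
apply/funext => w; rewrite (bigD1 j) //= (bigD1 j') /=; last by rewrite eq_sym.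
rewrite big1 ?mulr1; last first.
  by move=> l /andP[lj lj']; rewrite /p (negbTE lj) (negbTE lj').
by rewrite /p !eqxx eq_sym (negbTE jj').
Qed.

Lemma noise_uncorrelated (j j' : 'I_M * 'I_B) k : j != j' ->
  \int[P]_w (noise j.1 j.2 w k 0 * noise j'.1 j'.2 w k 0) = 0.
Proof.
move=> jj'.
have HT (l : 'I_M * 'I_B) : sigma_of (ans l.1 l.2) `<=` measurable.
  exact: subset_trans (@ans_meas l.1 l.2 (ltn_ord l.2)) FT'.
have := @uncorrelated _ _ _ P F (sigma_of (ans j.1 j.2)) (sigma_of (ans j'.1 j'.2))
   (fun w => ans j.1 j.2 w k 0) (fun w => gradient (f_ j.1) (col j.1 (Q w)) k 0)
   (fun w => ans j'.1 j'.2 w k 0) (fun w => gradient (f_ j'.1) (col j'.1 (Q w)) k 0)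
   sF FT (sigma_of_sigma_algebra _) (HT j) (sigma_of_sigma_algebra _) (HT j')
   (fun A1 A2 p1 p2 => @pair_indep j j' A1 A2 p1 p2 jj')
   (@smeas_sigma_of _ _ _ (ans j.1 j.2) k) (@smeas_sigma_of _ _ _ (ans j'.1 j'.2) k)
   (unbiased _ (ltn_ord j.2) k) (unbiased _ (ltn_ord j'.2) k)
   (proj2 (madm_ans _ (ltn_ord j.2) k 0)) (proj2 (madm_grad _ bB_ex k 0))
   (proj2 (madm_ans _ (ltn_ord j'.2) k 0)) (proj2 (madm_grad _ bB_ex k 0)).
move=> e; rewrite -[RHS]e; apply: eq_Rintegral => w _.
by rewrite /noise !mxE.
Qed.

Let n_ (j : 'I_M * 'I_B) := noise j.1 j.2.
Let err w := mean (batch w) - mean (grads f_ (Q w)).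
Let MB : R := M%:R * B%:R.

Let MB0 : 0 < MB. Proof. by rewrite mulr_gt0 ?ltr0n. Qed.

Let errE w k : err w k 0 = MB^-1 * \sum_j n_ j w k 0.
Proof.
rewrite /err mxE [X in _ + X]mxE !meanE.
have -> : \sum_j n_ j w k 0 = \sum_i \sum_(b < B) noise i b w k 0.
  by rewrite pair_big.
rewrite -mulrBr -sumrB /MB invfM -mulrA; congr (_ * _); rewrite mulr_sumr.
apply: eq_bigr => i _; rewrite !mxE.
under [in RHS]eq_bigr do rewrite /noise mxE [X in _ + X]mxE.
rewrite sumrB mulrBr; congr (_ - _).
have Bn0 : (B%:R : R) != 0 by rewrite pnatr_eq0 -lt0n.
rewrite sumr_const card_ord -(mulr_natl (gradient _ _ _ _)) mulKf //.
  by rewrite [RHS]mxE.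
Qed.

(** Known before the round, Z can be pulled out of the conditional expectation. This removes the
    linear noise term of the potential. *)
Lemma noise_mean0 (Z : T -> 'cV[R]_d) : madm P F Z ->
  P.-integrable setT (EFin \o (fun w => dot (err w) (Z w))) /\
  \int[P]_w dot (err w) (Z w) = 0.
Proof.
move=> hZ.
have e w : dot (err w) (Z w) = MB^-1 * \sum_k \sum_j (Z w k 0 * n_ j w k 0).
  rewrite /dot mulr_sumr; apply: eq_bigr => k _; rewrite big_ord1 errE -mulrA; congr (_ * _).
  by rewrite mulr_suml; apply: eq_bigr => j _; rewrite mulrC.
have i1 k (j : 'I_M * 'I_B) : P.-integrable setT (EFin \o (fun w => Z w k 0 * n_ j w k 0)).
  by apply: sqintM; [exact: (proj2 (hZ k 0)) | exact: (proj2 (madm_noise j.1 (ltn_ord j.2) k 0))].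
have h2 k := RintegralT_sum (index_enum ('I_M * 'I_B)%type) (Q := xpredT) (fun j _ => i1 k j).
have h3 := RintegralT_sum (index_enum 'I_d) (Q := xpredT) (fun k _ => proj1 (h2 k)).
split.
  have := integrableZlR MB^-1 (proj1 h3).
  by apply: eq_integrable => // w _ /=; rewrite e.
under eq_Rintegral do rewrite e.
rewrite (RintegralZl _ measurableT (proj1 h3)) (proj2 h3) big1 ?mulr0 // => k _.
rewrite (proj2 (h2 k)) big1 // => j _.
have := pull_out sF FT (unbiased j.1 (ltn_ord j.2) k) (proj1 (hZ k 0)).
have e2 : (fun w => Z w k 0 * (ans j.1 j.2 w k 0 - gradient (f_ j.1) (col j.1 (Q w)) k 0)) =
   (fun w => Z w k 0 * n_ j w k 0) by apply/funext => w; rewrite /n_ /noise !mxE.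
by rewrite e2; apply.
Qed.

Lemma madm_err : madm P F' err.
Proof.
apply: madmB => //; first exact: (madm_mulmx _ _ madm_batch).
apply: madm_mulmx => //; exact: (madm_mono FF' madm_grads).
Qed.

(** Only the MB diagonal terms of the expanded square survive, by [noise_uncorrelated]; this is the
    gain from all workers and samples. *)
Lemma noise_second_moment : \int[P]_w normsq (err w) <= sigma ^+ 2 / MB.
Proof.
have e w : normsq (err w) = (MB^-1) ^+ 2 * \sum_k \sum_j \sum_j' (n_ j w k 0 * n_ j' w k 0).
  rewrite /normsq /dot mulr_sumr; apply: eq_bigr => k _; rewrite big_ord1 errE.
  rewrite mulrACA -expr2; congr (_ * _); rewrite mulr_suml.
  by apply: eq_bigr => j _; rewrite mulr_sumr.
have sn k (j : 'I_M * 'I_B) : sqint P (fun w => n_ j w k 0).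
  exact: (proj2 (madm_noise j.1 (ltn_ord j.2) k 0)).
have i1 k j j' := sqintM (sn k j) (sn k j').
have h1 k j := RintegralT_sum (index_enum ('I_M * 'I_B)%type) (Q := xpredT) (fun j' _ => i1 k j j').
have h2 k := RintegralT_sum (index_enum ('I_M * 'I_B)%type) (Q := xpredT) (fun j _ => proj1 (h1 k j)).
have h3 := RintegralT_sum (index_enum 'I_d) (Q := xpredT) (fun k _ => proj1 (h2 k)).
under eq_Rintegral do rewrite e.
rewrite (RintegralZl _ measurableT (proj1 h3)) (proj2 h3).
have -> : \sum_k \int[P]_w (\sum_j \sum_j' (n_ j w k 0 * n_ j' w k 0)) =
   \sum_j \int[P]_w normsq (n_ j w).
  transitivity (\sum_k \sum_j \int[P]_w (n_ j w k 0 * n_ j w k 0)).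
    apply: eq_bigr => k _; rewrite (proj2 (h2 k)); apply: eq_bigr => j _.
    rewrite (proj2 (h1 k j)) (bigD1 j) //= big1 ?addr0 // => j' jj'.
    by apply: noise_uncorrelated; rewrite eq_sym.
  rewrite exchange_big /=; apply: eq_bigr => j _.
  rewrite -(proj2 (RintegralT_sum _ (Q := xpredT) (fun k _ => i1 k j j))).
  by apply: eq_Rintegral => w _; rewrite /normsq /dot; apply: eq_bigr => k _; rewrite big_ord1.
have -> : sigma ^+ 2 / MB = MB^-1 ^+ 2 * (MB * sigma ^+ 2) by field; rewrite gt_eqF.
rewrite ler_wpM2l ?sqr_ge0 //.
have -> : MB * sigma ^+ 2 = \sum_(j : 'I_M * 'I_B) sigma ^+ 2.
  by rewrite sumr_const card_prod !card_ord /MB -natrM mulr_natl.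
by apply: ler_sum => j _; exact: (proj2 (variance_bound j.1 (ltn_ord j.2))).
Qed.

(** Jensen's inequality over each batch. The bound enters only the dispersion, where gossip
    contraction outweighs the lost factor B. *)
Lemma noise_total : \int[P]_w normsq (batch w - grads f_ (Q w)) <= M%:R * sigma ^+ 2.
Proof.
have Br : (0 : R) < B%:R by rewrite ltr0n.
have le w : normsq (batch w - grads f_ (Q w)) <= B%:R^-1 * \sum_j normsq (n_ j w).
  have -> : \sum_j normsq (n_ j w) = \sum_i \sum_(b < B) normsq (noise i b w).
    by rewrite [RHS]pair_big; apply: eq_bigr.
  rewrite normsq_col mulr_sumr; apply: ler_sum => i _.
  have -> : col i (batch w - grads f_ (Q w)) = B%:R^-1 *: \sum_(b < B) noise i b w.
    apply/colP => k; rewrite !mxE summxE.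
    under [in RHS]eq_bigr do rewrite /noise mxE [X in _ + X]mxE.
    rewrite sumrB mulrBr; congr (_ - _).
    have Bn0 : (B%:R : R) != 0 by rewrite gt_eqF.
    rewrite sumr_const card_ord -(mulr_natl (gradient _ _ _ _)) mulKf //.
  by rewrite [RHS]mxE.
  rewrite normsqZ expr2 -mulrA; apply: ler_wpM2l; first by rewrite invr_ge0 ltW.
  rewrite ler_pdivrMl //; exact: (normsq_sum_le B (fun b => noise i b w)).
have i1 (j : 'I_M * 'I_B) := proj1 (variance_bound j.1 (ltn_ord j.2)).
have h1 := RintegralT_sum (index_enum ('I_M * 'I_B)%type) (Q := xpredT) (fun j _ => i1 j).
have iG : madm P F' (fun w => batch w - grads f_ (Q w)).
  by apply: madmB => //; [exact: madm_batch | exact: (madm_mono FF' madm_grads)].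
apply: (le_trans (le_RintegralT (normsq_integrable iG) (integrableZlR _ (proj1 h1)) le)).
rewrite (RintegralZl _ measurableT (proj1 h1)) (proj2 h1).
rewrite mulrC ler_pdivrMr //.
have -> : M%:R * sigma ^+ 2 * B%:R = \sum_(j : 'I_M * 'I_B) sigma ^+ 2.
  by rewrite sumr_const card_prod !card_ord -[RHS]mulr_natl natrM; ring.
by apply: ler_sum => j _; exact: (proj2 (variance_bound j.1 (ltn_ord j.2))).
Qed.

End noise.

(** * One epoch in expectation *)

Lemma sqr_le {R : realDomainType} (s t : R) : 0 <= s -> s <= t -> s ^+ 2 <= t ^+ 2.
Proof. by move=> s0 st; rewrite lerXn2r // nnegrE (le_trans s0). Qed.

Lemma lincomb_le {R : realDomainType} (c1 c2 x y m : R) :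
  0 <= c1 -> 0 <= c2 -> x <= m -> y <= m -> c1 * x + c2 * y <= (c1 + c2) * m.
Proof. by move=> *; rewrite mulrDl lerD // ler_wpM2l. Qed.

Section expectation_bounds.
Context disp (T : measurableType disp) (R : realType) (P : probability T R).
Implicit Types X Y : T -> R.

Lemma expectation_lincomb X Y1 Y2 Y3 (c0 c1 c2 c3 : R) :
  P.-integrable setT (EFin \o X) -> P.-integrable setT (EFin \o Y1) ->
  P.-integrable setT (EFin \o Y2) -> P.-integrable setT (EFin \o Y3) ->
  (forall w, X w <= c0 + c1 * Y1 w + c2 * Y2 w + c3 * Y3 w) ->
  \int[P]_w X w <= c0 + c1 * \int[P]_w Y1 w + c2 * \int[P]_w Y2 w + c3 * \int[P]_w Y3 w.
Proof.
move=> iX i1 i2 i3 h.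
have j1 := integrableZlR c1 i1; have j2 := integrableZlR c2 i2.
have j3 := integrableZlR c3 i3; have j0 := integrable_cstR P c0.
have k1 := integrableDR j0 j1; have k2 := integrableDR k1 j2; have k3 := integrableDR k2 j3.
apply: (le_trans (le_RintegralT iX k3 h)).
rewrite (RintegralD _ k2 j3) // (RintegralD _ k1 j2) // (RintegralD _ j0 j1) //.
by rewrite !RintegralZl // RintegralT_cst.
Qed.

Lemma expectation_lincomb2 X Y1 Y2 (c1 c2 : R) :
  P.-integrable setT (EFin \o X) -> P.-integrable setT (EFin \o Y1) ->
  P.-integrable setT (EFin \o Y2) ->
  (forall w, X w <= c1 * Y1 w + c2 * Y2 w) ->
  \int[P]_w X w <= c1 * \int[P]_w Y1 w + c2 * \int[P]_w Y2 w.
Proof.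
move=> iX i1 i2 h.
have := @expectation_lincomb X Y1 Y2 Y2 0 c1 c2 0 iX i1 i2 i2.
rewrite mul0r addr0 add0r; apply => w; have := h w; lra.
Qed.
End expectation_bounds.

Section epoch.
Context disp (Omega : measurableType disp) (R : realType) (P : probability Omega R).
Context {d M : nat}.
Variables (f_ : 'I_M -> 'cV[R]_d -> R) (L sigma zeta rho rad : R) (T B : nat).
Variables (W : 'M[R]_M) (edge : rel 'I_M) (xs c : 'cV[R]_d).
Variables (Xi : 'I_M -> Type) (G : forall i : 'I_M, 'cV[R]_d -> Xi i -> 'cV[R]_d).
Variables (xi : Omega -> nat -> forall i : 'I_M, nat -> Xi i).
Variables (F : nat -> set (set Omega)) (U : Omega -> 'M[R]_(d, M)).
Local Notation prm := (rule_params M L sigma rho rad T B).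
Local Notation st w t := (dda_sgd_state prm W (@G) (xi w) (U w) t).
Local Notation f := (average f_).
Local Notation b := (beta_coef M L sigma rad T B).
Local Notation a := (a_coef L).
Let ans t i k w := @G i (col i (dQ (st w t))) (xi w t i k).

Hypotheses (M0 : (0 < M)%N) (B0 : (0 < B)%N) (T0 : (0 < T)%N) (L0 : 0 < L).
Hypotheses (sigma0 : 0 <= sigma) (rad0 : 0 < rad).
Hypothesis cvx : forall i, convex_on_space (f_ i).
Hypothesis smooth : forall i, L_smooth L (f_ i).
Hypothesis xs_min : forall v, f xs <= f v.
Hypothesis het : \sum_(i < M) normsq (gradient (f_ i) xs - c) <= M%:R * zeta ^+ 2.
Hypothesis gW : gossip_matrix edge W.
Variable del : R.
Hypothesis del0 : 0 <= del.
Hypothesis contract : forall X : 'M[R]_(d, M),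
  normsq (dis (gossip_iter (1 / 2)
    ((1 - Num.sqrt (rho / 2)) / (1 + Num.sqrt (rho / 2))) W X B).1) <= del * normsq (dis X).

Hypothesis sF : forall t, sigma_algebra setT (F t).
Hypothesis FT : forall t, F t `<=` measurable.
Hypothesis FS : forall t, (t <= T)%N -> F t `<=` F t.+1.
Hypothesis ans_meas : forall t i k, (t <= T)%N -> (k < B)%N ->
  sigma_of (ans t i k) `<=` F t.+1.
Hypothesis unbiased : forall t i k, (t <= T)%N -> (k < B)%N -> forall l,
  cond_exp_version P (F t) (fun w => ans t i k w l 0)
    (fun w => gradient (f_ i) (col i (dQ (st w t))) l 0).
Hypothesis variance_le : forall t i k, (t <= T)%N -> (k < B)%N -> exists V : Omega -> R,
  cond_exp_version P (F t)
    (fun w => enorm (ans t i k w - gradient (f_ i) (col i (dQ (st w t)))) ^+ 2) V /\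
  {ae P, forall w, V w <= sigma ^+ 2}.
Hypothesis indep : forall t, (t <= T)%N -> cond_independent P (F t)
  (fun ib : 'I_M * 'I_B => sigma_of (ans t ib.1 ib.2)).
Hypothesis hU : madm P (F 0%N) U.

Let Q t w := dQ (st w t).
Let X t w := dX (st w t).
Let Z t w := dZ (st w t).
Let Gr t w := minibatch (@G) B (xi w t) (Q t w).

Let batchE t : batch (B := B) (ans t) = Gr t.
Proof. by []. Qed.

Lemma madm_gossip_iter F' al be (A : Omega -> 'M[R]_(d, M)) s : sigma_algebra setT F' ->
  madm P F' A -> madm P F' (fun w => (gossip_iter al be W (A w) s).1) /\
  madm P F' (fun w => (gossip_iter al be W (A w) s).2).
Proof.
move=> sF' hA; elim: s => [|s [h1 h2]] //.
have e w : gossip_iter al be W (A w) s.+1 =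
  let Y := (gossip_iter al be W (A w) s).1 in
  let V := Y + be *: (Y - (gossip_iter al be W (A w) s).2) in
  ((1 - al) *: V + al *: (V *m W), Y) by rewrite /=; case: gossip_iter.
have hV : madm P F' (fun w => (gossip_iter al be W (A w) s).1 + be *: ((gossip_iter al be W (A w) s).1 - (gossip_iter al be W (A w) s).2)).
  by apply: madmD => //; apply: madmZ => //; apply: madmB.
split.
  under eq_fun do rewrite e /=.
  by apply: madmD => //; apply: madmZ => //; apply: madm_mulmx.
by under eq_fun do rewrite e /=.
Qed.

Ltac round_hyps tT := first [ assumption | exact: sF | exact: FT | exact: (FS tT)
  | exact: (fun i k kB => @ans_meas _ i k tT kB)
  | exact: (fun i k kB => @unbiased _ i k tT kB)
  | exact: (fun i k kB => @variance_le _ i k tT kB)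
  | exact: (indep tT) ].

Lemma madm_round t : (t <= T)%N -> madm P (F t) (Q t) -> madm P (F t.+1) (Gr t).
Proof.
move=> tT hQ; rewrite -batchE.
apply: (@madm_batch _ _ _ P d M B f_ L sigma (F t) (F t.+1) (Q t)); round_hyps tT.
Qed.

(** The range reaches T + 1 because the output is stored in the state after round T. *)
Lemma madm_state t : (t <= T.+1)%N ->
  [/\ madm P (F t) (X t), madm P (F t) (Z t), madm P (F t) (Q t) &
      madm P (F t) (fun w => dXg (st w t))].
Proof.
elim: t => [|t IH] tT; first by split; exact: hU.
have [hX hZ hQ hXg] := IH (ltnW tT).
have hG := madm_round tT hQ.
have FF := FS tT.
have mono A : madm P (F t) A -> madm P (F t.+1) A by exact: madm_mono.
have hXg' : madm P (F t.+1) (fun w => dXg (st w t.+1)).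
  have [h _] := @madm_gossip_iter (F t.+1) (alpha_g prm) (beta_g prm) (X t) B (sF t.+1) (mono _ _ _ hX).
  exact: h.
have hZ' : madm P (F t.+1) (Z t.+1).
  by apply: (madmB (sF t.+1) (mono _ _ _ hZ)); exact: madmZ.
split => //.
- by apply: (madmD (sF t.+1)); [apply: madmZ => //; exact: mono | exact: madmZ].
- apply: (madmD (sF t.+1)) => //; apply: (madmZ _ (sF t.+1)).
  by apply: madmB => //; exact: mono.
Qed.

Lemma madm_err_state t : (t <= T)%N ->
  madm P (F t.+1) (fun w => mean (Gr t w) - mean (grads f_ (Q t w))).
Proof.
move=> tT; have [_ _ hQ _] := madm_state (leqW tT).
apply: (@madm_err _ _ _ P d M B f_ L sigma (F t) (F t.+1) (Q t) (ans t)); round_hyps tT.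
Qed.

Lemma err_second_moment t : (t <= T)%N ->
  \int[P]_w (normsq (mean (Gr t w) - mean (grads f_ (Q t w)))) <= sigma ^+ 2 / (M%:R * B%:R).
Proof.
move=> tT; have [_ _ hQ _] := madm_state (leqW tT).
apply: (@noise_second_moment _ _ _ P d M B f_ L sigma (F t) (F t.+1) (Q t) (ans t)); round_hyps tT.
Qed.

Lemma err_orthogonal t : (t <= T)%N ->
  P.-integrable setT (EFin \o (fun w => dot (mean (Gr t w) - mean (grads f_ (Q t w))) (mean (Z t w) - xs))) /\
  \int[P]_w (dot (mean (Gr t w) - mean (grads f_ (Q t w))) (mean (Z t w) - xs)) = 0.
Proof.
move=> tT; have [_ hZ hQ _] := madm_state (leqW tT).
have hZ' : madm P (F t) (fun w => mean (Z t w) - xs).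
  by apply: madmB => //; [apply: madm_mulmx | apply: madm_cst].
apply: (@noise_mean0 _ _ _ P d M B f_ L sigma (F t) (F t.+1) (Q t) (ans t)); round_hyps tT.
Qed.

Lemma oracle_total t : (t <= T)%N ->
  \int[P]_w (normsq (Gr t w - grads f_ (Q t w))) <= M%:R * sigma ^+ 2.
Proof.
move=> tT; have [_ _ hQ _] := madm_state (leqW tT).
apply: (@noise_total _ _ _ P d M B f_ L sigma (F t) (F t.+1) (Q t) (ans t)); round_hyps tT.
Qed.

Lemma madm_grads_state t : (t <= T)%N -> madm P (F t) (fun w => grads f_ (Q t w)).
Proof.
move=> tT; have [_ _ hQ _] := madm_state (leqW tT).
apply: (@madm_grads _ _ _ P d M B f_ L (F t) (Q t) (ans t)); round_hyps tT.
Qed.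

Let madm_dis F' (A : Omega -> 'M[R]_(d, M)) : sigma_algebra setT F' ->
  madm P F' A -> madm P F' (fun w => dis (A w)).
Proof. by move=> sF' hA; exact: madm_mulmx. Qed.
Let madm_mean_sub F' (A : Omega -> 'M[R]_(d, M)) : sigma_algebra setT F' ->
  madm P F' A -> madm P F' (fun w => mean (A w) - xs).
Proof. by move=> sF' hA; apply: madmB => //; [apply: madm_mulmx | apply: madm_cst]. Qed.

Variable qb : R.
Hypothesis qb0 : 0 <= qb.
Hypothesis hx0 : \int[P]_w (normsq (mean (U w) - xs)) <= rad ^+ 2.
Hypothesis hd0 : \int[P]_w (normsq (dis (U w))) <= qb.
(** Bound on the expected dispersion of the stochastic gradients, from [normsq_dis_oracle]; 104 is
    26 times the bound 4 rad^2 on the distance of the averages. *)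
Let Hh : R := 2 * (M%:R * sigma ^+ 2) + 4 * L ^+ 2 * (qb + M%:R * (104 * rad ^+ 2))
  + 4 * (M%:R * zeta ^+ 2).
(* H1 makes the dispersion negligible in the potential of the averages; H2 says
   that gossip restores the bound qb on the dispersion in every round. *)
Hypothesis H1 : T%:R ^+ 3 * qb <= rad ^+ 2.
(** Bound on the dispersion of Z and X: at most T increments with step at most T / (128 L), and
    Cauchy-Schwarz contributes another factor T. *)
Let zb : R := 2 * qb + 2 * (T%:R ^+ 4 / (128 * L) ^+ 2 * Hh).
Hypothesis H2 : 26 * del * zb <= qb.

(** This is rad (beta - 1), see [beta_stoch_term]; with it the noise contributes V^2 / beta to the
    potential. *)
Definition stoch_term : R :=
  sigma / Num.sqrt (M%:R * B%:R) * Num.sqrt (\sum_(i < T) a i ^+ 2).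
Local Notation V := stoch_term.

Let Mr : (0 : R) < M%:R. Proof. by rewrite ltr0n. Qed.
Let Br : (0 : R) < B%:R. Proof. by rewrite ltr0n. Qed.
Let Tr : (1 : R) <= T%:R. Proof. by rewrite ler1n. Qed.
Let MBr : (0 : R) < M%:R * B%:R. Proof. exact: mulr_gt0. Qed.

Lemma stoch_term_ge0 : 0 <= V.
Proof.
apply: mulr_ge0; last exact: sqrtr_ge0.
by apply: divr_ge0 => //; exact: sqrtr_ge0.
Qed.

Lemma beta_stoch_term : b = 1 + V / rad.
Proof.
rewrite /beta_coef /stoch_term; congr (_ + _).
have s0 : Num.sqrt (M%:R * B%:R) != 0 :> R by rewrite gt_eqF // sqrtr_gt0.
by field; rewrite s0 gt_eqF.
Qed.

Lemma stoch_term_sq : V ^+ 2 = sigma ^+ 2 / (M%:R * B%:R) * \sum_(i < T) a i ^+ 2.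
Proof.
rewrite /stoch_term !exprMn exprVn (sqr_sqrtr (ltW MBr)) sqr_sqrtr //.
by apply: sumr_ge0 => i _; exact: sqr_ge0.
Qed.

Let b1 : 1 <= b.
Proof. by rewrite beta_stoch_term lerDl divr_ge0 ?stoch_term_ge0 // ltW. Qed.

Let b0 : 0 < b. Proof. exact: lt_le_trans b1. Qed.

Lemma asum_le t : (t < T)%N -> asum L t.+1 * (L / 2 * (qb / M%:R)) <= T%:R ^+ 2 * qb / 256.
Proof.
move=> tT; have tr : (t.+1%:R : R) <= T%:R by rewrite ler_nat.
have t0 : (0 : R) <= t.+1%:R by [].
have q1 : qb / M%:R <= qb by rewrite ler_piMr // invf_le1 // ler1n.
have q2 : 0 <= qb / M%:R by rewrite divr_ge0.
rewrite /asum -(natr1 t.+1).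
have -> : t.+1%:R * (t.+1%:R + 1) / (256 * L) * (L / 2 * (qb / M%:R)) =
   t.+1%:R * (t.+1%:R + 1) * (qb / M%:R) / 512.
  by field; rewrite !gt_eqF.
have h : t.+1%:R * (t.+1%:R + 1) <= T%:R ^+ 2 * 2 :> R.
  by move: tr Tr t0; move: (t.+1%:R : R) (T%:R : R) => u v; nra.
have h0 : (0 : R) <= t.+1%:R * (t.+1%:R + 1) by rewrite mulr_ge0 // addr_ge0.
have := ler_pM h0 q2 h q1; lra.
Qed.

(** The integrable Y stands for the left-hand side, which contains f along the run. In its bound the
    linear noise vanishes, the quadratic noise sums to V^2 / b, and [H1] turns T rounds of
    dispersion into rad^2 / 256. *)
Lemma potential_expectation t : (t <= T)%N ->
  (forall s, (s < t)%N -> \int[P]_w (normsq (dis (Q s w))) <= qb) ->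
  exists Y : Omega -> R, [/\ P.-integrable setT (EFin \o Y),
    forall w, asum L t * (f (mean (X t w)) - f xs) + b / 2 * normsq (mean (Z t w) - xs) <= Y w &
    \int[P]_w (Y w) <= b / 2 * rad ^+ 2 + V ^+ 2 / b + rad ^+ 2 / 256].
Proof.
move=> tT hq.
pose e s w := mean (Gr s w) - mean (grads f_ (Q s w)).
pose h s w := a s ^+ 2 * normsq (e s w) / b - a s * dot (e s w) (mean (Z s w) - xs)
  + asum L s.+1 * (L / 2 * (normsq (dis (Q s w)) / M%:R)).
exists (fun w => b / 2 * normsq (mean (U w) - xs) + \sum_(s < t) h s w).
have sT (s : 'I_t) : (s < T)%N by exact: leq_trans (ltn_ord s) tT.
have ie (s : 'I_t) : P.-integrable setT (EFin \o (fun w => normsq (e s w))).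
  exact: (normsq_integrable (madm_err_state (ltnW (sT s)))).
have iq (s : 'I_t) : P.-integrable setT (EFin \o (fun w => normsq (dis (Q s w)))).
  have [_ _ hQ _] := madm_state (leqW (ltnW (sT s))).
  exact: (normsq_integrable (madm_dis (sF s) hQ)).
have iu : P.-integrable setT (EFin \o (fun w => normsq (mean (U w) - xs))).
  exact: (normsq_integrable (madm_mean_sub (sF 0) hU)).
have ih (s : 'I_t) : P.-integrable setT (EFin \o h s) /\
   \int[P]_w (h s w) <= a s ^+ 2 * (sigma ^+ 2 / (M%:R * B%:R)) / b + T%:R ^+ 2 * qb / 256.
  have [io eo] := err_orthogonal (ltnW (sT s)).
  have he : h s = fun w => (a s ^+ 2 / b) * normsq (e s w) + (- a s) * dot (e s w) (mean (Z s w) - xs)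
     + (asum L s.+1 * (L / 2 / M%:R)) * normsq (dis (Q s w)).
    by apply/funext => w; rewrite /h; field; rewrite !gt_eqF.
  have j1 := integrableZlR (a s ^+ 2 / b) (ie s).
  have j2 := integrableZlR (- a s) io.
  have j3 := integrableZlR (asum L s.+1 * (L / 2 / M%:R)) (iq s).
  have j12 := integrableDR j1 j2.
  split; first by rewrite he; exact: (integrableDR j12 j3).
  rewrite he (RintegralD _ j12 j3) // (RintegralD _ j1 j2) // !RintegralZl //.
  rewrite eo mulr0 addr0; apply: lerD.
    have -> : a s ^+ 2 * (sigma ^+ 2 / (M%:R * B%:R)) / b = a s ^+ 2 / b * (sigma ^+ 2 / (M%:R * B%:R)).
      by field; rewrite !gt_eqF.
    apply: ler_wpM2l; first by rewrite divr_ge0 ?sqr_ge0 // ltW.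
    exact: (err_second_moment (ltnW (sT s))).
  apply: le_trans (asum_le (sT s)).
  have -> : asum L s.+1 * (L / 2 * (qb / M%:R)) = asum L s.+1 * (L / 2 / M%:R) * qb by ring.
  apply: ler_wpM2l; last exact: hq.
  by rewrite mulr_ge0 ?asum_ge0 // !divr_ge0 // ltW.
have hs := RintegralT_sum (P := P) (index_enum 'I_t) (Q := xpredT) (fun s _ => proj1 (ih s)).
have ju := integrableZlR (b / 2) iu.
split.
- exact: (integrableDR ju (proj1 hs)).
- move=> w; exact: (@run_pathwise R d M f_ L sigma rho rad T B W edge
    (fun r q => minibatch (@G) B (xi w r) q) (U w) M0 L0 cvx smooth gW b1 xs t tT).
rewrite (RintegralD _ ju (proj1 hs)) // RintegralZl // (proj2 hs) -addrA.
apply: lerD; first by apply: ler_wpM2l => //; rewrite divr_ge0 // ltW.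
apply: (@le_trans _ _ (\sum_(s < t) (a s ^+ 2 * (sigma ^+ 2 / (M%:R * B%:R)) / b + T%:R ^+ 2 * qb / 256))).
  by apply: ler_sum => s _; exact: (proj2 (ih s)).
rewrite big_split /=; apply: lerD.
  have sub : \sum_(s < t) a s ^+ 2 <= \sum_(s < T) a s ^+ 2.
    rewrite -(big_mkord xpredT (fun k => a k ^+ 2)) -(big_mkord xpredT (fun k => a k ^+ 2)).
    rewrite [leRHS](big_cat_nat (leq0n t) tT) /= lerDl; apply: sumr_ge0 => i _; exact: sqr_ge0.
  rewrite -!mulr_suml stoch_term_sq.
  apply: ler_wpM2r; first by rewrite invr_ge0 ltW.
  by rewrite mulrC; apply: ler_wpM2l => //; rewrite divr_ge0 ?sqr_ge0 // ltW.
rewrite sumr_const card_ord -[leLHS]mulr_natl.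
have tr : (t%:R : R) <= T%:R by rewrite ler_nat.
have q2 : 0 <= T%:R ^+ 2 * qb / 256.
  by apply: divr_ge0 => //; apply: mulr_ge0 => //; exact: sqr_ge0.
apply: (le_trans (ler_wpM2r q2 tr)).
rewrite (_ : T%:R * (T%:R ^+ 2 * qb / 256) = T%:R ^+ 3 * qb / 256); last by ring.
by apply: ler_wpM2r.
Qed.

Lemma oracle_bound t : (t <= T)%N -> \int[P]_w (normsq (dis (Q t w))) <= qb ->
  \int[P]_w (normsq (mean (Q t w) - xs)) <= 104 * rad ^+ 2 ->
  \int[P]_w (normsq (dis (Gr t w))) <= Hh.
Proof.
move=> tT h1 h2; have [_ _ hQ _] := madm_state (leqW tT).
have hG := madm_round tT hQ.
have hgr := madm_mono (FS tT) (madm_grads_state tT).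
have i0 := normsq_integrable (madm_dis (sF t.+1) hG).
have i1 := normsq_integrable (madmB (sF t.+1) hG hgr).
have i2 := normsq_integrable (madm_dis (sF t) hQ).
have i3 := normsq_integrable (madm_mean_sub (sF t) hQ).
have := expectation_lincomb (c0 := 4 * (M%:R * zeta ^+ 2)) (c1 := 2) (c2 := 4 * L ^+ 2)
  (c3 := 4 * L ^+ 2 * M%:R) i0 i1 i2 i3.
move=> /(_ _)/le_trans; apply.
  move=> w; apply: le_trans (normsq_dis_oracle M0 smooth (Gr t w) (Q t w) het) _; lra.
have h0 := oracle_total tT.
have L2 : 0 <= 4 * L ^+ 2 by rewrite mulr_ge0 // sqr_ge0.
have L2M : 0 <= 4 * L ^+ 2 * M%:R by rewrite mulr_ge0 // ltW.
have := ler_wpM2l L2 h1; have := ler_wpM2l L2M h2.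
rewrite /Hh; lra.
Qed.

Let zb_ge0 : 2 * qb <= zb.
Proof.
rewrite /zb lerDl mulr_ge0 // mulr_ge0 //; first by apply: divr_ge0; [exact: exprn_ge0 | exact: sqr_ge0].
have Mz : 0 <= M%:R * zeta ^+ 2 by rewrite mulr_ge0 ?sqr_ge0 // ltW.
have Ms : 0 <= M%:R * sigma ^+ 2 by rewrite mulr_ge0 ?sqr_ge0 // ltW.
have Mr2 : 0 <= M%:R * (104 * rad ^+ 2) by rewrite !mulr_ge0 ?sqr_ge0 // ltW.
have L2 : 0 <= 4 * L ^+ 2 by rewrite mulr_ge0 // sqr_ge0.
have := mulr_ge0 L2 (addr_ge0 qb0 Mr2); rewrite /Hh; lra.
Qed.

Let Vb : V ^+ 2 / b <= b * rad ^+ 2.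
Proof.
rewrite ler_pdivrMr //.
have e : b * rad = rad + V by rewrite beta_stoch_term; field; rewrite gt_eqF.
have -> : b * rad ^+ 2 * b = (b * rad) ^+ 2 by ring.
rewrite e; have := stoch_term_ge0; move: rad0; nra.
Qed.

Let z_from_potential t : (t <= T)%N ->
  (forall s, (s < t)%N -> \int[P]_w (normsq (dis (Q s w))) <= qb) ->
  \int[P]_w (normsq (mean (Z t w) - xs)) <= 4 * rad ^+ 2.
Proof.
move=> tT hq; have [Y [iY hY eY]] := potential_expectation tT hq.
have [_ hZ _ _] := madm_state (leqW tT).
have iz := normsq_integrable (madm_mean_sub (sF t) hZ).
have le w : b / 2 * normsq (mean (Z t w) - xs) <= Y w.
  apply: le_trans (hY w); rewrite lerDr mulr_ge0 ?asum_ge0 // subr_ge0; exact: xs_min.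
have := le_RintegralT (integrableZlR (b / 2) iz) iY le.
rewrite RintegralZl // => h.
have b20 : 0 < b / 2 by rewrite divr_gt0.
rewrite -(ler_pM2l b20); apply: le_trans h _; apply: le_trans eY _.
have r2 : 0 <= rad ^+ 2 by exact: sqr_ge0.
have := ler_wpM2r r2 b1; move: Vb; lra.
Qed.

(** Strong induction, since Z accumulates all earlier gradients. Small dispersion in the past bounds
    Z, hence X, through the potential; bounded queries limit the gradient dispersion, hence that of
    Z and X; gossip and [H2] restore [qb] for the next query. *)
Lemma state_bounds t : (t <= T)%N ->
  [/\ \int[P]_w (normsq (mean (X t w) - xs)) <= 4 * rad ^+ 2,
      \int[P]_w (normsq (dis (Q t w))) <= qb,
      \int[P]_w (normsq (mean (Q t w) - xs)) <= 104 * rad ^+ 2 &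
      \int[P]_w (normsq (dis (X t w))) <= zb].
Proof.
elim/ltn_ind: t => t IH tT.
have r2 : 0 <= rad ^+ 2 by exact: sqr_ge0.
case: t IH tT => [|t] IH tT.
  have zb2 := zb_ge0; split.
  - by apply: (le_trans hx0); lra.
  - exact: hd0.
  - by apply: (le_trans hx0); lra.
  - by apply: (le_trans hd0); move: qb0; lra.
have tT' : (t <= T)%N by exact: ltnW.
have hq s : (s < t.+1)%N -> \int[P]_w (normsq (dis (Q s w))) <= qb.
  by move=> lts; case: (IH s lts (leq_trans (ltnW lts) tT)).
have hz := z_from_potential tT hq.
have [hX hZ hQ hXg] := madm_state (leqW tT).
have [hX1 hZ1 hQ1 hXg1] := madm_state (leqW tT').
have tpT : (t.-1 <= T)%N by exact: leq_trans (leq_pred t) tT'.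
have [hX2 hZ2 hQ2 hXg2] := madm_state (leqW tpT).
have [x1 q1 m1 d1] := IH t (leqnn _) tT'.
have tp : (t.-1 < t.+1)%N by rewrite ltnS leq_pred.
have [x2 q2 m2 d2] := IH t.-1 tp tpT.
have t0 : (0 : R) <= t%:R by [].
have th0 : 0 <= 2 / (t%:R + 2) :> R by rewrite divr_ge0 // addr_ge0.
have th1 : 0 <= 1 - 2 / (t%:R + 2) :> R.
  by rewrite subr_ge0 ler_pdivrMr ?mul1r ?lerDr // ltr_wpDl.
pose orcw w r q := minibatch (@G) B (xi w r) q.
have dz : \int[P]_w (normsq (dis (Z t.+1 w))) <= zb.
  have hG (s : 'I_t.+1) : madm P (F s.+1) (Gr s).
    have sT : (s <= T)%N by exact: leq_trans (ltnW (ltn_ord s)) tT.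
    by apply: madm_round => //; case: (madm_state (leqW sT)).
  have ig (s : 'I_t.+1) := normsq_integrable (madm_dis (sF s.+1) (hG s)).
  have ig' (s : 'I_t.+1) := integrableZlR ((a s / b) ^+ 2) (ig s).
  have hs := RintegralT_sum (index_enum 'I_t.+1) (Q := xpredT) (fun s _ => ig' s).
  have iu := normsq_integrable (madm_dis (sF 0) hU).
  have iz := normsq_integrable (madm_dis (sF t.+1) hZ).
  have := expectation_lincomb2 (c1 := 2) (c2 := 2 * t.+1%:R) iz iu (proj1 hs).
  move=> /(_ _)/le_trans; apply.
    move=> w; rewrite -mulrA; exact: (@normsq_dis_dZ R d M L sigma rho rad T B W (orcw w) (U w) t.+1 tT).
  rewrite (proj2 hs) /zb; apply: lerD; first by apply: ler_wpM2l.
  rewrite -mulrA; apply: ler_wpM2l => //.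
  apply: (@le_trans _ _ (T%:R * \sum_(s < t.+1) (T%:R ^+ 2 / (128 * L) ^+ 2 * Hh))).
    apply: ler_pM => //.
    - by apply: sumr_ge0 => s _; apply: Rintegral_ge0 => w _; rewrite mulr_ge0 ?sqr_ge0 ?normsq_ge0.
    - by rewrite ler_nat.
    apply: ler_sum => s _; rewrite RintegralZl //.
    have sT : (s <= T)%N by exact: leq_trans (ltnW (ltn_ord s)) tT.
    have [xs' qs ms ds] := IH s (ltn_ord s) sT.
    apply: ler_pM; first exact: sqr_ge0.
    - by apply: Rintegral_ge0 => w _; exact: normsq_ge0.
    - have sT' : (s.+1%:R : R) <= T%:R by rewrite ler_nat; exact: leq_trans (ltn_ord s) tT.
      have ab : a s / b <= T%:R / (128 * L).
        rewrite ler_pdivrMr //; apply: (@le_trans _ _ (T%:R / (128 * L))).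
          by rewrite /a_coef ler_pM2r // invr_gt0 mulr_gt0.
        by rewrite ler_peMr // divr_ge0 // mulr_ge0 // ltW.
      have a0 : 0 <= a s / b by rewrite divr_ge0 // ltW // a_gt0.
      by rewrite -expr_div_n; exact: sqr_le.
    - exact: oracle_bound sT qs ms.
  rewrite sumr_const card_ord -[X in _ * X]mulr_natl.
  have Hh0 : 0 <= T%:R ^+ 2 / (128 * L) ^+ 2 * Hh.
    have [xs' qs ms ds] := IH t (leqnn _) tT'.
    apply: mulr_ge0; first by rewrite divr_ge0 ?sqr_ge0.
    by apply: le_trans (oracle_bound tT' qs ms); apply: Rintegral_ge0 => w _; exact: normsq_ge0.
  apply: (@le_trans _ _ (T%:R * (T%:R * (T%:R ^+ 2 / (128 * L) ^+ 2 * Hh)))).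
    by apply: ler_wpM2l => //; apply: ler_wpM2r => //; rewrite ler_nat.
  by rewrite le_eqVlt; apply/orP; left; apply/eqP; ring.
have ix := normsq_integrable (madm_mean_sub (sF t.+1) hX).
have ix1 := normsq_integrable (madm_mean_sub (sF t) hX1).
have ix2 := normsq_integrable (madm_mean_sub (sF t.-1) hX2).
have izm := normsq_integrable (madm_mean_sub (sF t.+1) hZ).
have idx := normsq_integrable (madm_dis (sF t.+1) hX).
have idx1 := normsq_integrable (madm_dis (sF t) hX1).
have idx2 := normsq_integrable (madm_dis (sF t.-1) hX2).
have idz := normsq_integrable (madm_dis (sF t.+1) hZ).
have idq := normsq_integrable (madm_dis (sF t.+1) hQ).
have imq := normsq_integrable (madm_mean_sub (sF t.+1) hQ).
split.
- have := expectation_lincomb2 (c1 := 1 - 2 / (t%:R + 2)) (c2 := 2 / (t%:R + 2)) ix ix1 izm.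
  move=> /(_ _)/le_trans; apply.
    move=> w; exact: (@normsq_x_err R d M L sigma rho rad T B W (orcw w) (U w) xs t tT).
  by apply: (le_trans (lincomb_le th1 th0 x1 hz)); rewrite subrK mul1r.
- have := expectation_lincomb2 (c1 := del * 18) (c2 := del * 8) idq idx1 idx2.
  move=> /(_ _)/le_trans; apply.
    move=> w; rewrite -!mulrA -mulrDr.
    exact: (@normsq_dis_dQS R d M L sigma rho rad T B W (orcw w) (U w) del del0 contract t tT).
  have d18 : 0 <= del * 18 by rewrite mulr_ge0.
  have d8 : 0 <= del * 8 by rewrite mulr_ge0.
  apply: (le_trans (lincomb_le d18 d8 d1 d2)); apply: le_trans H2.
  by rewrite le_eqVlt; apply/orP; left; apply/eqP; ring.
- have := expectation_lincomb2 (c1 := 18) (c2 := 8) imq ix1 ix2.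
  move=> /(_ _)/le_trans; apply.
    move=> w; exact: (@normsq_mean_dQS R d M L sigma rho rad T B W edge (orcw w) (U w) gW xs t tT).
  have c18 : 0 <= 18 :> R by [].
  have c8 : 0 <= 8 :> R by [].
  apply: (le_trans (lincomb_le c18 c8 x1 x2)).
  by rewrite le_eqVlt; apply/orP; left; apply/eqP; ring.
- have := expectation_lincomb2 (c1 := 1 - 2 / (t%:R + 2)) (c2 := 2 / (t%:R + 2)) idx idx1 idz.
  move=> /(_ _)/le_trans; apply.
    move=> w; exact: (@normsq_dis_dXS R d M L sigma rho rad T B W (orcw w) (U w) t tT).
  by apply: (le_trans (lincomb_le th1 th0 d1 dz)); rewrite subrK mul1r.
Qed.

Let out w := dda_sgd prm W (@G) (xi w) (U w).

(** The output is the gossip of X_T without extrapolation, hence the gain 26 in dispersion. In the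
    gap, b rad = rad + V gives b/2 rad^2 = rad^2/2 + V rad/2, and V^2 / b <= V rad. *)
Theorem epoch_bound :
  [/\ madm P (F T.+1) out,
      \int[P]_w (normsq (dis (out w))) <= qb / 26 &
      exists Y : Omega -> R, [/\ P.-integrable setT (EFin \o Y),
        forall w, f (mean (out w)) - f xs <= Y w &
        \int[P]_w (Y w) <= (rad ^+ 2 + 3 / 2 * (V * rad)) / asum L T]].
Proof.
have [_ _ _ hO] := madm_state (leqnn T.+1).
have [hX hZ hQ hXg] := madm_state (leqW (leqnn T)).
have [x1 q1 m1 d1] := state_bounds (leqnn T).
have A0 : 0 < asum L T by rewrite /asum !divr_gt0 ?mulr_gt0 ?ltr0n.
split => //.
  have io := normsq_integrable (madm_dis (sF T.+1) hO).
  have ix := normsq_integrable (madm_dis (sF T) hX).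
  have := le_RintegralT io (integrableZlR del ix).
  move=> /(_ _)/le_trans; apply; first by move=> w; exact: contract.
  rewrite RintegralZl // ler_pdivlMr //.
  have := ler_wpM2l del0 d1; move: H2; lra.
have hq s : (s < T)%N -> \int[P]_w (normsq (dis (Q s w))) <= qb.
  by move=> sT; case: (state_bounds (ltnW sT)).
have [Y [iY hY eY]] := potential_expectation (leqnn T) hq.
exists (fun w => (asum L T)^-1 * Y w); split.
- exact: integrableZlR.
- move=> w; rewrite /out /dda_sgd.
  rewrite (@mean_dXgS R d M L sigma rho rad T B W edge (fun r q => minibatch (@G) B (xi w r) q) (U w) gW T).
  rewrite ler_pdivlMl //; apply: le_trans (hY w).
  by rewrite lerDl mulr_ge0 ?normsq_ge0 // divr_ge0 // ltW.
rewrite RintegralZl // mulrC; apply: ler_wpM2r; first by rewrite invr_ge0 ltW.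
apply: le_trans eY _.
have e : b * rad = rad + V by rewrite beta_stoch_term; field; rewrite gt_eqF.
have e2 : b / 2 * rad ^+ 2 = rad ^+ 2 / 2 + V * rad / 2.
  have -> : b / 2 * rad ^+ 2 = b * rad * rad / 2 by ring.
  by rewrite e; ring.
have v2 : V ^+ 2 / b <= V * rad.
  rewrite ler_pdivrMr // -mulrA (mulrC rad) e expr2.
  by apply: ler_wpM2l; [exact: stoch_term_ge0 | rewrite lerDr ltW].
rewrite e2; have := sqr_ge0 rad; lra.
Qed.

End epoch.

(** * Parameter rules *)

Section ceilings.
Context {R : realType}.

Lemma nat_ceilE (x : R) : 0 <= x -> (nat_ceil x)%:R = (Num.ceil x)%:~R :> R.
Proof.
move=> x0; rewrite /nat_ceil natr_absz ger0_norm // ceil_ge0.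
by apply: lt_le_trans x0; rewrite ltrN10.
Qed.

Lemma nat_ceil_ge (x : R) : 0 <= x -> x <= (nat_ceil x)%:R.
Proof. by move=> x0; rewrite nat_ceilE // ceil_ge. Qed.

Lemma nat_ceil_lt (x : R) : 0 <= x -> (nat_ceil x)%:R < x + 1.
Proof.
move=> x0; rewrite nat_ceilE //; have /andP[h _] := ceil_itv x.
by move: h; rewrite intrB ltrBlDr.
Qed.

Lemma nat_ceil_le (x : R) n : 0 <= x -> (nat_ceil x <= n)%N = (x <= n%:R).
Proof.
move=> x0; rewrite -(ler_nat R) nat_ceilE // -[n%:R]/((Posz n)%:~R : R) ler_int.
exact: ceil_le_int.
Qed.
End ceilings.

Section epochs.
Context {R : realType}.
Variables (Delta0 eps : R).
Hypothesis eps0 : 0 < eps <= Delta0.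

Let e0 : 0 < eps. Proof. by case/andP: eps0. Qed.
Let D0 : 0 < Delta0. Proof. by case/andP: eps0 => h; exact: (lt_le_trans h). Qed.
Let q1 : 1 <= Delta0 / eps.
Proof. by rewrite ler_pdivlMr // mul1r; case/andP: eps0. Qed.
Let ln2 : 0 < ln (2 : R). Proof. by apply: ln_gt0; rewrite ltr1n. Qed.
Let x0 : 0 <= ln (Delta0 / eps) / ln 2.
Proof. by apply: divr_ge0; [exact: ln_ge0 | exact: ltW]. Qed.

(** K is the least n with Delta0 / 2^n <= eps; the next two lemmas are the two sides of this. *)
Let num_epochs_le n : (num_epochs Delta0 eps <= n)%N = (Delta0 / 2 ^+ n <= eps).
Proof.
rewrite /num_epochs nat_ceil_le // ler_pdivrMr // -[n%:R * _]mulrC mulr_natr -lnXn //.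
rewrite ler_ln ?posrE ?divr_gt0 ?exprn_gt0 //.
by rewrite !ler_pdivrMr ?exprn_gt0 // mulrC.
Qed.

Lemma epoch_gap_gt s : (s < num_epochs Delta0 eps)%N -> eps < Delta0 / 2 ^+ s.
Proof. by rewrite ltnNge num_epochs_le -ltNge. Qed.

Lemma last_epoch_gap : Delta0 / 2 ^+ (num_epochs Delta0 eps) <= eps.
Proof. by rewrite -num_epochs_le. Qed.

(** The logarithm in base 2 is then at least 1, so that rounding up costs at most a factor 2. *)
Lemma num_epochs_log : 2 * eps <= Delta0 ->
  (num_epochs Delta0 eps)%:R <= 2 / ln 2 * ln (Delta0 / eps).
Proof.
move=> h; apply: le_trans (ltW (nat_ceil_lt x0)) _.
have : 1 <= ln (Delta0 / eps) / ln 2.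
  rewrite ler_pdivlMr // mul1r ler_ln ?posrE ?divr_gt0 // ler_pdivlMr //.
have -> : 2 / ln 2 * ln (Delta0 / eps) = 2 * (ln (Delta0 / eps) / ln 2) by ring.
lra.
Qed.
End epochs.

(** Final arithmetic of [dispersion_contract], with powers replaced by variables; it rests on 2 + 2
    * 420 / 16384 <= 3. *)
Lemma dispersion_arith {R : realFieldType} (w x q7 s r n4 t4 m : R) : 0 < r ->
  w * n4 <= 420 / 16384 * (t4 * m * s * r) * n4 ->
  t4 * n4 * m * (s * r) <= q7 * (s * r) -> 1 * r <= q7 * s * r -> x * n4 = r ->
  (2 * x + 2 * w) * n4 <= 3 * (q7 * s) * r.
Proof. by move=> *; lra. Qed.

(** * Budget, block length and horizon of one epoch *)

Section parameters.
Context {R : realType}.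
Variables (M : nat) (L mu sigma zeta rho eps Delta : R).
Hypotheses (M0 : (0 < M)%N) (L0 : 0 < L) (mu0 : 0 < mu) (sigma0 : 0 <= sigma).
Hypotheses (zeta0 : 0 <= zeta) (rho01 : 0 < rho <= 1) (eps0 : 0 < eps).
Hypothesis epsD : eps <= Delta.
Local Notation bud := (budget_real M L mu sigma zeta rho eps).
Local Notation N := (nat_ceil bud).
Local Notation rad := (Num.sqrt (2 * Delta / mu)).
Local Notation Lam := (Lambda M L sigma zeta rad N).
Local Notation B := (block_length M L sigma zeta rho rad N).
Local Notation T := (N %/ (M * B))%N.
Local Notation l := (ell M L mu sigma zeta rho eps).
Hypotheses (dvdN : (M * B %| N)%N) (T0 : (0 < T)%N).

Let rho0 : 0 < rho. Proof. by case/andP: rho01. Qed.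
Let rho1 : rho <= 1. Proof. by case/andP: rho01. Qed.
Let D0 : 0 < Delta. Proof. exact: lt_le_trans epsD. Qed.
Let Mr : (1 : R) <= M%:R. Proof. by rewrite ler1n. Qed.
Let Mr0 : (0 : R) < M%:R. Proof. by rewrite ltr0n. Qed.
Let u : R := sigma ^+ 2 / (mu * eps).
Let r : R := Num.sqrt (L / (mu * rho)).
Let u0 : 0 <= u. Proof. by rewrite divr_ge0 ?sqr_ge0 // mulr_ge0 // ltW. Qed.
Let r0 : 0 < r. Proof. by rewrite sqrtr_gt0 divr_gt0 // mulr_gt0. Qed.
Let l60 : 60 <= l. Proof. by rewrite /ell le_max lexx. Qed.
Let budE : bud = 2 ^+ 16 * u + 2 ^+ 18 * M%:R * r * l ^+ 2. Proof. by []. Qed.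
Let bud0 : 0 <= bud.
Proof.
rewrite budE; apply: addr_ge0; first exact: mulr_ge0.
by apply: mulr_ge0; [apply: mulr_ge0; [exact: mulr_ge0 | exact: ltW] | exact: sqr_ge0].
Qed.

Lemma epoch_rad_gt0 : 0 < rad. Proof. by rewrite sqrtr_gt0 divr_gt0 // mulr_gt0. Qed.
Lemma epoch_rad_sq : rad ^+ 2 = 2 * Delta / mu.
Proof. by rewrite sqr_sqrtr // divr_ge0 ?mulr_ge0 // ltW. Qed.

Let S : R := 1 + (zeta + sigma) / (L * rad).
Let zs0 : 0 <= zeta + sigma. Proof. exact: addr_ge0. Qed.
Let S1 : 1 <= S.
Proof. by rewrite /S lerDl divr_ge0 // mulr_ge0 ?(ltW epoch_rad_gt0) // ltW. Qed.

Lemma block_gt0 : (0 < B)%N.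
Proof.
rewrite -(ltr0n R); apply: lt_le_trans (nat_ceil_ge _); first by rewrite lt_max ltr01.
by rewrite le_max ler01.
Qed.
Let B1 : (1 : R) <= B%:R. Proof. by rewrite ler1n block_gt0. Qed.

Lemma budget_split : N%:R = T%:R * (M%:R * B%:R) :> R.
Proof. by rewrite -!natrM divnK. Qed.

Let T1 : (1 : R) <= T%:R. Proof. by rewrite ler1n. Qed.
Let MB1 : 1 <= M%:R * B%:R :> R. Proof. by rewrite -natrM ler1n muln_gt0 M0 block_gt0. Qed.
Lemma horizon_le_budget : T%:R <= N%:R :> R.
Proof. by rewrite budget_split ler_peMr. Qed.
Let N1 : (1 : R) <= N%:R. Proof. exact: le_trans T1 horizon_le_budget. Qed.

Let lE : ln (2 ^+ 100 / (rho * Num.sqrt M%:R)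
         * (1 + (zeta + sigma) / (L * Num.sqrt (eps / mu)))
         * (1 + u + M%:R * r)) <= l.
Proof. by rewrite /ell le_max lexx orbT. Qed.

(** Lambda contains N, which contains [ell] squared. The argument E0 of the logarithm in [ell] is at
    most exp l and dominates the rest; l^2 <= 4 exp l costs the second exp l. *)
Lemma log_Lambda_le : ln (Lam / rho) <= 2 * l.
Proof.
have sM : 0 < Num.sqrt (M%:R : R) by rewrite sqrtr_gt0.
have se : 0 < Num.sqrt (eps / mu) by rewrite sqrtr_gt0 divr_gt0.
pose S0 : R := 1 + (zeta + sigma) / (L * Num.sqrt (eps / mu)).
have SS0 : S <= S0.
  rewrite /S /S0 lerD2l ler_wpM2l // lef_pV2 ?posrE ?mulr_gt0 ?epoch_rad_gt0 //.
  rewrite ler_pM2l // ler_wsqrtr // ler_pM2r ?invr_gt0 //.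
  by move: epsD eps0; lra.
have S00 : 0 < S0 by apply: lt_le_trans SS0; apply: lt_le_trans S1.
pose w : R := 1 + u + M%:R * r.
have w0 : 0 < w by rewrite /w !ltr_wpDr ?ltr01 // ?mulr_ge0 ?(ltW Mr0) ?(ltW r0).
pose E0 : R := 2 ^+ 100 / (rho * Num.sqrt M%:R) * S0 * w.
have E00 : 0 < E0.
  by rewrite /E0 !mulr_gt0 ?invr_gt0 ?exprn_gt0 ?mulr_gt0.
have E0l : E0 <= expR l by rewrite -[E0]lnK ?posrE // ler_expR.
have Nle : N%:R <= 2 ^+ 18 * l ^+ 2 * w.
  apply: le_trans (ltW (nat_ceil_lt bud0)) _; rewrite budE /w.
  have l2 : 1 <= l ^+ 2 by move: l60; nra.
  have h1 : u * 1 <= u * l ^+ 2 by rewrite ler_wpM2l.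
  have h2 : 2 ^+ 16 <= 2 ^+ 18 :> R by rewrite ler_eXn2l // ltr1n.
  have h3 : 1 <= 2 ^+ 18 :> R by rewrite expr_ge1 // ler1n.
  have h4 : u <= u * l ^+ 2 by rewrite ler_peMr.
  have h5 := ler_pM (exprn_ge0 16 (ler0n R 2)) u0 h2 h4.
  have h6 : 1 <= 2 ^+ 18 * l ^+ 2 by have := ler_pM ler01 ler01 h3 l2; rewrite mulr1.
  lra.
have Lle : Lam / rho <= 100 * 2 ^+ 18 / 2 ^+ 100 * l ^+ 2 * E0.
  have -> : Lam / rho = (100 / (Num.sqrt M%:R * rho)) * (N%:R * S).
    by rewrite /Lambda -/S; field; rewrite !gt_eqF.
  have -> : 100 * 2 ^+ 18 / 2 ^+ 100 * l ^+ 2 * E0 =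
     (100 / (Num.sqrt M%:R * rho)) * (2 ^+ 18 * l ^+ 2 * w * S0).
    rewrite /E0; move: (exprn_gt0 100 (ltr0n R 2)); move: (2 ^+ 100 : R) => c c0.
    by field; rewrite !gt_eqF.
  apply: ler_wpM2l; first by rewrite divr_ge0 // mulr_ge0 // ltW.
  by apply: ler_pM => //; apply: le_trans S1.
have l4 : l ^+ 2 <= 4 * expR l.
  have l20 : 0 <= l / 2 by move: l60; lra.
  have := expR_ge1Dx (l / 2) => h.
  have -> : expR l = expR (l / 2) ^+ 2 by rewrite -expRM_natl; congr expR; field.
  by move: h l20; move: (expR _) => x h l20; nra.
(* The factor 2^100 in [ell] is there to absorb the numerical constants. *)
have c1 : 100 * 2 ^+ 18 / 2 ^+ 100 * 4 <= 1 :> R.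
  rewrite -mulrA (mulrC _ 4) mulrA ler_pdivrMr ?exprn_gt0 // mul1r.
  apply: (@le_trans _ _ (2 ^+ 7 * 2 ^+ 18 * 2 ^+ 2)).
    have p18 : 0 < 2 ^+ 18 :> R by rewrite exprn_gt0.
    rewrite ler_pM ?mulr_ge0 ?(ltW p18) //; last by rewrite -natrX ler_nat.
    by rewrite ler_pM2r // -natrX ler_nat.
  by rewrite -!exprD ler_eXn2l // ltr1n.
have fin : Lam / rho <= expR (2 * l).
  apply: le_trans Lle _.
  have -> : expR (2 * l) = expR l * expR l by rewrite -expRD; congr expR; ring.
  have el : 0 <= expR l by exact: expR_ge0.
  have c0 : 0 <= 100 * 2 ^+ 18 / 2 ^+ 100 :> R by rewrite divr_ge0 ?mulr_ge0 ?exprn_ge0.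
  have h1 := ler_wpM2l c0 l4.
  have h2 : 100 * 2 ^+ 18 / 2 ^+ 100 * l ^+ 2 <= expR l.
    by apply: le_trans h1 _; rewrite mulrA -[leRHS]mul1r ler_wpM2r.
  apply: ler_pM => //; last exact: ltW.
  by rewrite mulr_ge0 ?sqr_ge0.
have Lp : 0 < Lam / rho.
  rewrite divr_gt0 // /Lambda -/S !mulr_gt0 ?invr_gt0 //; last exact: lt_le_trans S1.
  exact: lt_le_trans N1.
by rewrite -(expRK (2 * l)) ler_ln ?posrE ?expR_gt0.
Qed.

Let sr0 : 0 < Num.sqrt rho. Proof. by rewrite sqrtr_gt0. Qed.
Let sr1 : Num.sqrt rho <= 1.
Proof. by rewrite -[leRHS](sqrtr1 R) ler_wsqrtr. Qed.

(** 20 * 2 l comes from [log_Lambda_le]; the ceiling and the maximum with 1 cost at most 2, well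
    below 2 l. *)
Lemma block_le : B%:R * Num.sqrt rho <= 42 * l.
Proof.
set y := 20 / Num.sqrt rho * ln (Lam / rho).
have m0 : 0 <= Num.max 1 y by rewrite le_max ler01.
have h : B%:R <= Num.max 1 y + 1 by exact: ltW (nat_ceil_lt m0).
have hy : y * Num.sqrt rho <= 40 * l.
  have -> : y * Num.sqrt rho = 20 * ln (Lam / rho) by rewrite /y; field; rewrite gt_eqF.
  by have := log_Lambda_le; lra.
apply: (@le_trans _ _ ((Num.max 1 y + 1) * Num.sqrt rho)).
  by rewrite ler_pM2r.
have l1 := l60; have s1 := sr1.
by case: (leP 1 y) => _; rewrite mulrDl mul1r; lra.
Qed.

(** Of the two factors l in the budget one pays for the block length; the other covers 42, because l
    >= 60. *)
Lemma horizon_ge : 2 ^+ 18 * Num.sqrt (L / mu) <= T%:R.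
Proof.
have e : r * Num.sqrt rho = Num.sqrt (L / mu).
  rewrite /r -sqrtrM; last by rewrite divr_ge0 ?mulr_ge0 // ltW.
  by congr Num.sqrt; field; rewrite !gt_eqF.
have h1 : 2 ^+ 18 * M%:R * r * l ^+ 2 <= T%:R * (M%:R * B%:R).
  rewrite -budget_split; apply: le_trans (nat_ceil_ge bud0); rewrite budE lerDr.
  by rewrite mulr_ge0 // exprn_ge0.
have h2 : 2 ^+ 18 * r * l ^+ 2 <= T%:R * B%:R.
  by rewrite -(ler_pM2l Mr0); move: h1; rewrite -subr_ge0 => h1; rewrite -subr_ge0; lra.
have h3 : 2 ^+ 18 * Num.sqrt (L / mu) * l ^+ 2 <= T%:R * (42 * l).
  apply: (@le_trans _ _ (T%:R * (B%:R * Num.sqrt rho))).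
    have := ler_wpM2r (ltW sr0) h2; rewrite -e; lra.
  by apply: ler_wpM2l; [exact: le_trans T1 | exact: block_le].
have l0 : 0 < l by apply: lt_le_trans l60.
have h4 : 2 ^+ 18 * Num.sqrt (L / mu) * l <= T%:R * 42.
  by rewrite -(ler_pM2r l0); move: h3; rewrite expr2 !mulrA.
have p : 0 <= 2 ^+ 18 * Num.sqrt (L / mu) by rewrite mulr_ge0 ?exprn_ge0 // sqrtr_ge0.
rewrite -(@ler_pM2r _ 42) //; apply: le_trans h4; apply: ler_wpM2l => //.
by have := l60; lra.
Qed.

Lemma horizon_sq_ge : 2 ^+ 36 * L <= T%:R ^+ 2 * mu.
Proof.
have p : 0 <= 2 ^+ 18 * Num.sqrt (L / mu) by rewrite mulr_ge0 ?exprn_ge0 // sqrtr_ge0.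
have := sqr_le p horizon_ge; rewrite exprMn sqr_sqrtr; last by rewrite divr_ge0 // ltW.
by rewrite -exprM -[(18 * 2)%N]/36%N mulrA ler_pdivrMr.
Qed.

Lemma budget_noise : 2 ^+ 16 * sigma ^+ 2 <= N%:R * (mu * eps).
Proof.
have h : 2 ^+ 16 * u <= N%:R.
  apply: le_trans (nat_ceil_ge bud0); rewrite budE lerDl.
  by apply: mulr_ge0; [apply: mulr_ge0; [exact: mulr_ge0 | exact: ltW] | exact: sqr_ge0].
by move: h; rewrite /u mulrA ler_pdivrMr // mulr_gt0.
Qed.

(** Replacing one factor N by T M B cancels the division by M. *)
Lemma Lambda_sq : Lam ^+ 2 = 10 ^+ 4 * (T%:R * B%:R * N%:R) * S ^+ 2.
Proof.
have s2 : Num.sqrt (M%:R : R) ^+ 2 = M%:R by rewrite sqr_sqrtr // ltW.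
have -> : Lam = 100 * N%:R * S / Num.sqrt M%:R by rewrite /Lambda -/S; ring.
rewrite expr_div_n s2 !exprMn.
have -> : N%:R ^+ 2 = T%:R * (M%:R * B%:R) * N%:R :> R by rewrite -budget_split expr2.
by field; rewrite gt_eqF.
Qed.

Let Lam1 : 1 <= Lam.
Proof.
have Lge0 : 0 <= Lam.
  rewrite /Lambda -/S; apply: mulr_ge0; last exact: le_trans S1.
  by rewrite divr_ge0 ?sqrtr_ge0 // mulr_ge0.
have h : 1 <= Lam ^+ 2.
  rewrite Lambda_sq; have S21 : 1 <= S ^+ 2 by rewrite expr_ge1 // (le_trans _ S1).
  have TBN : 1 <= T%:R * B%:R * N%:R :> R by rewrite -!natrM ler1n !muln_gt0 T0 block_gt0 -(ltr0n R) (lt_le_trans ltr01 N1).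
  have p : 1 <= 10 ^+ 4 :> R by rewrite -natrX ler1n.
  have := ler_pM ler01 ler01 p TBN; rewrite mulr1 => h1.
  by have := ler_pM ler01 ler01 h1 S21; rewrite mulr1.
by rewrite leNgt; apply/negP => lt; move: h; rewrite leNgt exprn_ilt1.
Qed.

Let kap : R := Num.sqrt (rho / 2).

(** (1 - kap)^B <= exp (- kap B), and kap >= 0.7 sqrt rho turns the 20 of the block rule into the
    exponent 14. One of the 14 factors rho cancels the 1 / rho in front. *)
Lemma contraction_le : 4 / rho * (1 - kap) ^+ B <= 4 / Lam ^+ 14.
Proof.
have k0 : 0 <= kap by exact: sqrtr_ge0.
have k2 : kap ^+ 2 = rho / 2 by rewrite sqr_sqrtr // divr_ge0 // ltW.
have k1 : kap <= 1.
  by rewrite -[leRHS](sqrtr1 R) ler_wsqrtr //; move: rho1 rho0; lra.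
have sr2 : Num.sqrt rho ^+ 2 = rho by rewrite sqr_sqrtr // ltW.
have kr : 7 * Num.sqrt rho <= 10 * kap.
  have h : (7 * Num.sqrt rho) ^+ 2 <= (10 * kap) ^+ 2.
    by rewrite !exprMn sr2 k2; move: rho0; lra.
  by move: h; rewrite ler_pXn2r ?nnegrE ?mulr_ge0 // ltW.
have Lr1 : 1 <= Lam / rho by rewrite ler_pdivlMr // mul1r; exact: le_trans Lam1.
have lg0 : 0 <= ln (Lam / rho) by exact: ln_ge0.
have Bge : 20 / Num.sqrt rho * ln (Lam / rho) <= B%:R.
  apply: le_trans (nat_ceil_ge _); first by rewrite le_max lexx orbT.
  by rewrite le_max ler01.
have h14 : 14 * ln (Lam / rho) <= kap * B%:R.
  apply: le_trans (ler_wpM2l k0 Bge).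
  have -> : kap * (20 / Num.sqrt rho * ln (Lam / rho)) = (20 * kap / Num.sqrt rho) * ln (Lam / rho) by ring.
  by apply: ler_wpM2r => //; rewrite ler_pdivlMr //; lra.
have e1 : (1 - kap) ^+ B <= (rho / Lam) ^+ 14.
  apply: (@le_trans _ _ (expR (- (kap * B%:R)))).
    rewrite -mulNr expRM_natr lerXn2r ?nnegrE ?expR_ge0 ?subr_ge0 //.
    exact: expR_ge1Dx.
  have -> : (rho / Lam) ^+ 14 = expR (- (14 * ln (Lam / rho))).
    rewrite -mulrN expRM_natl expRN lnK ?posrE ?(lt_le_trans ltr01 Lr1) //.
    by rewrite invf_div.
  by rewrite ler_expR lerN2.
have Lp : 0 < Lam by exact: lt_le_trans Lam1.
apply: (@le_trans _ _ (4 / rho * (rho / Lam) ^+ 14)).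
  by apply: ler_wpM2l => //; rewrite divr_ge0 // ltW.
rewrite expr_div_n exprS.
have -> : 4 / rho * (rho * rho ^+ 13 / Lam ^+ 14) = rho ^+ 13 * (4 / Lam ^+ 14).
  by move: (rho ^+ 13) => c; field; rewrite !gt_eqF ?exprn_gt0.
rewrite ler_piMl //; last by rewrite exprn_ile1 // ltW.
by rewrite divr_ge0 // exprn_ge0 // ltW.
Qed.

Definition dispersion_bound : R := rad ^+ 2 / N%:R ^+ 4.
Local Notation qb := dispersion_bound.

Let Np : (0 : R) < N%:R. Proof. exact: lt_le_trans N1. Qed.

Lemma dispersion_bound_ge0 : 0 <= qb.
Proof. by rewrite /dispersion_bound divr_ge0 ?sqr_ge0 ?exprn_ge0. Qed.

Lemma dispersion_horizon : T%:R ^+ 3 * qb <= rad ^+ 2.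
Proof.
rewrite /dispersion_bound mulrA ler_pdivrMr ?exprn_gt0 // mulrC.
apply: ler_wpM2l; first exact: sqr_ge0.
apply: (@le_trans _ _ (N%:R ^+ 3)).
  by rewrite lerXn2r ?nnegrE // horizon_le_budget.
by apply: ler_weXn2l.
Qed.

(** Lambda^14 is the seventh power of 10^4 q S^2 with q = T B N. The power of q beats T^4 N^4 M, S^2
    absorbs the noise and heterogeneity relative to L rad, and 10^4 exceeds the remaining 104 *
    3. *)
Lemma dispersion_contract :
  26 * (4 / rho * (1 - kap) ^+ B) *
   (2 * qb + 2 * (T%:R ^+ 4 / (128 * L) ^+ 2 *
     (2 * (M%:R * sigma ^+ 2) + 4 * L ^+ 2 * (qb + M%:R * (104 * rad ^+ 2))
       + 4 * (M%:R * zeta ^+ 2)))) <= qb.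
Proof.
set H := 2 * (M%:R * sigma ^+ 2) + _ + _; set dl := 4 / rho * _.
have r2 : 0 < rad ^+ 2 by rewrite exprn_gt0 // epoch_rad_gt0.
have qM : qb <= M%:R * rad ^+ 2.
  rewrite /dispersion_bound ler_pdivrMr ?exprn_gt0 //.
  have n4 : 1 <= N%:R ^+ 4 :> R by rewrite expr_ge1.
  have a1 : rad ^+ 2 <= M%:R * rad ^+ 2 by rewrite ler_peMl // ltW.
  apply: (le_trans a1); rewrite ler_peMr //; apply: mulr_ge0; exact: ltW.
(* 420 = 4 * (1 + 104), the 1 coming from [qM]. *)
have Hle : H <= 420 * M%:R * L ^+ 2 * rad ^+ 2 * S ^+ 2.
  have y0 : 0 <= (zeta + sigma) / (L * rad) by rewrite divr_ge0 // mulr_ge0 // ltW // epoch_rad_gt0.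
  have e : zeta + sigma = (zeta + sigma) / (L * rad) * (L * rad).
    by field; rewrite !gt_eqF // epoch_rad_gt0.
  have sz : 2 * sigma ^+ 2 + 4 * zeta ^+ 2 <= 4 * (zeta + sigma) ^+ 2 by move: sigma0 zeta0; nra.
  have h1 := ler_wpM2l (ltW Mr0) sz.
  have L2 : 0 <= 4 * L ^+ 2 by rewrite mulr_ge0 // sqr_ge0.
  have h2 := ler_wpM2l L2 qM.
  rewrite e in h1; move: h1; rewrite /S; move: ((zeta + sigma) / (L * rad)) y0 => y y0 h1.
  have k : 0 <= M%:R * L ^+ 2 * rad ^+ 2 by rewrite !mulr_ge0 ?sqr_ge0 // ltW.
  have h3 : 420 + 4 * y ^+ 2 <= 420 * (1 + y) ^+ 2 by nra.
  have := ler_wpM2l k h3; rewrite /H; lra.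
have dl0 : 0 <= dl.
  apply: mulr_ge0; first by rewrite divr_ge0 // ltW.
  apply: exprn_ge0; rewrite subr_ge0 -[leRHS](sqrtr1 R) ler_wsqrtr //.
  by move: rho1 rho0; lra.
have S2 : 1 <= S ^+ 2 by rewrite expr_ge1 // (le_trans _ S1).
pose q : R := T%:R * B%:R * N%:R.
have q1 : 1 <= q.
  by rewrite /q -!natrM ler1n !muln_gt0 T0 block_gt0 -(ltr0n R) Np.
have L14 : 10 ^+ 4 * (q ^+ 7 * S ^+ 2) <= Lam ^+ 14.
  have -> : Lam ^+ 14 = (10 ^+ 4 * q * S ^+ 2) ^+ 7 by rewrite -Lambda_sq -exprM.
  have split3 (x y z : R) : (x * y * z) ^+ 7 = x ^+ 7 * (y ^+ 7 * z ^+ 7).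
    by rewrite !exprMn mulrA.
  have grow (x : R) : 1 <= x -> x <= x ^+ 7.
    by move=> x1; rewrite -[leLHS]expr1; apply: ler_weXn2l.
  have p1 : 1 <= 10 ^+ 4 :> R by rewrite -natrX ler1n.
  have q7 : 0 <= q ^+ 7 by rewrite exprn_ge0 // (le_trans _ q1).
  rewrite split3; apply: ler_pM; [by rewrite exprn_ge0 | | exact: grow | ].
    by apply: mulr_ge0 => //; exact: sqr_ge0.
  by apply: ler_wpM2l => //; exact: grow.
have TMN : T%:R ^+ 4 * N%:R ^+ 4 * M%:R <= q ^+ 7.
  have TM : T%:R * M%:R <= N%:R :> R by rewrite budget_split mulrA ler_peMr // mulr_ge0.
  have NT : N%:R * T%:R <= q.
    by rewrite /q [leRHS]mulrC ler_wpM2l // ler_peMr.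
  apply: (@le_trans _ _ (q ^+ 5)); last exact: ler_weXn2l.
  apply: (@le_trans _ _ ((N%:R * T%:R) ^+ 5)); last first.
    by rewrite lerXn2r ?nnegrE ?mulr_ge0 // (le_trans _ q1).
  rewrite exprMn.
  have -> : T%:R ^+ 4 * N%:R ^+ 4 * M%:R = (T%:R ^+ 3 * N%:R ^+ 4) * (T%:R * M%:R) :> R by ring.
  have -> : N%:R ^+ 5 * T%:R ^+ 5 = (T%:R ^+ 5 * N%:R ^+ 4) * N%:R :> R by ring.
  apply: ler_pM; [ | exact: mulr_ge0 | | exact: TM].
    by apply: mulr_ge0; exact: exprn_ge0.
  by apply: ler_wpM2r; [exact: exprn_ge0 | exact: ler_weXn2l].
have Lp : 0 < Lam ^+ 14 by rewrite exprn_gt0 // (lt_le_trans _ Lam1).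
have N4 : 0 < N%:R ^+ 4 :> R by rewrite exprn_gt0.
set zz := 2 * qb + _.
have zle : zz * N%:R ^+ 4 <= 3 * (q ^+ 7 * S ^+ 2) * rad ^+ 2.
  have T4 : 0 <= T%:R ^+ 4 / (128 * L) ^+ 2 :> R by rewrite divr_ge0 ?exprn_ge0 // mulr_ge0 // ltW.
  have h1 := ler_wpM2l T4 Hle.
  have e1 : T%:R ^+ 4 / (128 * L) ^+ 2 * (420 * M%:R * L ^+ 2 * rad ^+ 2 * S ^+ 2) =
     420 / 16384 * (T%:R ^+ 4 * M%:R * S ^+ 2 * rad ^+ 2).
    by move: (rad ^+ 2) (S ^+ 2) => x1 x2; field; rewrite gt_eqF.
  rewrite e1 in h1.
  have eq : qb * N%:R ^+ 4 = rad ^+ 2 by rewrite /dispersion_bound divfK // gt_eqF.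
  have h2 := ler_wpM2r (ltW N4) h1.
  have sr2 : 0 <= S ^+ 2 * rad ^+ 2 by rewrite mulr_ge0 ?sqr_ge0.
  have h3 := ler_wpM2r sr2 TMN.
  have q71 : 1 <= q ^+ 7 by exact: exprn_ege1.
  have h4 : 1 * rad ^+ 2 <= (q ^+ 7 * S ^+ 2) * rad ^+ 2.
    apply: ler_wpM2r; first exact: ltW.
    by have := ler_pM ler01 ler01 q71 S2; rewrite mulr1.
  exact: dispersion_arith r2 h2 h3 h4 eq.
have z0 : 0 <= zz.
  rewrite /zz addr_ge0 ?mulr_ge0 ?dispersion_bound_ge0 ?invr_ge0 ?exprn_ge0 //.
    by rewrite mulr_ge0 // ltW.
  have Mz : 0 <= M%:R * zeta ^+ 2 by rewrite mulr_ge0 ?sqr_ge0 // ltW.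
  have Ms : 0 <= M%:R * sigma ^+ 2 by rewrite mulr_ge0 ?sqr_ge0 // ltW.
  have Mr2 : 0 <= M%:R * (104 * rad ^+ 2) by rewrite !mulr_ge0 ?sqr_ge0 // ltW.
  have L2 : 0 <= 4 * L ^+ 2 by rewrite mulr_ge0 // sqr_ge0.
  have := mulr_ge0 L2 (addr_ge0 dispersion_bound_ge0 Mr2); rewrite /H; lra.
rewrite /dispersion_bound ler_pdivlMr //.
apply: (@le_trans _ _ (26 * (4 / Lam ^+ 14) * zz * N%:R ^+ 4)).
  rewrite ler_pM2r //; apply: ler_wpM2r => //; rewrite ler_pM2l //; exact: contraction_le.
have -> : 26 * (4 / Lam ^+ 14) * zz * N%:R ^+ 4 = 104 * (zz * N%:R ^+ 4) / Lam ^+ 14.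
  by move: (Lam ^+ 14) Lp => c Lp; field; rewrite gt_eqF.
rewrite ler_pdivrMr //.
have h5 := ler_wpM2r (ltW r2) L14.
have k : 0 <= q ^+ 7 * S ^+ 2 * rad ^+ 2.
  apply: mulr_ge0; last exact: sqr_ge0.
  by apply: mulr_ge0; [apply: exprn_ge0; exact: le_trans q1 | exact: sqr_ge0].
have c : 10 ^+ 4 = 10000 :> R by rewrite -natrX.
rewrite c in h5; move: zle h5 k.
move: (zz * _) (q ^+ 7) (S ^+ 2) (rad ^+ 2) (Lam ^+ 14) => a1 a2 a3 a4 a5; lra.
Qed.

Let L256 : 0 < 256 * L. Proof. by apply: mulr_gt0; rewrite ?ltr0n. Qed.
Let L128 : 0 < 128 * L. Proof. by apply: mulr_gt0; rewrite ?ltr0n. Qed.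

Let asum_ge : T%:R ^+ 2 / (256 * L) <= asum L T.
Proof.
rewrite /asum; apply: ler_wpM2r; first by rewrite invr_ge0 (ltW L256).
by rewrite expr2; apply: ler_wpM2l => //; rewrite ler_nat.
Qed.

(** The noise term is a square root, so squares are compared. After cancellation only [key] remains,
    which is [budget_noise] with eps <= Delta; 3 / 256 is chosen so that 8 <= 9 there. *)
Lemma stoch_term_le : @stoch_term R M L sigma T B * rad <= 3 / 256 * Delta * asum L T.
Proof.
have Tp : (0 : R) < T%:R by apply: lt_le_trans T1.
have MBp : 0 < M%:R * B%:R :> R by apply: lt_le_trans MB1.
have V0 := @stoch_term_ge0 R M L sigma T B sigma0.
have c0 : 0 <= 3 / 256 * Delta.
  by apply: mulr_ge0; [apply: divr_ge0; exact: ler0n | exact: ltW].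
have Vsq := @stoch_term_sq R M L sigma T B M0 block_gt0.
apply: (@le_trans _ _ (3 / 256 * Delta * (T%:R ^+ 2 / (256 * L)))); last first.
  by apply: ler_wpM2l; [exact: c0 | exact: asum_ge].
have rhs0 : 0 <= 3 / 256 * Delta * (T%:R ^+ 2 / (256 * L)).
  by apply: (mulr_ge0 c0); apply: divr_ge0; [exact: sqr_ge0 | exact: ltW L256].
rewrite -(@ler_pXn2r _ 2) ?nnegrE //; last by rewrite mulr_ge0 // ltW // epoch_rad_gt0.
rewrite exprMn Vsq epoch_rad_sq.
have suma : \sum_(i < T) a_coef L i ^+ 2 <= T%:R * (T%:R / (128 * L)) ^+ 2.
  apply: (@le_trans _ _ (\sum_(i < T) (T%:R / (128 * L)) ^+ 2)).
    apply: ler_sum => i _; apply: sqr_le; first by apply: divr_ge0; [exact: ler0n | exact: ltW L128].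
    by apply: ler_wpM2r; [rewrite invr_ge0 (ltW L128) | rewrite ler_nat].
  by rewrite sumr_const card_ord -[leLHS]mulr_natl lexx.
apply: (@le_trans _ _ (sigma ^+ 2 / (M%:R * B%:R) * (T%:R * (T%:R / (128 * L)) ^+ 2) * (2 * Delta / mu))).
  apply: ler_wpM2r; first by rewrite divr_ge0 ?mulr_ge0 // ltW.
  by apply: ler_wpM2l => //; rewrite divr_ge0 ?sqr_ge0 // ltW.
have key : 8 * sigma ^+ 2 * 2 ^+ 16 <= 9 * Delta * (T%:R * (M%:R * B%:R)) * mu.
  have h := budget_noise; rewrite budget_split in h.
  have MBT : 0 <= T%:R * (M%:R * B%:R) * mu by rewrite !mulr_ge0 // ltW.
  have h2 := ler_wpM2l MBT epsD.
  have h3 : 0 <= T%:R * (M%:R * B%:R) * mu * Delta by rewrite mulr_ge0 // ltW.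
  lra.
have -> : sigma ^+ 2 / (M%:R * B%:R) * (T%:R * (T%:R / (128 * L)) ^+ 2) * (2 * Delta / mu) =
  8 * sigma ^+ 2 * 2 ^+ 16 * (T%:R ^+ 3 * Delta / (M%:R * B%:R * mu * L ^+ 2 * 2 ^+ 32)).
  have c128 : 128 = 2 ^+ 7 :> R by rewrite -natrX.
  have -> : 2 ^+ 32 = 2 ^+ 16 * (2 ^+ 2 * 128 ^+ 2) :> R by rewrite c128 -!exprM -!exprD.
  move: (exprn_gt0 16 (ltr0n R 2)); move: (2 ^+ 16 : R) => p p0.
  by field; rewrite !gt_eqF // ltr0n ?block_gt0.
have -> : (3 / 256 * Delta * (T%:R ^+ 2 / (256 * L))) ^+ 2 =
  9 * Delta * (T%:R * (M%:R * B%:R)) * mu * (T%:R ^+ 3 * Delta / (M%:R * B%:R * mu * L ^+ 2 * 2 ^+ 32)).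
  have c256 : 256 = 2 ^+ 8 :> R by rewrite -natrX.
  have -> : 2 ^+ 32 = 256 ^+ 4 :> R by rewrite c256 -exprM.
  by field; rewrite !gt_eqF // ltr0n ?block_gt0.
apply: ler_wpM2r => //.
rewrite divr_ge0 ?mulr_ge0 ?exprn_ge0 ?(ltW D0) ?(ltW mu0) ?(ltW L0) //.
Qed.

(** The two budget terms act separately: the accelerated one makes rad^2 negligible through
    [horizon_sq_ge], the statistical one is [stoch_term_le]. *)
Lemma epoch_gap_le :
  (rad ^+ 2 + 3 / 2 * (@stoch_term R M L sigma T B * rad)) / asum L T <= Delta / 8.
Proof.
have Tp : (0 : R) < T%:R by apply: lt_le_trans T1.
have A0 : 0 < asum L T by rewrite /asum !divr_gt0 ?mulr_gt0 ?ltr0n.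
rewrite ler_pdivrMr //; have := stoch_term_le.
have h : 2 ^+ 25 * rad ^+ 2 <= Delta * asum L T.
  rewrite epoch_rad_sq; have hh := horizon_sq_ge.
  apply: (@le_trans _ _ (Delta * (T%:R ^+ 2 / (256 * L)))); last first.
    by apply: ler_wpM2l; [exact: ltW | exact: asum_ge].
  have -> : Delta * (T%:R ^+ 2 / (256 * L)) = (T%:R ^+ 2 * mu) * (Delta / (256 * L * mu)).
    by field; rewrite !gt_eqF.
  have -> : 2 ^+ 25 * (2 * Delta / mu) = (2 ^+ 34 * L) * (Delta / (256 * L * mu)).
    have -> : 2 ^+ 34 = 2 ^+ 25 * 2 ^+ 9 :> R by rewrite -exprD.
    move: (2 ^+ 25 : R) => c; have -> : 2 ^+ 9 = 512 :> R by rewrite -natrX.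
    by field; rewrite !gt_eqF.
  apply: ler_wpM2r; first by apply: divr_ge0; [exact: ltW | apply: mulr_ge0; [exact: ltW L256 | exact: ltW]].
  apply: le_trans hh; rewrite ler_pM2r //; by rewrite ler_eXn2l // ltr1n.
have c : 1000 <= 2 ^+ 25 :> R.
  have -> : 2 ^+ 25 = 2 ^+ 10 * 2 ^+ 15 :> R by rewrite -exprD.
  have -> : 2 ^+ 10 = 1024 :> R by rewrite -natrX.
  have : 1 <= 2 ^+ 15 :> R by rewrite expr_ge1 // ler1n.
  lra.
have r2 : 0 <= rad ^+ 2 by exact: sqr_ge0.
have h2 := ler_wpM2r r2 c.
have h3 : 0 <= Delta * asum L T by rewrite mulr_ge0 // ltW.
by move: (@stoch_term R M L sigma T B * rad) => V hV; lra.
Qed.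

(** The price of passing from the average to a single column in the last epoch. *)
Lemma dispersion_gap : L * (qb / 26) <= Delta / 8.
Proof.
have r2 : 0 <= rad ^+ 2 by exact: sqr_ge0.
have TN := horizon_le_budget.
have h : T%:R ^+ 2 <= N%:R ^+ 4 :> R.
  apply: (@le_trans _ _ (N%:R ^+ 2)); first exact: sqr_le.
  exact: ler_weXn2l.
have hh := horizon_sq_ge.
have e : L * (qb / 26) = L * (2 * Delta / 26) / (mu * N%:R ^+ 4).
  rewrite /dispersion_bound epoch_rad_sq; have := exprn_gt0 4 Np; move: (N%:R ^+ 4) => c c0.
  by field; rewrite !gt_eqF.
rewrite e ler_pdivrMr; last by rewrite mulr_gt0 // exprn_gt0.
have c : 1 <= 2 ^+ 36 :> R by rewrite expr_ge1 // ler1n.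
have h1 := ler_wpM2r (ltW L0) c.
have h2 := ler_wpM2r (ltW mu0) h.
have h3 : L <= N%:R ^+ 4 * mu by apply: (le_trans _ h2); apply: (le_trans _ hh); rewrite -[leLHS]mul1r.
have := ler_wpM2r (ltW D0) h3.
have : 0 <= L * Delta by rewrite mulr_ge0 // ltW.
move: (N%:R ^+ 4) => n4; lra.
Qed.
End parameters.

(** * Growth and smoothness of the averaged objective *)

Section objective.
Context {R : realType} {d M : nat}.
Variables (f_ : 'I_M -> 'cV[R]_d -> R) (L mu : R) (xs : 'cV[R]_d).
Hypotheses (M0 : (0 < M)%N) (L0 : 0 < L).
Hypothesis cvx : forall i, convex_on_space (f_ i).
Hypothesis smooth : forall i, L_smooth L (f_ i).
Local Notation f := (average f_).
Hypothesis xs_min : forall v, f xs <= f v.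

(** Expand f u around v. The linear term is split by Young's inequality, and |g|^2 / (2 L) is at
    most the gap at v because the gradient step v - g / L cannot go below the minimum. *)
Lemma gap_near u v : f u - f xs <= 2 * (f v - f xs) + L * normsq (u - v).
Proof.
(* At a consensus query the dispersion is 0, so the inexact oracle is exact at v. *)
have [c] := mean_oracle M0 L0 cvx smooth (v *m ones).
rewrite dis_rank1 // normsq0 mul0r mean_rank1 //; move: (mean _) => g h.
have h0 := h v; rewrite subrr normsq0 addr0 mulr0 addr0 in h0; case: h0 => h1 h2.
have [_ h3] := h u; have [_ h4] := h (v - L^-1 *: g); have h5 := xs_min (v - L^-1 *: g).
rewrite addr0 in h3; rewrite addr0 in h4.
have e : v - L^-1 *: g - v = - L^-1 *: g by rewrite addrAC subrr add0r scaleNr.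
rewrite e normsqZ dotDr -scaleNr dotZr in h4.
rewrite -/(normsq g) in h4.
have eu : dot g u = dot g v + dot g (u - v) by rewrite dotDr dotNr; lra.
have y := young (u - v) g L0; rewrite (dotC _ g) in y.
have e2 : L / 2 * ((- L^-1) ^+ 2 * normsq g) = normsq g / L / 2 by field; rewrite gt_eqF.
have e3 : - L^-1 * normsq g = - (normsq g / L) by rewrite mulNr mulrC.
rewrite e2 e3 in h4; rewrite eu in h3.
have e4 : L / 2 * normsq (u - v) = L * normsq (u - v) / 2 by rewrite mulrAC.
rewrite e4 in h3; rewrite -scaleNr in h5; lra.
Qed.

(** Minimality along the segment to xs and strong convexity give g >= (1 - t) n for every t in (0,
    1), contradicting g < n for small t. *)
Lemma strong_growth x : 0 < mu -> strongly_convex mu f ->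
  mu / 2 * normsq (x - xs) <= f x - f xs.
Proof.
move=> mu0 sc; rewrite leNgt; apply/negP => lt.
set g := f x - f xs in lt; set n := mu / 2 * _ in lt.
have g0 : 0 <= g by rewrite subr_ge0.
have n0 : 0 < n by apply: le_lt_trans lt.
(* Then (1 - t) n is the midpoint of g and n, hence larger than g. *)
pose t := (n - g) / (2 * n).
have n2 : 0 < 2 * n by rewrite mulr_gt0.
have t0 : 0 < t by rewrite divr_gt0 // subr_gt0.
have t1 : t < 1 by rewrite /t ltr_pdivrMr //; lra.
have := sc x xs t; rewrite (ltW t0) (ltW t1) enorm_sqr => /(_ isT).
have := xs_min (t *: x + (1 - t) *: xs) => h1 h2.
have h : 0 <= t * (g - (1 - t) * n).
  have -> : t * (g - (1 - t) * n) = t * f x + (1 - t) * f xs - mu / 2 * t * (1 - t) * normsq (x - xs) - f xs.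
    by rewrite /g /n; ring.
  by rewrite subr_ge0; exact: le_trans h2.
rewrite pmulr_rge0 // in h.
have e : t * n = (n - g) / 2 by rewrite /t; field; rewrite gt_eqF.
by lra.
Qed.

(** Growth and smoothness are compared at xs plus a nonzero vector. This serves the complexity
    bound, where it keeps sqrt (L / (mu rho)) away from 0. *)
Lemma strong_le_smooth : (0 < d)%N -> 0 < mu -> strongly_convex mu f -> mu <= 2 * L.
Proof.
move=> d0 mu0 sc; pose e : 'cV[R]_d := const_mx 1.
have n0 : 0 < normsq e.
  have -> : normsq e = d%:R.
    rewrite /normsq /dot; under eq_bigr do rewrite big_ord1 mxE mulr1.
    by rewrite sumr_const card_ord.
  by rewrite ltr0n.
have := strong_growth (xs + e) mu0 sc; have := gap_near (xs + e) xs.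
have -> : xs + e - xs = e by rewrite addrC addKr.
rewrite subrr mulr0 add0r => h1 h2; have := le_trans h2 h1.
by rewrite ler_pM2r // ler_pdivrMr // mulrC.
Qed.
End objective.

(** * Soft-O form of the sample complexity *)

Section complexity.
Context {R : realType}.
Variables (M : nat) (L mu sigma zeta rho eps Delta0 : R).
Hypotheses (M0 : (0 < M)%N) (L0 : 0 < L) (mu0 : 0 < mu) (sigma0 : 0 <= sigma).
Hypotheses (zeta0 : 0 <= zeta) (rho01 : 0 < rho <= 1) (eps0 : 0 < eps).
Hypotheses (muL : mu <= 2 * L) (epsD : 2 * eps <= Delta0).
Local Notation vs := [:: eps; Delta0; mu; L; rho; M%:R; 1 + sigma; 1 + zeta].
(** Every v in [vs] has v and 1 / v at most E = exp S, so expressions built from [vs] by products,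
    quotients and sums are at most powers of E. Shifting sigma and zeta by 1 keeps their logarithms
    meaningful at 0. *)
Let S : R := log_factor 1 vs.
Let E := expR S.
Let r : R := Num.sqrt (L / (mu * rho)).
Let u : R := sigma ^+ 2 / (mu * eps).

Let rho0 : 0 < rho. Proof. by case/andP: rho01. Qed.
Let rho1 : rho <= 1. Proof. by case/andP: rho01. Qed.
Let Mr : (1 : R) <= M%:R. Proof. by rewrite ler1n. Qed.
Let Mr0 : (0 : R) < M%:R. Proof. by rewrite ltr0n. Qed.
Let D0 : 0 < Delta0. Proof. by apply: lt_le_trans epsD; rewrite mulr_gt0. Qed.
Let s0 : 0 < 1 + sigma. Proof. exact: ltr_wpDr. Qed.
Let z0 : 0 < 1 + zeta. Proof. exact: ltr_wpDr. Qed.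

Let S1 : 1 <= S.
Proof. by rewrite /S /log_factor expr1 lerDl sumr_ge0. Qed.

Let lnS v : v \in vs -> `|ln v| <= S.
Proof.
move=> vin; rewrite /S /log_factor expr1 (perm_big _ (perm_to_rem vin)) big_cons /=.
by rewrite addrCA lerDl addr_ge0 // sumr_ge0.
Qed.

Let E2 : 2 <= E.
Proof. by apply: (@le_trans _ _ (1 + S)); [move: S1; lra | exact: expR_ge1Dx]. Qed.

Let leE v : 0 < v -> v \in vs -> v <= E.
Proof.
move=> v0 vin; rewrite -{1}(@lnK _ v) ?posrE // ler_expR.
exact: le_trans (ler_norm _) (lnS vin).
Qed.

Let leVE v : 0 < v -> v \in vs -> v^-1 <= E.
Proof.
move=> v0 vin; rewrite -{1}(@lnK _ v) ?posrE // -expRN ler_expR.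
by apply: le_trans (lnS vin); rewrite -normrN ler_norm.
Qed.

Let powM x y m n : 0 <= x -> 0 <= y -> x <= E ^+ m -> y <= E ^+ n -> x * y <= E ^+ (m + n).
Proof. by move=> *; rewrite exprD ler_pM. Qed.

(** A sum costs one extra power because E >= 2. *)
Let powD x y n : x <= E ^+ n -> y <= E ^+ n -> x + y <= E ^+ n.+1.
Proof.
move=> hx hy; rewrite exprS; apply: (@le_trans _ _ (2 * E ^+ n)); first by rewrite mulr_natl mulr2n lerD.
by rewrite ler_wpM2r // exprn_ge0 // expR_ge0.
Qed.

Let pow_mono x m n : (m <= n)%N -> x <= E ^+ m -> x <= E ^+ n.
Proof. by move=> mn h; apply: (le_trans h); rewrite ler_weXn2l //; move: E2; lra. Qed.

Let pow1 n : 1 <= E ^+ n.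
Proof. by rewrite exprn_ege1 //; move: E2; lra. Qed.

Let sqrt_le1D (x : R) : 0 <= x -> Num.sqrt x <= x + 1.
Proof.
move=> x0; have := sqr_ge0 (Num.sqrt x - 1 / 2); rewrite sqrrB sqr_sqrtr //.
by move: (Num.sqrt x) => y; lra.
Qed.

(** The three factors under the logarithm are at most E^101, E^7 and E^7; 115 is the sum of these
    exponents. *)
Lemma ell_le : ell M L mu sigma zeta rho eps <= 115 * S.
Proof.
rewrite /ell ge_max; apply/andP; split; first by move: S1; lra.
have h1 : 2 ^+ 100 / (rho * Num.sqrt M%:R) <= E ^+ (100 + 1).
  apply: powM => //.
  - by rewrite invr_ge0 mulr_ge0 ?sqrtr_ge0 ?ltW.
  - by rewrite lerXn2r // nnegrE ?expR_ge0.
  rewrite expr1; apply: (@le_trans _ _ rho^-1); last by apply: leVE; rewrite // !inE eqxx ?orbT.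
  have sM : 1 <= Num.sqrt M%:R :> R by rewrite -{1}sqrtr1 ler_sqrt // ltW.
  by rewrite lef_pV2 ?posrE ?mulr_gt0 ?(lt_le_trans _ sM) // ler_peMr // ltW.
have h2 : 1 + (zeta + sigma) / (L * Num.sqrt (eps / mu)) <= E ^+ 7.
  apply: powD; first exact: pow1.
  have hzs : zeta + sigma <= E ^+ 2.
    apply: powD; rewrite expr1.
      by apply: (@le_trans _ _ (1 + zeta)); [lra | apply: leE; rewrite // !inE eqxx ?orbT].
    by apply: (@le_trans _ _ (1 + sigma)); [lra | apply: leE; rewrite // !inE eqxx ?orbT].
  apply: (@powM _ _ 2 4) => //.
  - by rewrite addr_ge0.
  - by rewrite invr_ge0 mulr_ge0 ?sqrtr_ge0 ?ltW.
  rewrite invfM; apply: (@powM _ _ 1 3); rewrite ?invr_ge0 ?sqrtr_ge0 ?(ltW L0) //.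
    by rewrite expr1; apply: leVE; rewrite // !inE eqxx ?orbT.
  rewrite -sqrtrV ?invf_div; last by rewrite divr_ge0 // ltW.
  have me : 0 <= mu / eps by rewrite divr_ge0 // ltW.
  apply: (le_trans (sqrt_le1D me)).
  apply: powD; last exact: pow1.
  apply: (@powM _ _ 1 1); rewrite ?invr_ge0 ?(ltW mu0) ?(ltW eps0) // expr1.
    by apply: leE; rewrite // !inE eqxx ?orbT.
  by apply: leVE; rewrite // !inE eqxx ?orbT.
have h3 : 1 + u + M%:R * r <= E ^+ 7.
  apply: powD.
    apply: powD; first exact: pow1.
    apply: (@powM _ _ 2 3); rewrite ?sqr_ge0 // ?invr_ge0 ?mulr_ge0 ?(ltW mu0) ?(ltW eps0) //.
      rewrite lerXn2r ?nnegrE ?expR_ge0 //.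
      by apply: (@le_trans _ _ (1 + sigma)); [lra | apply: leE; rewrite // !inE eqxx ?orbT].
    apply: (@pow_mono _ 2) => //.
    rewrite invfM; apply: (@powM _ _ 1 1); rewrite ?invr_ge0 ?(ltW mu0) ?(ltW eps0) // expr1.
      by apply: leVE; rewrite // !inE eqxx ?orbT.
    by apply: leVE; rewrite // !inE eqxx ?orbT.
  apply: (@powM _ _ 1 5); rewrite ?sqrtr_ge0 ?(ltW Mr0) //.
    by rewrite expr1; apply: leE; rewrite // !inE eqxx ?orbT.
  have Lmr : 0 <= L / (mu * rho) by rewrite divr_ge0 ?mulr_ge0 ?ltW.
  apply: (le_trans (sqrt_le1D Lmr)); apply: (@pow_mono _ 4) => //.
  apply: powD; last exact: pow1.
  apply: (@powM _ _ 1 2); rewrite ?invr_ge0 ?mulr_ge0 ?(ltW L0) ?(ltW mu0) ?(ltW rho0) //.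
    by rewrite expr1; apply: leE; rewrite // !inE eqxx ?orbT.
  rewrite invfM; apply: (@powM _ _ 1 1); rewrite ?invr_ge0 ?(ltW mu0) ?(ltW rho0) // expr1.
    by apply: leVE; rewrite // !inE eqxx ?orbT.
  by apply: leVE; rewrite // !inE eqxx ?orbT.
have a1 : 0 < 2 ^+ 100 / (rho * Num.sqrt M%:R) by rewrite divr_gt0 ?exprn_gt0 ?mulr_gt0 ?sqrtr_gt0.
have a2 : 0 < 1 + (zeta + sigma) / (L * Num.sqrt (eps / mu)).
  rewrite ltr_wpDr // divr_ge0 ?addr_ge0 //; apply: mulr_ge0; first exact: ltW.
  exact: sqrtr_ge0.
have a3 : 0 < 1 + u + M%:R * r.
  rewrite -addrA ltr_wpDr //; apply: addr_ge0.
    by rewrite divr_ge0 ?sqr_ge0 // mulr_ge0 // ltW.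
  by rewrite mulr_ge0 // ?sqrtr_ge0.
have h := powM (ltW (mulr_gt0 a1 a2)) (ltW a3) (powM (ltW a1) (ltW a2) h1 h2) h3.
apply: (@le_trans _ _ (ln (E ^+ (100 + 1 + 7 + 7)))).
  rewrite ler_ln ?posrE //; last by rewrite exprn_gt0 ?expR_gt0.
  by apply: mulr_gt0 => //; exact: mulr_gt0.
by rewrite lnXn ?expR_gt0 // expRK -[leLHS]mulr_natl.
Qed.

(** The number of epochs is of order q = ln (Delta0 / eps). On the statistical term, whose target
    carries no q, it is absorbed by q <= S; on the accelerated term q is kept and S^2 pays for [ell]
    squared. *)
Lemma soft_O_complexity :
  (num_epochs Delta0 eps)%:R * (1 + budget_real M L mu sigma zeta rho eps) <=
  2 / ln 2 * (2 + 2 ^+ 16 + 2 ^+ 18 * 115 ^+ 2) * log_factor 2 vs *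
  (u + M%:R * r * ln (Delta0 / eps)).
Proof.
have q2 : 2 <= Delta0 / eps by rewrite ler_pdivlMr.
have lnq0 : 0 <= ln (Delta0 / eps) by rewrite ln_ge0 //; lra.
have lnqS : ln (Delta0 / eps) <= S.
  rewrite ln_div ?posrE // /S /log_factor expr1 !big_cons.
  have n1 := ler_norm (ln Delta0); have n2 : - ln eps <= `|ln eps| by rewrite -normrN ler_norm.
  have h : 0 <= \sum_(j <- [::mu; L; rho; M%:R; 1 + sigma; 1 + zeta]) `|ln j| by rewrite sumr_ge0.
  rewrite !big_cons in h; move: (_ + (_ + (_ + (_ + _)))) n1 n2 h => *; lra.
have hK : (num_epochs Delta0 eps)%:R <= 2 / ln 2 * ln (Delta0 / eps).
  by apply: num_epochs_log => //; rewrite eps0 /=; move: epsD eps0; lra.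
have k0 : 0 <= 2 / ln 2 :> R by rewrite divr_ge0 // ln_ge0 // ler1n.
have hl := ell_le.
have l0 : 0 <= ell M L mu sigma zeta rho eps by rewrite le_max ler0n.
have hl2 : ell M L mu sigma zeta rho eps ^+ 2 <= 115 ^+ 2 * S ^+ 2.
  by rewrite -exprMn lerXn2r // nnegrE // (le_trans l0).
have u0 : 0 <= u by rewrite divr_ge0 ?sqr_ge0 // mulr_ge0 // ltW.
have r0 : 0 <= r by exact: sqrtr_ge0.
have r2 : 1 <= 2 * r.
  have mr0 : 0 < mu * rho by exact: mulr_gt0.
  rewrite -(@ler_pXn2r _ 2) ?nnegrE //; last exact: mulr_ge0.
  rewrite expr1n exprMn sqr_sqrtr; last by rewrite divr_ge0 // ltW.
  rewrite mulrA ler_pdivlMr // mul1r.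
  by apply: (@le_trans _ _ mu); [rewrite ler_piMr // ltW | move: muL L0; lra].
(* Lets the 1 due to rounding the budget be charged to the accelerated term. *)
have Mr2 : 1 <= 2 * (M%:R * r).
  by apply: (le_trans r2); rewrite mulrCA ler_peMl // mulr_ge0.
have -> : log_factor 2 vs = S ^+ 2 by rewrite /S /log_factor expr1.
rewrite /budget_real -/u -/r -(mulrA _ M%:R r).
move: (M%:R * r) (ell M L mu sigma zeta rho eps ^+ 2) hl2 Mr2 (sqr_ge0 (ell M L mu sigma zeta rho eps)) => w l2 hl2 w2 l2p.
have w0 : 0 <= w by lra.
move: (u) u0 => v v0.
have S2 : 1 <= S ^+ 2 by rewrite exprn_ege1 //; move: S1; lra.
have SS : S <= S ^+ 2 by rewrite expr2 ler_peMl //; move: S1; lra.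
have a0 : 0 <= 2 ^+ 16 :> R by exact: exprn_ge0.
have b0 : 0 <= 2 ^+ 18 :> R by exact: exprn_ge0.
have c0 : 0 <= 115 ^+ 2 :> R by exact: sqr_ge0.
move: (2 ^+ 16 : R) (2 ^+ 18 : R) (115 ^+ 2 : R) hl2 a0 b0 c0 => a b c hl2 a0 b0 c0.
have l20 : 0 <= c * S ^+ 2 by exact: mulr_ge0 c0 (sqr_ge0 S).
move: (ln (Delta0 / eps)) lnq0 lnqS hK => q q0 qS hK.
move: (S ^+ 2) S2 SS hl2 l20 => s2 S2 SS hl2 l20.
have qw0 : 0 <= q * w by exact: mulr_ge0.
have s20 : 0 <= s2 by lra.
have k1 : q <= s2 * (2 * (q * w)).
  apply: (@le_trans _ _ (2 * (q * w))); first by rewrite mulrCA ler_peMr.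
  by rewrite ler_peMl // mulr_ge0.
have k2 : q * (a * v) <= s2 * (a * v) by apply: ler_wpM2r; [exact: mulr_ge0 | exact: le_trans SS].
have k3 : q * w * b * l2 <= q * w * b * (c * s2) by apply: ler_wpM2l hl2; exact: mulr_ge0.
have k4 : 0 <= s2 * (a * (q * w)) by rewrite !mulr_ge0.
have k5 : 0 <= s2 * v by exact: mulr_ge0.
have k6 : 0 <= (c * s2) * (b * v) by rewrite mulr_ge0 // mulr_ge0.
apply: (@le_trans _ _ (2 / ln 2 * (q * (1 + (a * v + b * w * l2))))).
  rewrite (mulrA (2 / ln 2) q); apply: ler_wpM2r hK.
  rewrite addr_ge0 // addr_ge0 ?mulr_ge0 //.
rewrite -2!(mulrA (2 / ln 2)); apply: ler_wpM2l => //.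
lra.
Qed.
End complexity.

(** * Restarts *)

(* No measurability of X is needed: for nonnegative functions the integral is
   a supremum over simple minorants. *)
Lemma expectation_le_Rintegral disp (T : measurableType disp) (R : realType)
    (P : probability T R) (X Y : T -> R) :
  (forall w, 0 <= X w) -> (forall w, X w <= Y w) -> P.-integrable setT (EFin \o Y) ->
  ('E_P[X] <= (\int[P]_w Y w)%:E)%E.
Proof.
move=> X0 XY iY; rewrite unlock /Rintegral fineK; last exact: integrable_fin_num.
have Y0 w : 0 <= Y w by exact: le_trans (XY w).
rewrite ge0_integralTE; last by move=> w; rewrite lee_fin.
rewrite ge0_integralTE; last by move=> w; rewrite lee_fin.
apply: ereal_sup_le => _ [h hX <-]; exists h => // w.
by apply: le_trans (hX w) _; rewrite lee_fin.
Qed.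

Lemma nat_ceil_sum_le {R : realType} (M : nat) (L mu sigma zeta rho eps : R) (K : nat) :
  0 < mu -> 0 < eps ->
  (\sum_(s < K) nat_ceil (budget_real M L mu sigma zeta rho eps))%:R <=
  K%:R * (1 + budget_real M L mu sigma zeta rho eps).
Proof.
move=> mu0 eps0; rewrite sum_nat_const card_ord natrM; apply: ler_wpM2l => //.
rewrite addrC; apply/ltW/nat_ceil_lt.
rewrite /budget_real; apply: addr_ge0; apply: mulr_ge0; rewrite ?sqr_ge0 ?exprn_ge0 //.
by rewrite divr_ge0 ?sqr_ge0 // mulr_ge0 // ltW.
Qed.

Section restart.
Context disp (Omega : measurableType disp) (R : realType) (P : probability Omega R).
Context {d M : nat}.
Variables (f_ : 'I_M -> 'cV[R]_d -> R) (L mu sigma zeta rho Delta0 eps : R).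
Variables (x0 xstar : 'cV[R]_d) (edge : rel 'I_M) (W : 'M[R]_M) (lam : 'I_M -> R).
Variables (Xi : 'I_M -> Type) (G : forall i : 'I_M, 'cV[R]_d -> Xi i -> 'cV[R]_d).
Variable xi : nat -> nat -> forall i : 'I_M, nat -> Omega -> Xi i.
Variable F : nat -> nat -> set (set Omega).
Local Notation f := (average f_).
Local Notation K := (num_epochs Delta0 eps).
Local Notation bud := (budget_real M L mu sigma zeta rho eps).
Local Notation N := (nat_ceil bud).
Local Notation rad s := (epoch_radius mu Delta0 s).
Local Notation B s := (block_length M L sigma zeta rho (rad s) N).
Local Notation T s := (N %/ (M * B s))%N.
Local Notation prm s := (rule_params M L sigma rho (rad s) (T s) (B s)).
Local Notation U s w :=
  (restarted (fun e => prm e) W (@G) (fun e r j b => xi e r j b w) x0 s).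
Local Notation q s t i w :=
  (query (fun e => prm e) W (@G) (fun e r j b => xi e r j b w) x0 s t i).
Let ans s t i b w := @G i (q s t i w) (xi s t i b w).

Hypotheses (M0 : (0 < M)%N) (L0 : 0 < L) (mu0 : 0 < mu).
Hypotheses (sigma0 : 0 <= sigma) (zeta0 : 0 <= zeta).
Hypothesis cvx : forall i, convex_on_space (f_ i).
Hypothesis smooth : forall i, L_smooth L (f_ i).
Hypothesis sc : strongly_convex mu f.
Hypothesis xs_min : forall x, f xstar <= f x.
Hypothesis het : (M%:R)^-1 * \sum_(i < M)
  enorm (gradient (f_ i) xstar - gradient f xstar) ^+ 2 <= zeta ^+ 2.
Hypothesis gW : gossip_matrix edge W.
Hypothesis spec : ordered_spectrum W lam.
Hypothesis rho01 : 0 < rho <= 1.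
Hypothesis lam1 : forall i : 'I_M, nat_of_ord i = 1%N -> rho <= 1 - lam i.
Hypothesis gap0 : f x0 - f xstar <= Delta0.
Hypothesis eps0 : 0 < eps <= Delta0.
Hypothesis dvdN : forall s, (s < K)%N -> (M * B s %| N)%N /\ (0 < T s)%N.
Hypothesis sF : forall s t, sigma_algebra setT (F s t) /\ F s t `<=` measurable.
Hypothesis FS : forall s t, (s < K)%N -> (t <= T s)%N -> F s t `<=` F s t.+1.
Hypothesis FE : forall s, (s < K)%N -> F s (T s).+1 `<=` F s.+1 0%N.
Hypothesis ans_meas : forall s t i b, (s < K)%N -> (t <= T s)%N -> (b < B s)%N ->
  sigma_of (ans s t i b) `<=` F s t.+1.
Hypothesis unbiased : forall s t i b, (s < K)%N -> (t <= T s)%N -> (b < B s)%N ->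
  forall k : 'I_d, cond_exp_version P (F s t) (fun w => ans s t i b w k 0)
    (fun w => gradient (f_ i) (q s t i w) k 0).
Hypothesis variance_le : forall s t i b, (s < K)%N -> (t <= T s)%N -> (b < B s)%N ->
  exists V : Omega -> R,
    cond_exp_version P (F s t)
      (fun w => enorm (ans s t i b w - gradient (f_ i) (q s t i w)) ^+ 2) V /\
    {ae P, forall w, V w <= sigma ^+ 2}.
Hypothesis indep : forall s t, (s < K)%N -> (t <= T s)%N ->
  cond_independent P (F s t)
    (fun ib : 'I_M * 'I_(B s) => sigma_of (ans s t ib.1 ib.2)).

Let epos : 0 < eps. Proof. by case/andP: eps0. Qed.
Let D0 : 0 < Delta0. Proof. by case/andP: eps0 => h; exact: lt_le_trans. Qed.
Let rho0 : 0 < rho. Proof. by case/andP: rho01. Qed.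
Local Notation D s := (Delta0 / 2 ^+ s).

Let radE s : rad s = Num.sqrt (2 * D s / mu).
Proof.
rewrite /epoch_radius; congr Num.sqrt; have : 2 ^+ s != 0 :> R by rewrite expf_neq0.
by move: (2 ^+ s : R) => c c0; field; rewrite c0 gt_eqF.
Qed.

Let Dpos s : 0 < D s. Proof. by rewrite divr_gt0 // exprn_gt0. Qed.

Let rad_sq s : rad s ^+ 2 = 2 * D s / mu.
Proof. by rewrite radE sqr_sqrtr // divr_ge0 ?mulr_ge0 // ltW. Qed.

Let rad_gt0 s : 0 < rad s.
Proof. by rewrite radE sqrtr_gt0 divr_gt0 ?mulr_gt0. Qed.

Let radS s : rad s.+1 ^+ 2 = rad s ^+ 2 / 2.
Proof.
rewrite !rad_sq exprS; have : 2 ^+ s != 0 :> R by rewrite expf_neq0.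
by move: (2 ^+ s : R) => c c0; field; rewrite c0 gt_eqF.
Qed.

Let gap (Y : 'M[R]_(d, M)) : Y *m ones^T = 0 -> dot Y (Y *m W) <= (1 - rho) * normsq Y.
Proof.
have [_ WT _ _ _] := gW.
exact: (spectral_gap WT (gossip_onesT gW) spec rho0 lam1 M0).
Qed.

Let hetsum : \sum_(i < M) normsq (gradient (f_ i) xstar - gradient f xstar) <= M%:R * zeta ^+ 2.
Proof.
have := het; rewrite mulrC ler_pdivrMr ?ltr0n // mulrC => h.
by under eq_bigr do rewrite -enorm_sqr.
Qed.

Local Notation qb s := (dispersion_bound M L mu sigma zeta rho eps (D s)).

Let epoch_start s :=
  [/\ madm P (F s 0%N) (fun w => U s w),
      \int[P]_w normsq (mean (U s w) - xstar) <= rad s ^+ 2 &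
      \int[P]_w normsq (dis (U s w)) <= qb s].

Let epoch_end s :=
  [/\ madm P (F s (T s).+1) (fun w => U s.+1 w),
      \int[P]_w normsq (dis (U s.+1 w)) <= qb s / 26 &
      exists Y : Omega -> R, [/\ P.-integrable setT (EFin \o Y),
        forall w, f (mean (U s.+1 w)) - f xstar <= Y w &
        \int[P]_w Y w <= D s / 8]].

Let epoch_step s : (s < K)%N -> epoch_start s -> epoch_end s.
Proof.
move=> sK [mU hx hd]; have [dvds Ts] := dvdN sK.
have Dge : eps <= D s by apply/ltW/epoch_gap_gt.
have del0 : 0 <= 4 / rho * (1 - Num.sqrt (rho / 2)) ^+ B s.
  have k1 : Num.sqrt (rho / 2) <= 1.
    rewrite -[leRHS]sqrtr1 ler_sqrt //; move: rho01; lra.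
  by rewrite mulr_ge0 ?exprn_ge0 ?subr_ge0 // divr_ge0 // ltW.
have Bs : (0 < B s)%N.
  by have := @block_gt0 R M L mu sigma zeta rho eps (D s); rewrite -radE.
have dvds' := dvds; have Ts' := Ts; rewrite radE in dvds' Ts'.
have H1 := @dispersion_horizon R M L mu sigma zeta rho eps (D s) M0 dvds' Ts'.
have H2 := dispersion_contract M0 L0 mu0 sigma0 zeta0 rho01 epos Dge dvds' Ts'.
have H3 := epoch_gap_le M0 L0 mu0 sigma0 zeta0 rho01 epos Dge dvds' Ts'.
rewrite -radE in H1 H2 H3.
have [e1 e2 [Y [iY fY hY]]] := @epoch_bound _ Omega R P d M f_ L sigma zeta rho (rad s)
  (T s) (B s) W edge xstar (gradient f xstar) Xi G (fun w t i b => xi s t i b w) (F s)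
  (fun w => U s w) M0 Bs Ts L0 sigma0 (rad_gt0 s) cvx smooth xs_min hetsum gW _ del0
  (fun X => gossip_contract M0 gW rho01 gap X (B s)) (fun t => (sF s t).1)
  (fun t => (sF s t).2) (fun t => @FS s t sK) (fun t i b => @ans_meas s t i b sK)
  (fun t i b => @unbiased s t i b sK) (fun t i b => @variance_le s t i b sK)
  (fun t => @indep s t sK) mU (qb s)
  (dispersion_bound_ge0 M L mu sigma zeta rho eps (D s)) hx hd H1 H2.
by split=> //; exists Y; split => //; apply: le_trans H3.
Qed.

Let start0 : epoch_start 0.
Proof.
have m : mean (x0 *m const_mx 1 : 'M[R]_(d, M)) = x0 by exact: (mean_rank1 M0 x0).
have di : dis (x0 *m const_mx 1 : 'M[R]_(d, M)) = 0 by exact: (dis_rank1 M0 x0).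
split; rewrite /=.
- exact: madm_cst (sF 0 0).1.
- rewrite RintegralT_cst m rad_sq expr0 divr1 ler_pdivlMr //.
  have h := strong_growth xs_min x0 mu0 sc; have g := gap0; lra.
- by rewrite RintegralT_cst di normsq0; exact: dispersion_bound_ge0.
Qed.

(** Strong growth turns the gap D s / 8 into squared distance at most D s / (4 mu), below the new
    squared radius D s / mu. The budget being the same in all epochs, [qb] only halves, while the
    epoch gained a factor 26. *)
Let next_start s : (s < K)%N -> epoch_end s -> epoch_start s.+1.
Proof.
move=> sK [mU hd [Y [iY fY hY]]].
have mU' : madm P (F s.+1 0%N) (fun w => U s.+1 w) by exact: madm_mono (FE sK) mU.
have sF' := (sF s.+1 0).1.
split=> //.
  have im : madm P (F s.+1 0%N) (fun w => mean (U s.+1 w) - xstar).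
    by apply: madmB => //; [apply: madm_mulmx | apply: madm_cst].
  have m2 : 0 <= 2 / mu by rewrite divr_ge0 // ltW.
  have := le_RintegralT (normsq_integrable im) (integrableZlR (2 / mu) iY).
  move=> /(_ _)/le_trans; apply.
    move=> w; rewrite /= mulrAC ler_pdivlMr //.
    have h := strong_growth xs_min (mean (U s.+1 w)) mu0 sc.
    have := le_trans h (fY w); lra.
  rewrite RintegralZl // radS rad_sq; apply: (le_trans (ler_wpM2l m2 hY)).
  have Dm : 0 <= D s / mu by rewrite divr_ge0 // ltW.
  lra.
have -> : qb s.+1 = qb s / 2.
  by rewrite /dispersion_bound -!radE radS mulrAC.
have := @dispersion_bound_ge0 R M L mu sigma zeta rho eps (D s); move: hd.
by move: (qb s) => x hx x_ge0; apply: (le_trans hx); lra.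
Qed.

Let reach s : (s <= K)%N -> epoch_start s.
Proof.
elim: s => [_|s IH sK]; first exact: start0.
by apply: next_start => //; apply: epoch_step => //; apply: IH; exact: ltnW.
Qed.

(** In the last epoch k, [gap_near] passes from the average to column i at cost 2 D k / 8 + L qb /
    26 <= D k / 2, which is the target gap after K = k + 1 epochs. *)
Theorem restarted_gap i :
  ('E_P[fun w => (f (col i (U K w)) - f xstar)%R] <= eps%:E)%E.
Proof.
have g0 w : 0 <= f (col i (U K w)) - f xstar by rewrite subr_ge0.
have last := @last_epoch_gap R Delta0 eps eps0.
(* With no epoch at all, Delta0 <= eps and the common starting point is already accurate enough. *)
have [K0|[k KE]] : K = 0%N \/ exists k, K = k.+1 by case: K => [|k]; [left | right; exists k].
  have := expectation_le_Rintegral g0 _ (integrable_cstR P eps).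
  rewrite RintegralT_cst; apply=> w; apply: le_trans last; rewrite K0 expr0 divr1 /=.
  by have -> : col i (x0 *m const_mx 1 : 'M[R]_(d, M)) = x0;
    [apply/colP => j; rewrite !mxE big_ord1 mxE mulr1 | exact: gap0].
have kK : (k < K)%N by rewrite KE.
have [mU hd [Y [iY fY hY]]] := epoch_step kK (reach (ltnW kK)).
have Dge : eps <= D k by apply/ltW/epoch_gap_gt.
have [dvdk Tk] := dvdN kK; rewrite radE in dvdk Tk.
have H4 := dispersion_gap M0 L0 mu0 sigma0 zeta0 rho01 epos Dge dvdk Tk.
have sF' := (sF k (T k).+1).1.
have imd : madm P (F k (T k).+1) (fun w => dis (U k.+1 w)) by exact: madm_mulmx.
have id := integrableZlR L (normsq_integrable imd).
have iY2 := integrableZlR 2 iY.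
have iS := integrableDR iY2 id.
apply: le_trans (expectation_le_Rintegral g0 _ iS) _.
  move=> w; rewrite KE.
  have h := gap_near M0 L0 cvx smooth xs_min (col i (U k.+1 w)) (mean (U k.+1 w)).
  have c := normsq_col_mean_le M0 (U k.+1 w) i.
  have c2 := ler_wpM2l (ltW L0) c.
  have := fY w; lra.
rewrite lee_fin (RintegralD _ iY2 id) // !RintegralZl //; last exact: normsq_integrable imd.
apply: le_trans last; rewrite KE exprS.
have -> : Delta0 / (2 * 2 ^+ k) = D k / 2 by rewrite invfM mulrCA mulrC.
have h5 := ler_wpM2l (ltW L0) hd.
have := Dpos k; lra.
Qed.
End restart.

Theorem theorem5 (R : realType) :
  exists (C : R) (p : nat),
  forall (d M : nat) (f_ : 'I_M -> 'cV[R]_d -> R)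
    (L mu sigma zeta rho Delta0 eps : R) (x0 xstar : 'cV[R]_d)
    (edge : rel 'I_M) (W : 'M[R]_M) (lam : 'I_M -> R)
    (disp : measure_display) (Omega : measurableType disp)
    (P : probability Omega R)
    (Xi : 'I_M -> Type) (G : forall i : 'I_M, 'cV[R]_d -> Xi i -> 'cV[R]_d)
    (xi : nat -> nat -> forall i : 'I_M, nat -> Omega -> Xi i)
    (F : nat -> nat -> set (set Omega)),
  let f := average f_ in
  let K := num_epochs Delta0 eps in
  let N := fun s : nat => nat_ceil (budget_real M L mu sigma zeta rho eps) in
  let rad := epoch_radius mu Delta0 in
  let B := fun s : nat => block_length M L sigma zeta rho (rad s) (N s) in
  let T := fun s : nat => (N s %/ (M * B s))%N in
  let prm := fun s : nat => rule_params M L sigma rho (rad s) (T s) (B s) in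
  let z := fun w : Omega => (fun s t i b => xi s t i b w) in
  let U := fun (s : nat) (w : Omega) => restarted prm W G (z w) x0 s in
  let q := fun s t i (w : Omega) => query prm W G (z w) x0 s t i in
  let ans := fun s t i b (w : Omega) => G i (q s t i w) (xi s t i b w) in
  (* problem *)
  (0 < d)%N -> (0 < M)%N ->
  0 < L -> 0 < mu -> 0 <= sigma -> 0 <= zeta ->
  (forall i, convex_on_space (f_ i)) ->
  (forall i, L_smooth L (f_ i)) ->
  strongly_convex mu f ->
  (forall x, f xstar <= f x) ->
  (M%:R)^-1 * \sum_(i < M)
      enorm (gradient (f_ i) xstar - gradient f xstar) ^+ 2 <= zeta ^+ 2 ->
  (* gossip matrix *)
  symmetric edge ->
  gossip_matrix edge W ->
  ordered_spectrum W lam ->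
  0 < rho <= 1 ->
  (forall i : 'I_M, nat_of_ord i = 1%N -> rho <= 1 - lam i) ->
  (* accuracy and integrality of the horizons *)
  f x0 - f xstar <= Delta0 ->
  0 < eps <= Delta0 ->
  (forall s, (s < K)%N -> (M * B s %| N s)%N /\ (0 < T s)%N) ->
  (* F s t is the information available just before round t of epoch s *)
  (forall s t, sigma_algebra setT (F s t) /\ F s t `<=` measurable) ->
  (forall s t, (s < K)%N -> (t <= T s)%N -> F s t `<=` F s t.+1) ->
  (forall s, (s < K)%N -> F s (T s).+1 `<=` F s.+1 0%N) ->
  (forall s t i b, (s < K)%N -> (t <= T s)%N -> (b < B s)%N ->
     sigma_of (ans s t i b) `<=` F s t.+1) ->
  (* unbiased oracle, bounded conditional variance, conditional independence *)
  (forall s t i b, (s < K)%N -> (t <= T s)%N -> (b < B s)%N ->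
     forall k : 'I_d,
       cond_exp_version P (F s t) (fun w => ans s t i b w k 0)
         (fun w => gradient (f_ i) (q s t i w) k 0)) ->
  (forall s t i b, (s < K)%N -> (t <= T s)%N -> (b < B s)%N ->
     exists V : Omega -> R,
       cond_exp_version P (F s t)
         (fun w => enorm (ans s t i b w - gradient (f_ i) (q s t i w)) ^+ 2) V /\
       {ae P, forall w, V w <= sigma ^+ 2}) ->
  (forall s t, (s < K)%N -> (t <= T s)%N ->
     cond_independent P (F s t)
       (fun ib : 'I_M * 'I_(B s) => sigma_of (ans s t ib.1 ib.2))) ->
  [/\ (\big[maxe/-oo]_(i < M) 'E_P[fun w => (f (col i (U K w)) - f xstar)%R]
         <= eps%:E)%E,
      (\sum_(s < K) N s)%:R
        <= K%:R * (1 + budget_real M L mu sigma zeta rho eps) &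
      2 * eps <= Delta0 ->
      K%:R * (1 + budget_real M L mu sigma zeta rho eps)
        <= C * log_factor p
                 [:: eps; Delta0; mu; L; rho; M%:R; 1 + sigma; 1 + zeta]
           * (sigma ^+ 2 / (mu * eps)
              + M%:R * Num.sqrt (L / (mu * rho)) * ln (Delta0 / eps))].
Proof.
exists (2 / ln 2 * (2 + 2 ^+ 16 + 2 ^+ 18 * 115 ^+ 2)), 2%N.
move=> d M f_ L mu sigma zeta rho Delta0 eps x0 xstar edge W lam disp Omega P Xi G xi F.
move=> f K N rad B T prm z U q ans d0 M0 L0 mu0 sigma0 zeta0 cvx smooth sc xs_min het.
move=> _ gW spec rho01 lam1 gap0 eps0 dvdN sF FS FE ans_meas unbiased variance_le indep.
have epos : 0 < eps by case/andP: eps0.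
split.
- apply: bigmax_le => [|i _]; first exact: leNye.
  exact: (restarted_gap M0 L0 mu0 sigma0 zeta0 cvx smooth sc xs_min het gW spec rho01 lam1
    gap0 eps0 dvdN sF FS FE ans_meas unbiased variance_le indep).
- exact: nat_ceil_sum_le.
- apply: soft_O_complexity => //.
  exact: strong_le_smooth M0 L0 cvx smooth xs_min d0 mu0 sc.
Qed.
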